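(* Let $x_0\in\mathbb{R}^d$, $x_*$ a minimizer of $f$, $D_0:=\|x_0-x_*\|$, $\Omega:=\{x:\|x-x_*\|\le\sqrt3D_0\}$. Suppose $f$ is closed, twice continuously differentiable with $\inf f=f(x_* )=:f_*>-\infty$; for all $x,y\in\Omega$, $\|\nabla f(x)-\nabla f(y)\|\le L\|x-y\|$ and $\|\nabla f(x)\|^2\le2L(f(x)-f_* )$; for some $\alpha\ge4$ and $\boldsymbol\sigma\succeq0$, $\mathbb{E}_\xi|\nabla F(x;\xi)-\nabla f(x)|^\alpha\preceq\boldsymbol\sigma^\alpha$ for all $x\in\Omega$; $f$ is convex on $\Omega$ (i.e. $\langle\nabla f(x)-\nabla f(y),x-y\rangle\ge0$ and $f(y)\ge f(x)+\langle\nabla f(x),y-x\rangle$ for $x,y\in\Omega$); and $\|\nabla f(x)\|_\infty\le G_\infty$ on $\Omega$. Assume moreover $1-\beta_1=\Omega(1)$, $\big(\frac{D_0\|\boldsymbol\sigma\|_{2\alpha}^{\alpha}}{\varepsilon}\big)^{\frac1{\alpha-1}}\gtrsim G_\infty\vee\sigma_\infty$ and $K\gtrsim\log\frac{MT}{\delta}\Big(\frac{\|\boldsymbol\sigma\|_{2\alpha}d^{\frac12-\frac1{2\alpha}}}{\sigma}\Big)^{\frac{2\alpha}{\alpha-2}}$. Then, with $\eta,\rho$ chosen optimally, with probability at least $1-\delta$ Local SGDM yields $f(\hat x)-f_*\le\varepsilon$ if $$T\gtrsim\frac{D_0^2}{\varepsilon}\Big[L+\frac{\sigma^2}{M\varepsilon}\log\frac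 T\delta+\sqrt{\frac{L\sigma^2K\log\frac{MT}\delta}{\varepsilon}}+\sqrt{\frac{dL}{\varepsilon}}\Big(\frac{D_0\|\boldsymbol\sigma\|_{2\alpha}^\alpha}{\varepsilon}\Big)^{\frac1{\alpha-1}}\log\frac{MT}\delta\Big].$$ Equivalently, $$f(\hat x)-f_*\lesssim\frac{LD_0^2}{KR}+\frac{\sigma D_0}{\sqrt{MKR}}\log^{\frac12}\frac{KR}\delta+\frac{L^{\frac13}\sigma^{\frac23}D_0^{\frac43}}{K^{\frac13}R^{\frac23}}\log^{\frac13}\frac{MKR}\delta+\Big(\|\boldsymbol\sigma\|_{2\alpha}^{\frac{2\alpha}{\alpha-1}}dLD_0\Big)^{\frac{\alpha-1}{3\alpha-1}}D_0\Big(\frac{\log\frac{MKR}\delta}{KR}\Big)^{\frac{2(\alpha-1)}{3\alpha-1}}.$$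
   Context: Problem: minimize $f(x)=\mathbb{E}_{\xi\sim\mathcal D}[F(x;\xi)]$ over $\mathbb{R}^d$ with $M$ workers, each accessing an unbiased stochastic gradient oracle $\nabla F(x;\xi)$ with fresh independent $\xi$ at every call; $R$ rounds, $K$ local steps per round, $T=KR$, confidence $\delta\in(0,1)$, target $\varepsilon>0$. $\mathbf{clip}(X,\rho)$ is coordinatewise: $[\mathbf{clip}(X,\rho)]_i=\mathrm{sgn}(X_i)\min\{|X_i|,\rho\}$. Vector powers, $|\cdot|$ and $\preceq$ are coordinatewise. $\sigma_\infty:=\max_i\sigma_i$, $\sigma:=\|\boldsymbol\sigma\|_2$, $\|\cdot\|_{2\alpha}$ is the $\ell_{2\alpha}$-norm. Local SGDM (learning rate $\eta$, momentum $\beta_1\in[0,1)$, threshold $\rho$): $x_{0,0}^m=x_0$, $u_{0,-1}^m=0$; for each round $r$ and worker $m$, for $k=0,\dots,K-1$: $\widehat{g_{r,k}^m}=\mathbf{clip}(\nabla F(x_{r,k}^m;\xi_{r,k}^m),\rho)$, $u_{r,k}^m=\beta_1u_{r,k-1}^m+(1-\beta_1)\widehat{g_{r,k}^m}$, $x_{r,k+1}^m=x_{r,k}^m-\eta u_{r,k}^m$; then $x_{r+1,0}^m=\frac1M\sum_nx_{r,K}^n$, $u_{r+1,-1}^m=\frac1M\sum_nu_{r,K-1}^n$. With $t=rK+k$, $x_t^m:=x_{r,k}^m$, $\overline x_t:=\frac1M\sum_mx_t^m$, define $z_0^m=x_0$, $z_{t+1}^m=\frac{x_{t+1}^m-\beta_1x_t^m}{1-\beta_1}$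 if $t\bmod K\ne K-1$ and $z_{t+1}^m=\frac{x_{t+1}^m-\beta_1\overline x_t}{1-\beta_1}$ otherwise, $\overline z_t=\frac1M\sum_mz_t^m$. Output $\hat x=\frac1T\sum_{j=0}^{T-1}\overline z_j$. $a\gtrsim b$ means $a\ge Cb$ for an absolute constant $C$ large enough; $\lesssim$ and $\Omega(\cdot)$ hide absolute constants. *)

(* Defs.v *)
From HB Require Import structures.
From mathcomp Require Import all_boot all_order all_algebra.
From mathcomp Require Import all_classical all_reals all_analysis.
Set Implicit Arguments. Unset Strict Implicit. Unset Printing Implicit Defensive.
Import Order.TTheory GRing.Theory Num.Theory.
Import numFieldNormedType.Exports.
Local Open Scope classical_set_scope.
Local Open Scope ring_scope.

Section Defs.
Variable R : realType.

Definition evec (d : nat) (i : 'I_d) : 'rV[R]_d := delta_mx 0 i.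

Definition norm2 (d : nat) (v : 'rV[R]_d) : R := Num.sqrt (\sum_(i < d) v 0 i ^+ 2).
Definition inner (d : nat) (u v : 'rV[R]_d) : R := \sum_(i < d) u 0 i * v 0 i.
Definition lpnorm (d : nat) (p : R) (v : 'rV[R]_d) : R :=
  (\sum_(i < d) `|v 0 i| `^ p) `^ p^-1.
Definition linfnorm (d : nat) (v : 'rV[R]_d) : R := \big[Num.max/0]_(i < d) `|v 0 i|.

Definition partial (d : nat) (f : 'rV[R]_d -> R) (i : 'I_d) (x : 'rV[R]_d) : R :=
  'D_(evec i) f x.
Definition grad (d : nat) (f : 'rV[R]_d -> R) (x : 'rV[R]_d) : 'rV[R]_d :=
  \row_i partial f i x.

Definition C2 (d : nat) (f : 'rV[R]_d -> R) : Prop :=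
  continuous f /\
  (forall i x, derivable f x (evec i)) /\
  (forall i, continuous (partial f i)) /\
  (forall i j x, derivable (partial f i) x (evec j)) /\
  (forall i j, continuous (partial (partial f i) j)).

Definition clip (d : nat) (X : 'rV[R]_d) (rho : R) : 'rV[R]_d :=
  \row_i (Num.sg (X 0 i) * Num.min `|X 0 i| rho).

Definition avg (d M : nat) (xs : 'I_M -> 'rV[R]_d) : 'rV[R]_d :=
  (M%:R)^-1 *: \sum_(n < M) xs n.

Section LocalSGDM.
Variables (d M K : nat) (Xi : Type).
Variable g : 'rV[R]_d -> Xi -> 'rV[R]_d.       (* stochastic gradient oracle *)
Variables (x0 : 'rV[R]_d) (eta beta1 rho : R).
Variable s : 'I_M -> nat -> Xi.                (* s m t = xi_t^m, t = rK+k *)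

(* state at time t: (x_t^m, u_{t-1}^m) for every worker m *)
Fixpoint lsgdm_state (t : nat) : ('I_M -> 'rV[R]_d) * ('I_M -> 'rV[R]_d) :=
  match t with
  | 0 => (fun _ => x0, fun _ => 0)
  | t'.+1 =>
    let xs := (lsgdm_state t').1 in
    let us := (lsgdm_state t').2 in
    let u' := fun m => beta1 *: us m + (1 - beta1) *: clip (g (xs m) (s m t')) rho in
    let x' := fun m => xs m - eta *: u' m in
    if (t' %% K == K.-1)%N then (fun _ => avg x', fun _ => avg u')
    else (x', u')
  end.

Definition lsgdm_x (t : nat) (m : 'I_M) : 'rV[R]_d := (lsgdm_state t).1 m.
Definition lsgdm_xbar (t : nat) : 'rV[R]_d := avg (lsgdm_x t).

Definition lsgdm_z (t : nat) (m : 'I_M) : 'rV[R]_d :=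
  match t with
  | 0 => x0
  | t'.+1 =>
    (1 - beta1)^-1 *:
      (lsgdm_x t'.+1 m - beta1 *:
         (if (t' %% K == K.-1)%N then lsgdm_xbar t' else lsgdm_x t' m))
  end.
Definition lsgdm_zbar (t : nat) : 'rV[R]_d := avg (lsgdm_z t).

Definition lsgdm_output (T : nat) : 'rV[R]_d :=
  (T%:R)^-1 *: \sum_(j < T) lsgdm_zbar j.
End LocalSGDM.

Definition mutually_independent (dO : measure_display) (Om : measurableType dO)
    (P : probability Om R) (dX : measure_display) (Xi : measurableType dX)
    (I : eqType) (X : I -> Om -> Xi) : Prop :=
  forall (s : seq I), uniq s ->
  forall B : I -> set Xi, (forall i, measurable (B i)) ->
  P (\big[setI/setT]_(i <- s) (X i @^-1` B i)) =
  (\prod_(i <- s) P (X i @^-1` B i))%E.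

(* joint measurability of the oracle (x, xi) |-> g x xi, stated through
   compositions with measurable maps *)
Definition oracle_measurable (d : nat) (dX : measure_display) (Xi : measurableType dX)
    (g : 'rV[R]_d -> Xi -> 'rV[R]_d) : Prop :=
  forall (dT : measure_display) (T : measurableType dT)
         (X : T -> 'rV[R]_d) (Y : T -> Xi),
  (forall i, measurable_fun setT (fun w => X w 0 i)) ->
  measurable_fun setT Y ->
  forall i, measurable_fun setT (fun w => g (X w) (Y w) 0 i).

End Defs.

(* Main.v *)
Require Import Defs.
From HB Require Import structures.
From mathcomp Require Import all_boot all_order all_algebra.
From mathcomp Require Import all_classical all_reals all_analysis.
From mathcomp Require Import measurable_realfun ring lra.
Set Implicit Arguments. Unset Strict Implicit. Unset Printing Implicit Defensive.
Import Order.TTheory GRing.Theory Num.Theory.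
Import numFieldNormedType.Exports.
Local Open Scope classical_set_scope.
Local Open Scope ring_scope.

(** Write [zb] for the averaged auxiliary iterate: [zb_(t+1) = zb_t - eta * avg_m gh_t^m], where
    [gh] is the clipped gradient, so the squared distance of [zb] to [xstar] decreases by
    [eta (f(zb) - f(xstar))] up to a clipping bias, a martingale noise term and the drift
    [x^m - zb].  Within a round the difference of two workers is controlled through the potential
    [|dz|^2 + a |dz - dx|^2]: cocoercivity of the gradient absorbs the deterministic part, however
    large [eta L K] is, and only noise remains.  Both noise sums are bounded by Freedman's
    inequality, applied to increments switched off as soon as an iterate leaves the region where
    the bounds hold; on the intersection of these events an induction on time shows that nothing
    is ever switched off.  The clipping level is [8 (A + sig sqrt(K / LMT) / sqrt d)]: the first
    term makes the bias harmless for the distance to [xstar]; the second one is the largest level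
    whose range does not exceed the standard deviation accumulated over a round, and the condition
    on [K] says that at this level the bias accumulated over a round is dominated as well.  When
    [x0] is already [eps]-optimal, a tiny step size works. *)

(** * Independence and Fubini *)

(** The obstacle is the disagreement of the workers within a round: a crude bound on it grows with
    [eta * L * K], which the horizon does not keep small. Cocoercivity removes this growth, but it
    acts at the points [x], while the steps are those of [z]; the term [|dz - dx|^2], a multiple of
    the squared momentum difference, pays for the mismatch because it contracts at every step.
    Smoothness, convexity and the moment bounds hold only on a ball, and cocoercivity needs room
    around the iterates, hence the radii 3/2 < 17/10 < sqrt 3 (in units of [D0]). Raising the
    clipping level above [A] costs nothing: the horizon term with [K] already pays for it. Two
    confidence levels are kept apart so that the variance term carries [ln (T / delta)] only: the
    averaged process needs a union over [T] times, the pairs of workers one over [T * M * M] events.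
    The step size [2 D0^2 / (eps T)] is tied to the bound [2 D0^2] on the squared distance plus the
    telescoped gaps: dividing by [eta T] returns exactly [eps]. *)

Section Independence.
Context {R : realType} {dO : measure_display} {Om : measurableType dO}.
Variable P : probability Om R.

(** As functions of [A], both sides are finite measures: [P] restricted to [B] and [P] scaled by
    [P B]. They agree on the pi-system [G], so uniqueness of measures extends the identity to the
    generated sigma-algebra. *)
Lemma indep_sigma_left (G : set (set Om)) (B : set Om) :
  G `<=` measurable -> setI_closed G -> G setT -> measurable B ->
  (forall A, G A -> P (A `&` B) = P A * P B)%E ->
  forall A, <<s G >> A -> (P (A `&` B) = P A * P B)%E.
Proof.
move=> Gm GI GT mB GB A sA.
have PB : (P B \is a fin_num)%E by exact: fin_num_measure.
have r0 : (0 <= fine (P B)) by exact: fine_ge0.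
have cov : \bigcup_(k in [set: nat]) [set: Om] = setT by rewrite bigcup_const//; exists 0%N.
have mE C : (mscale (NngNum r0) P C = P C * P B)%E.
  by rewrite /mscale /= fineK// muleC.
rewrite -mE; change (mrestr P mB A = mscale (NngNum r0) P A).
apply: (@g_sigma_algebra_measure_unique _ R Om G Gm (fun=> setT) (fun=> GT) cov
  (mrestr P mB) (mscale (NngNum r0) P) GI _ _ A sA).
- by move=> A0 GA0; rewrite [RHS]mE -GB.
- by move=> k; rewrite /= /mrestr setTI ltey_eq PB.
Qed.

Lemma indep_sigma (G H : set (set Om)) :
  G `<=` measurable -> setI_closed G -> G setT ->
  H `<=` measurable -> setI_closed H -> H setT ->
  (forall A B, G A -> H B -> P (A `&` B) = P A * P B)%E ->
  forall A B, <<s G >> A -> <<s H >> B -> (P (A `&` B) = P A * P B)%E.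
Proof.
move=> Gm GI GT Hm HI HT GH A B sA sB.
have sGm : <<s G >> `<=` measurable.
  by apply: smallest_sub => //; exact: sigma_algebra_measurable.
rewrite setIC muleC; apply: (@indep_sigma_left H) => //; first exact: sGm.
move=> B0 HB0; rewrite setIC muleC; apply: (@indep_sigma_left G) => //.
  exact: Hm.
by move=> A0 GA0; exact: GH.
Qed.

(** The joint law of [X] and [Y] is the product of their laws, since both agree on rectangles;
    Tonelli and changes of variables then bring the double integral back to [Om]. *)
Lemma indep_ge0_integral (d1 d2 : measure_display) (T1 : measurableType d1)
    (T2 : measurableType d2) (X : Om -> T1) (Y : Om -> T2)
    (phi : T1 * T2 -> \bar R) :
  measurable_fun setT X -> measurable_fun setT Y ->
  (forall A B, measurable A -> measurable B ->
     P (X @^-1` A `&` Y @^-1` B) = P (X @^-1` A) * P (Y @^-1` B))%E ->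
  measurable_fun setT phi -> (forall z, 0 <= phi z)%E ->
  (\int[P]_w phi (X w, Y w) = \int[P]_w \int[P]_w' phi (X w, Y w'))%E.
Proof.
move=> mX mY XY mphi phi0.
pose Xm : {mfun Om >-> T1} := HB.pack X (isMeasurableFun.Build _ _ _ _ _ mX).
pose Ym : {mfun Om >-> T2} := HB.pack Y (isMeasurableFun.Build _ _ _ _ _ mY).
have mXY : measurable_fun setT (fun w => (X w, Y w)) by exact: measurable_fun_pair.
pose XYm : {mfun Om >-> (T1 * T2)%type} :=
  HB.pack (fun w => (X w, Y w)) (isMeasurableFun.Build _ _ _ _ _ mXY).
pose PX : probability T1 R := distribution P Xm.
pose PY : probability T2 R := distribution P Ym.
pose PXY : probability _ R := distribution P XYm.
have E : forall Z, measurable Z -> (PX \x PY)%E Z = PXY Z.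
  apply: product_measure_unique => A B mA mB /=.
  rewrite /PX /PY /PXY /distribution /pushforward /= -XY//; congr (P _).
transitivity (\int[PXY]_z phi z)%E.
  by rewrite ge0_integral_pushforward.
transitivity (\int[(PX \x PY)%E]_z phi z)%E.
  by apply: eq_measure_integral => A mA _; exact/esym/E.
rewrite fubini_tonelli1//= ge0_integral_pushforward//=.
- apply: eq_integral => w _ /=; rewrite /fubini_F ge0_integral_pushforward//=.
  exact: measurableT_comp.
- exact: measurable_fun_fubini_tonelli_F.
- by move=> x _; exact: integral_ge0.
Qed.

End Independence.

(** * Exponential moments of bounded variables *)

Section BoundedExpectation.
Context {R : realType} {d : measure_display} {T : measurableType d}.
Variable P : probability T R.

(** Stable under the algebraic operations and contained in the integrable functions, so
    integrability of the clipped quantities never has to be argued separately. *)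
Definition bmeas (f : T -> R) : Prop :=
  measurable_fun setT f /\ exists c, forall w, `|f w| <= c.

Lemma bmeas_cst c : bmeas (fun=> c).
Proof. by split; [exact: measurable_cst | exists `|c|]. Qed.

Lemma bmeasD f g : bmeas f -> bmeas g -> bmeas (fun w => f w + g w).
Proof.
move=> [mf [a fa]] [mg [b gb]]; split; first exact: measurable_funD.
by exists (a + b) => w; rewrite (le_trans (ler_normD _ _))// lerD.
Qed.

Lemma bmeasM f g : bmeas f -> bmeas g -> bmeas (fun w => f w * g w).
Proof.
move=> [mf [a fa]] [mg [b gb]]; split; first exact: measurable_funM.
by exists (a * b) => w; rewrite normrM ler_pM.
Qed.

Lemma bmeasZ c f : bmeas f -> bmeas (fun w => c * f w).
Proof. by move=> bf; apply: bmeasM => //; exact: bmeas_cst. Qed.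

Lemma bmeasX2 f : bmeas f -> bmeas (fun w => f w ^+ 2).
Proof. by move=> bf; exact: bmeasM. Qed.

Lemma bmeas_sum (I : Type) (s : seq I) (f : I -> T -> R) :
  (forall i, bmeas (f i)) -> bmeas (fun w => \sum_(i <- s) f i w).
Proof.
move=> bf; elim: s => [|i s IH].
  rewrite (_ : (fun w => _) = fun=> 0); first exact: bmeas_cst.
  by apply/funext => w; rewrite big_nil.
rewrite (_ : (fun w => _) = fun w => f i w + \sum_(i <- s) f i w).
  exact: bmeasD.
by apply/funext => w; rewrite big_cons.
Qed.

Lemma bmeas_integrable f : bmeas f -> P.-integrable setT (EFin \o f).
Proof.
move=> [mf [c fc]]; apply: (@le_integrable _ _ _ _ _ _ _ (EFin \o cst c)) => //.
- exact/measurable_EFinP.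
- move=> x _ /=; rewrite lee_fin (le_trans (fc x))// ler_norm //.
- exact: finite_measure_integrable_cst.
Qed.

Lemma RexpectD f g : bmeas f -> bmeas g ->
  \int[P]_w (f w + g w) = \int[P]_w f w + \int[P]_w g w.
Proof. by move=> bf bg; rewrite RintegralD//; exact: bmeas_integrable. Qed.

Lemma RexpectZ c f : bmeas f -> \int[P]_w (c * f w) = c * \int[P]_w f w.
Proof. by move=> bf; rewrite RintegralZl//; exact: bmeas_integrable. Qed.

Lemma Rexpect_cst c : \int[P]_w c = c.
Proof. by rewrite Rintegral_cst//= (_ : fine _ = 1) ?mulr1// [X in fine X]probability_setT. Qed.

Lemma le_Rexpect f g : bmeas f -> bmeas g -> (forall w, f w <= g w) ->
  \int[P]_w f w <= \int[P]_w g w.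
Proof.
by move=> bf bg fg; apply: le_Rintegral => //; exact: bmeas_integrable.
Qed.

Lemma Rexpect_sum (I : Type) (s : seq I) (f : I -> T -> R) :
  (forall i, bmeas (f i)) ->
  \int[P]_w (\sum_(i <- s) f i w) = \sum_(i <- s) \int[P]_w f i w.
Proof.
move=> bf; elim: s => [|i s IH].
  rewrite big_nil -[RHS]Rexpect_cst; apply: eq_Rintegral => w _.
  by rewrite big_nil.
rewrite big_cons -IH -RexpectD//; last exact: bmeas_sum.
by apply: eq_Rintegral => w _; rewrite big_cons.
Qed.

Lemma bmeas_EFin_Rintegral f : bmeas f ->
  (\int[P]_w (f w)%:E = (\int[P]_w f w)%:E)%E.
Proof.
move=> bf; rewrite /Rintegral fineK//; apply: integrable_fin_num => //.
exact: bmeas_integrable.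
Qed.

(** From [expR (- x) >= 1 - x] one gets [expR x <= 1 / (1 - x)], and [(1 + x + 2 x^2) (1 - x) - 1 =
    2 x^2 (1/2 - x)]. The estimate is one-sided: [x] may be arbitrarily negative. *)
Lemma expR_le_quad (x : R) : x <= 2^-1 -> expR x <= 1 + x + 2 * x ^+ 2.
Proof.
move=> x12; have x1 : 0 < 1 - x by lra.
have H : expR x <= (1 - x)^-1.
  rewrite -[expR x]invrK -expRN lef_pV2 ?posrE ?expR_gt0//.
  by rewrite (le_trans _ (expR_ge1Dx _)).
apply: (le_trans H); rewrite -[leLHS]mul1r ler_pdivrMr//.
have : 0 <= x ^+ 2 * (2^-1 - x) by rewrite mulr_ge0 ?sqr_ge0// subr_ge0.
rewrite !expr2; lra.
Qed.

(** The quadratic bound on [expR] is integrated, then [1 + y <= expR y] closes up. The second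
    moment, not the squared range, enters the exponent; this makes the later tail bounds of
    Bernstein type. *)
Lemma mgf_le (X : T -> R) (a v : R) : bmeas X -> (forall w, X w <= 2^-1) ->
  \int[P]_w X w <= a -> \int[P]_w X w ^+ 2 <= v ->
  (\int[P]_w (expR (X w))%:E <= (expR (a + 2 * v))%:E)%E.
Proof.
move=> bX X12 Ea Ev.
have bQ : bmeas (fun w => 1 + X w + 2 * X w ^+ 2).
  by apply: bmeasD; [apply: bmeasD => //; exact: bmeas_cst |
    apply: bmeasZ; exact: bmeasX2].
apply: (@le_trans _ _ (\int[P]_w (1 + X w + 2 * X w ^+ 2)%:E)%E).
  apply: ge0_le_integral => //.
  - by apply/measurable_EFinP; apply: measurableT_comp => //; case: bX.
  - by apply/measurable_EFinP; case: bQ.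
  - by move=> w _; rewrite lee_fin expR_le_quad.
rewrite bmeas_EFin_Rintegral// lee_fin.
have b2 := bmeasX2 bX.
rewrite RexpectD//; [|by apply: bmeasD => //; exact: bmeas_cst |exact: bmeasZ].
rewrite RexpectZ// RexpectD//; last exact: bmeas_cst.
rewrite Rexpect_cst (le_trans _ (expR_ge1Dx _))//; lra.
Qed.

Lemma markov_expR (S : T -> R) (C y l : R) : measurable_fun setT S ->
  (\int[P]_w (expR (S w))%:E <= (expR C)%:E)%E -> C + l <= y ->
  (P [set w | (y < S w)%R] <= (expR (- l))%:E)%E.
Proof.
move=> mS SC ly.
have mA : measurable [set w | y < S w].
  rewrite (_ : [set w | _] = S @^-1` `]y, +oo[%classic).
    by rewrite -[X in measurable X]setTI; exact: mS.
  by apply/seteqP; split => w /=; rewrite in_itv /= andbT.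
have : ((expR y)%:E * P [set w | (y < S w)%R] <= (expR C)%:E)%E.
  apply: le_trans SC.
  rewrite -[X in (_ * P X <= _)%E]setIT -integral_indic// -ge0_integralZl//.
  - apply: ge0_le_integral => //.
    + by apply: measurable_funeM; apply/measurable_EFinP.
    + by apply/measurable_EFinP; apply: measurableT_comp.
    + move=> w _; rewrite indicE -EFinM lee_fin.
      case: (boolP (w \in _)) => [/set_mem /= yS|_]; last by rewrite mulr0 expR_ge0.
      by rewrite mulr1 ler_expR ltW.
  - by apply/measurable_EFinP.
have Pf : (P [set w | (y < S w)%R] \is a fin_num)%E by exact: fin_num_measure.
rewrite -(fineK Pf) -EFinM !lee_fin => H.
rewrite -(@ler_pM2l _ (expR y)) ?expR_gt0// (le_trans H)// -expRD ler_expR; lra.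
Qed.

End BoundedExpectation.

(** * The sample filtration and Freedman's inequality *)

Section Filtration.
Context {R : realType} {dX : measure_display} {Xi : measurableType dX}.
Context {dO : measure_display} {Om : measurableType dO}.
Variables (P : probability Om R) (M : nat) (xi : 'I_M -> nat -> Om -> Xi).
Hypothesis mxi : forall m t, measurable_fun setT (xi m t).
Hypothesis xi_indep : mutually_independent P (fun p : 'I_M * nat => xi p.1 p.2).

Definition cylinders (I : seq ('I_M * nat)) : set (set Om) :=
  [set A | exists B : 'I_M * nat -> set Xi, (forall i, measurable (B i)) /\
     A = \big[setI/setT]_(i <- I) (xi i.1 i.2 @^-1` B i)].

Definition past (t : nat) : seq ('I_M * nat) :=
  [seq (m, s) | m <- enum 'I_M, s <- iota 0 t].
Definition present (t : nat) : seq ('I_M * nat) := [seq (m, t) | m <- enum 'I_M].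

(** The set [Om] with the sigma-algebra generated by the samples indexed by [I]; depending only on
    these samples becomes measurability of a map out of [info I]. *)
Definition info (I : seq ('I_M * nat)) := g_sigma_algebraType (cylinders I).
HB.instance Definition _ I := Measurable.on (info I).

Lemma mem_past m s t : ((m, s) \in past t) = (s < t)%N.
Proof.
apply/allpairsP/idP => [[[m' s'] /= [_ + [_ ->]]]|st].
  by rewrite mem_iota.
by exists (m, s); rewrite mem_enum mem_iota.
Qed.

Lemma mem_present m s t : ((m, s) \in present t) = (s == t).
Proof.
apply/mapP/eqP => [[m' _ [_ ->]]//|->].
by exists m; rewrite ?mem_enum.
Qed.

Lemma past_present_uniq t : uniq (past t ++ present t).
Proof.
rewrite cat_uniq; apply/and3P; split.
- by apply: allpairs_uniq; rewrite ?enum_uniq ?iota_uniq// => -[a b] [a' b'] _ _.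
- by apply/hasPn => -[m s]; rewrite mem_present mem_past => /eqP ->; rewrite ltnn.
- by rewrite map_inj_uniq ?enum_uniq// => a b [].
Qed.

Lemma cylinders_measurable I : cylinders I `<=` measurable.
Proof.
move=> _ [B [mB ->]]; apply: bigsetI_measurable => i _.
by rewrite -[X in measurable X]setTI; exact: mxi.
Qed.

Lemma cylindersT I : cylinders I setT.
Proof.
exists (fun=> setT); split => //.
by elim: I => [|i I IH]; rewrite ?big_nil// big_cons -IH setIT preimage_setT.
Qed.

Lemma cylindersI I : setI_closed (cylinders I).
Proof.
move=> _ _ [B [mB ->]] [C [mC ->]].
exists (fun i => B i `&` C i); split; first by move=> i; exact: measurableI.
by rewrite -big_split; apply: eq_bigr => i _; rewrite preimage_setI.
Qed.

(** The two families of events are merged into one family indexed by [I ++ J]; mutual independence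
    is then used for [I ++ J], for [I] and for [J]. *)
Lemma cylinders_indep I J A B : uniq (I ++ J) ->
  cylinders I A -> cylinders J B -> (P (A `&` B) = P A * P B)%E.
Proof.
move=> uIJ [B1 [mB1 ->]] [B2 [mB2 ->]].
have [uI _ uJ] : [/\ uniq I, True & uniq J].
  by move: uIJ; rewrite cat_uniq => /and3P[].
pose C i := if i \in I then B1 i else B2 i.
have mC i : measurable (C i) by rewrite /C; case: ifP.
have CI : \big[setI/setT]_(i <- I) (xi i.1 i.2 @^-1` B1 i) =
          \big[setI/setT]_(i <- I) (xi i.1 i.2 @^-1` C i).
  by apply: eq_big_seq => i iI; rewrite /C iI.
have CJ : \big[setI/setT]_(i <- J) (xi i.1 i.2 @^-1` B2 i) =
          \big[setI/setT]_(i <- J) (xi i.1 i.2 @^-1` C i).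
  apply: eq_big_seq => i iJ; rewrite /C ifN//.
  move: uIJ; rewrite cat_uniq => /and3P[_ /hasPn /(_ _ iJ) //].
by rewrite CI CJ -big_cat (xi_indep uIJ mC) big_cat/= !xi_indep.
Qed.

Lemma measurable_info (d : measure_display) (T : measurableType d) I
    (f : T -> Om) :
  (forall i, i \in I -> measurable_fun setT (fun w => xi i.1 i.2 (f w))) ->
  measurable_fun setT (f : T -> info I).
Proof.
move=> mf; apply: (@measurability _ _ _ (info I) _ _ (cylinders I)) => //.
move=> _ [_ [B [mB ->]] <-]; rewrite setTI.
elim: I mf => [|i I IH] mf; first by rewrite big_nil preimage_setT.
rewrite big_cons preimage_setI; apply: measurableI.
  have := mf i (mem_head _ _) measurableT _ (mB i).
  by rewrite setTI.
by apply: IH => j jI; apply: mf; rewrite inE jI orbT.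
Qed.

Lemma measurable_xi_info I m s : (m, s) \in I ->
  measurable_fun setT (xi m s : info I -> Xi).
Proof.
move=> msI _ B mB; rewrite setTI; apply: sub_sigma_algebra.
exists (fun i => if i == (m, s) then B else setT); split.
  by move=> i; case: ifP.
apply/seteqP; split => [w Bw|w].
  rewrite -bigcap_seq => i _ /=; case: eqP => [->|//]; exact: Bw.
by rewrite -bigcap_seq => /(_ _ msI) /=; rewrite eqxx.
Qed.

Lemma measurable_id_info I : measurable_fun setT (id : Om -> info I).
Proof. by apply: measurable_info => i _; exact: mxi. Qed.

Lemma measurable_of_info (d : measure_display) (T : measurableType d) I
    (f : Om -> T) :
  measurable_fun setT (f : info I -> T) -> measurable_fun setT f.
Proof.
move=> mf _ B mB; have := measurable_id_info measurableT (mf measurableT _ mB).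
by rewrite !setTI.
Qed.

Lemma measurable_info_sub I J : {subset I <= J} ->
  measurable_fun setT (id : info J -> info I).
Proof.
move=> IJ; apply: measurable_info => -[m s] iI /=.
by apply: measurable_xi_info; exact: IJ.
Qed.

(** The identity of [Om], read once with values in [info (past t)] and once in [info (present t)],
    gives two independent random elements, because the two pi-systems of cylinders are
    independent. *)
Lemma fresh_ge0_integral t
    (phi : info (past t) * info (present t) -> \bar R) :
  measurable_fun setT phi -> (forall z, 0 <= phi z)%E ->
  (\int[P]_w phi (w, w) = \int[P]_w \int[P]_w' phi (w, w'))%E.
Proof.
move=> mphi phi0.
apply: (@indep_ge0_integral _ _ _ P _ _ (info (past t)) (info (present t)) id id)
  => //; try exact: measurable_id_info.
move=> A B mA mB; rewrite !preimage_id.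
apply: (@indep_sigma _ _ _ P (cylinders (past t)) (cylinders (present t))) => //.
- exact: cylinders_measurable.
- exact: cylindersI.
- exact: cylindersT.
- exact: cylinders_measurable.
- exact: cylindersI.
- exact: cylindersT.
- by move=> A' B' cA cB; exact: cylinders_indep (past_present_uniq t) cA cB.
Qed.

(* The pair [(w, w')] separates the samples seen before time [t] (read off [w])
   from the fresh ones of time [t] (read off [w']): by independence, integrating
   over [w'] computes the conditional expectation given the past. *)
Definition fresh_meas t (X : Om -> Om -> R) : Prop :=
  measurable_fun setT
    (fun p : info (past t) * info (present t) => X p.1 p.2).

Lemma fresh_meas_prod t X : fresh_meas t X ->
  measurable_fun setT (fun p : Om * Om => X p.1 p.2).
Proof.
move=> mX.
have mp : measurable_fun setT (fun p : Om * Om =>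
    ((p.1 : info (past t)), (p.2 : info (present t)))).
  apply: measurable_fun_pair.
    by apply: measurable_info => i _; apply: (measurableT_comp (mxi _ _)); exact: measurable_fst.
  by apply: measurable_info => i _; apply: (measurableT_comp (mxi _ _)); exact: measurable_snd.
exact: (measurableT_comp mX mp).
Qed.

Lemma fresh_meas_section t X w : fresh_meas t X -> measurable_fun setT (X w).
Proof.
move=> /fresh_meas_prod mX.
have mp : measurable_fun setT (fun w' : Om => (w, w')).
  by apply: measurable_fun_pair; [exact: measurable_cst|exact: measurable_id].
exact: (measurableT_comp mX mp).
Qed.

Definition partial_sum (X : nat -> Om -> Om -> R) a b (w : Om) : R :=
  \sum_(a <= s < b) X s w w.

Lemma partial_sum_meas (X : nat -> Om -> Om -> R) a b :
  (forall t, fresh_meas t (X t)) ->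
  measurable_fun setT (partial_sum X a b : info (past b) -> R).
Proof.
move=> mX; rewrite /partial_sum.
(* The sigma-algebra stays that of the past of [b] while the induction runs over the upper limit
   [c]. *)
suff H c : (c <= b)%N ->
    measurable_fun setT (fun w : info (past b) => \sum_(a <= s < c) X s w w).
  exact: H.
move=> cb; elim: c cb => [|c IH] cb.
  rewrite (_ : (fun w => _) = fun=> 0); first exact: measurable_cst.
  by apply/funext => w; rewrite big_geq.
have [ac|ca] := leqP a c; last first.
  rewrite (_ : (fun w => _) = fun=> 0); first exact: measurable_cst.
  by apply/funext => w; rewrite big_geq.
rewrite (_ : (fun w => _) = (fun w => (\sum_(a <= s < c) X s w w) + X c w w)).
  apply: measurable_funD; first by apply: IH; exact: ltnW.
  have mp : measurable_fun setT (fun w : info (past b) =>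
      ((w : info (past c)), (w : info (present c)))).
    apply: measurable_fun_pair; apply: measurable_info_sub => -[m s].
      by rewrite !mem_past => /ltn_trans; apply.
    by rewrite mem_present mem_past => /eqP ->.
  exact: (measurableT_comp (mX c) mp).
by apply/funext => w; rewrite big_nat_recr.
Qed.

(** The last increment is peeled off: integrating its fresh samples for a frozen past [w] bounds its
    factor by [expR c]. The hypothesis, required for every [w], plays the role of an almost sure
    bound on a conditional expectation. *)
Lemma exp_supermartingale (X : nat -> Om -> Om -> R) (c : R) a b :
  (a <= b)%N -> (forall t, fresh_meas t (X t)) ->
  (forall t w, (a <= t < b)%N ->
     \int[P]_w' (expR (X t w w'))%:E <= (expR c)%:E)%E ->
  (\int[P]_w (expR (partial_sum X a b w))%:E <= (expR ((b - a)%:R * c))%:E)%E.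
Proof.
move=> ab mX; rewrite -(subnKC ab); move: (b - a)%N => n {b ab} Xc.
rewrite addKn.
elim: n Xc => [|n IH] Xc.
  rewrite addn0 mul0r expR0.
  under eq_integral do rewrite /partial_sum big_geq// expR0.
  by rewrite integral_cst//= mul1e probability_le1.
have mS := @partial_sum_meas X a (a + n)%N mX.
have mS' : measurable_fun setT (partial_sum X a (a + n)%N).
  exact: measurable_of_info mS.
pose phi (p : info (past (a + n)%N) * info (present (a + n)%N)) : \bar R :=
  (expR (partial_sum X a (a + n)%N p.1) * expR (X (a + n)%N p.1 p.2))%:E.
have mphi : measurable_fun setT phi.
  apply/measurable_EFinP; apply: measurable_funM.
    apply: measurableT_comp => //.
    by apply: (measurableT_comp mS); exact: measurable_fst.
  by apply: measurableT_comp => //; exact: mX.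
have phi0 z : (0 <= phi z)%E by rewrite lee_fin mulr_ge0 ?expR_ge0.
have -> : (\int[P]_w (expR (partial_sum X a (a + n.+1)%N w))%:E =
           \int[P]_w phi (w, w))%E.
  apply: eq_integral => w _; rewrite /phi /= -expRD /partial_sum addnS.
  by rewrite big_nat_recr ?leq_addr.
rewrite (fresh_ge0_integral mphi phi0).
apply: (@le_trans _ _
  (\int[P]_w ((expR (partial_sum X a (a + n)%N w))%:E * (expR c)%:E))%E).
  apply: ge0_le_integral => //.
  - by move=> w _; apply: integral_ge0.
  - pose phi' (p : Om * Om) : \bar R :=
      (expR (partial_sum X a (a + n)%N p.1) * expR (X (a + n)%N p.1 p.2))%:E.
    apply: (@measurable_fun_fubini_tonelli_F _ _ _ _ _ P phi') => //.
    apply/measurable_EFinP; apply: measurable_funM; apply: measurableT_comp => //.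
      by apply: (measurableT_comp mS'); exact: measurable_fst.
    exact: fresh_meas_prod (mX _).
  - apply/measurable_EFinP; apply: measurable_funM => //.
    exact: measurableT_comp.
  - move=> w _; rewrite /phi /=.
    under eq_integral do rewrite EFinM.
    rewrite ge0_integralZl//.
      by apply: lee_wpmul2l => //; apply: Xc; rewrite leq_addr addnS ltnSn.
    apply/measurable_EFinP; apply: measurableT_comp => //.
    exact: fresh_meas_section (mX _).
rewrite ge0_integralZr//; last by apply/measurable_EFinP; exact: measurableT_comp.
rewrite -natr1 mulrDl mul1r expRD EFinM lee_wpmul2r//.
by apply: IH => t w /andP[at_ tn]; apply: Xc; rewrite at_ (ltn_trans tn)// addnS.
Qed.

(** In this Chernoff form the scale of the exponential is already absorbed in [X], and [c] carries
    the conditional variance; the usual shape of the inequality appears once [c] is computed. *)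
Lemma freedman (X : nat -> Om -> Om -> R) (c l y : R) a b :
  (a <= b)%N -> (forall t, fresh_meas t (X t)) ->
  (forall t w, (a <= t < b)%N ->
     \int[P]_w' (expR (X t w w'))%:E <= (expR c)%:E)%E ->
  (b - a)%:R * c + l <= y ->
  (P [set w | (y < partial_sum X a b w)%R] <= (expR (- l))%:E)%E.
Proof.
move=> ab mX Xc ly; apply: markov_expR ly; last exact: exp_supermartingale.
by apply: (@measurable_of_info _ _ (past b)); exact: partial_sum_meas.
Qed.

End Filtration.

(** * Euclidean geometry *)

Section Euclidean.
Context {R : realType} {d : nat}.
Implicit Types u v w : 'rV[R]_d.

Lemma innerC u v : inner u v = inner v u.
Proof. by apply: eq_bigr => i _; rewrite mulrC. Qed.

Lemma innerDl u v w : inner (u + v) w = inner u w + inner v w.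
Proof. by rewrite -big_split; apply: eq_bigr => i _; rewrite !mxE mulrDl. Qed.

Lemma innerZl a u v : inner (a *: u) v = a * inner u v.
Proof. by rewrite mulr_sumr; apply: eq_bigr => i _; rewrite !mxE mulrA. Qed.

Lemma innerDr u v w : inner w (u + v) = inner w u + inner w v.
Proof. by rewrite innerC innerDl !(innerC w). Qed.

Lemma innerZr a u v : inner v (a *: u) = a * inner v u.
Proof. by rewrite innerC innerZl innerC. Qed.

Lemma innerNl u v : inner (- u) v = - inner u v.
Proof. by rewrite -scaleN1r innerZl mulN1r. Qed.

Lemma innerNr u v : inner v (- u) = - inner v u.
Proof. by rewrite innerC innerNl innerC. Qed.

Lemma inner0l v : inner 0 v = 0.
Proof. by rewrite -(scale0r 0) innerZl mul0r. Qed.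

Lemma inner0r v : inner v 0 = 0.
Proof. by rewrite innerC inner0l. Qed.

Definition innerE := (innerDl, innerDr, innerZl, innerZr, innerNl, innerNr).

Lemma inner_ge0 v : 0 <= inner v v.
Proof. by apply: sumr_ge0 => i _; rewrite -expr2 sqr_ge0. Qed.

Lemma inner_suml (I : Type) (s : seq I) (F : I -> 'rV[R]_d) v :
  inner (\sum_(i <- s) F i) v = \sum_(i <- s) inner (F i) v.
Proof.
by elim: s => [|i s IH]; rewrite ?big_nil ?inner0l// !big_cons innerDl IH.
Qed.

Lemma inner_sumr (I : Type) (s : seq I) (F : I -> 'rV[R]_d) v :
  inner v (\sum_(i <- s) F i) = \sum_(i <- s) inner v (F i).
Proof. by rewrite innerC inner_suml; apply: eq_bigr => i _; rewrite innerC. Qed.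

Lemma norm2_ge0 v : 0 <= norm2 v.
Proof. exact: sqrtr_ge0. Qed.

Lemma norm2_sqr v : norm2 v ^+ 2 = inner v v.
Proof.
rewrite sqr_sqrtr; last by apply: sumr_ge0 => i _; rewrite sqr_ge0.
by apply: eq_bigr => i _; rewrite expr2.
Qed.

Lemma norm2_le v (c : R) : 0 <= c -> (norm2 v <= c) = (inner v v <= c ^+ 2).
Proof. by move=> c0; rewrite -norm2_sqr ler_pXn2r ?nnegrE ?norm2_ge0. Qed.

Lemma norm20 : norm2 (0 : 'rV[R]_d) = 0.
Proof. by apply/eqP; rewrite -[_ == 0](@expf_eq0 _ _ 2) norm2_sqr inner0l. Qed.

Lemma norm2_eq0 v : norm2 v = 0 -> v = 0.
Proof.
move=> v0; have := norm2_sqr v; rewrite v0 expr0n /= => /esym /eqP.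
rewrite psumr_eq0 => [/allP H|i _]; last by rewrite -expr2 sqr_ge0.
apply/rowP => i; rewrite mxE; apply/eqP.
by have := H i (mem_index_enum _); rewrite /= mulf_eq0 orbb.
Qed.

Lemma cauchy_schwarz_sqr u v : inner u v ^+ 2 <= inner u u * inner v v.
Proof.
have [v0|v0] := eqVneq (inner v v) 0.
  have -> : v = 0 by apply: norm2_eq0; apply/eqP; rewrite -[_ == 0](@expf_eq0 _ _ 2) norm2_sqr v0.
  by rewrite !inner0r mulr0 expr0n.
have vp : 0 < inner v v by rewrite lt_def v0 inner_ge0.
have := inner_ge0 (inner v v *: u - inner u v *: v).
rewrite !innerE (innerC v u) => H.
rewrite -subr_ge0 -(pmulr_rge0 _ vp).
by apply: le_trans H _; rewrite le_eqVlt; apply/orP; left; apply/eqP; ring.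
Qed.

Lemma cauchy_schwarz u v : `|inner u v| <= norm2 u * norm2 v.
Proof.
rewrite -(@ler_pXn2r _ 2) ?nnegrE ?normr_ge0 ?mulr_ge0 ?norm2_ge0//.
by rewrite real_normK ?num_real// exprMn !norm2_sqr cauchy_schwarz_sqr.
Qed.

Lemma inner_le_norm2 u v : inner u v <= norm2 u * norm2 v.
Proof. exact: le_trans (ler_norm _) (cauchy_schwarz u v). Qed.

Lemma innerN_le_norm2 u v : - inner u v <= norm2 u * norm2 v.
Proof. by rewrite -innerNl (le_trans (ler_norm _))// innerNl normrN cauchy_schwarz. Qed.

Lemma norm2D u v : norm2 (u + v) <= norm2 u + norm2 v.
Proof.
rewrite norm2_le ?addr_ge0 ?norm2_ge0// !innerE (innerC v u).
have := inner_le_norm2 u v; rewrite sqrrD !norm2_sqr; lra.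
Qed.

Lemma norm2N v : norm2 (- v) = norm2 v.
Proof. by congr Num.sqrt; apply: eq_bigr => i _; rewrite mxE sqrrN. Qed.

Lemma norm2B u v : norm2 (u - v) <= norm2 u + norm2 v.
Proof. by rewrite -(norm2N v) norm2D. Qed.

Lemma norm2BC u v : norm2 (u - v) = norm2 (v - u).
Proof. by rewrite -norm2N opprB. Qed.

Lemma norm2Z a v : norm2 (a *: v) = `|a| * norm2 v.
Proof.
apply/eqP; rewrite -(@eqrXn2 _ 2) ?mulr_ge0 ?norm2_ge0//.
by rewrite norm2_sqr exprMn norm2_sqr real_normK ?num_real// innerZl innerZr mulrA.
Qed.

Lemma norm2_sum (I : Type) (s : seq I) (F : I -> 'rV[R]_d) :
  norm2 (\sum_(i <- s) F i) <= \sum_(i <- s) norm2 (F i).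
Proof.
elim: s => [|i s IH]; rewrite ?big_nil ?norm20// !big_cons.
by rewrite (le_trans (norm2D _ _))// lerD2l.
Qed.

Lemma inner_sqD u v : inner (u + v) (u + v) <= 2 * inner u u + 2 * inner v v.
Proof.
have := inner_ge0 (u - v); rewrite !innerE (innerC v u); lra.
Qed.

Lemma inner_sqD3 u v w :
  inner (u + v + w) (u + v + w) <= 3 * inner u u + 3 * inner v v + 3 * inner w w.
Proof.
have := inner_ge0 (u - v); have := inner_ge0 (u - w); have := inner_ge0 (v - w).
rewrite !innerE (innerC v u) (innerC w u) (innerC w v); lra.
Qed.

Lemma norm2_coord v (c : R) : 0 <= c -> (forall i, `|v 0 i| <= c) ->
  norm2 v <= Num.sqrt d%:R * c.
Proof.
move=> c0 vc; rewrite norm2_le ?mulr_ge0 ?sqrtr_ge0//.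
rewrite exprMn sqr_sqrtr ?ler0n// mulr_natl -[X in _ *+ X]card_ord -sumr_const.
apply: ler_sum => i _; rewrite -expr2 -real_normK ?num_real//.
by rewrite ler_pXn2r ?nnegrE.
Qed.

End Euclidean.

(** * Averages over the workers *)

Section Averages.
Context {R : realType} {d M : nat}.
Hypothesis M0 : (0 < M)%N.
Implicit Types (x y : 'I_M -> 'rV[R]_d) (v : 'rV[R]_d).

Let Mn : (M%:R : R) != 0. Proof. by rewrite pnatr_eq0 -lt0n. Qed.

Lemma avgD x y : avg (fun m => x m + y m) = avg x + avg y.
Proof. by rewrite /avg big_split scalerDr. Qed.

Lemma avgZ a x : avg (fun m => a *: x m) = a *: avg x.
Proof. by rewrite /avg -scaler_sumr !scalerA mulrC. Qed.

Lemma avgN x : avg (fun m => - x m) = - avg x.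
Proof. by rewrite /avg sumrN scalerN. Qed.

Lemma avgB x y : avg (fun m => x m - y m) = avg x - avg y.
Proof. by rewrite avgD avgN. Qed.

Lemma avg_cst v : avg (fun _ : 'I_M => v) = v.
Proof.
by rewrite /avg sumr_const card_ord -[v *+ M]scaler_nat scalerA mulVf// scale1r.
Qed.

Lemma eq_avg x y : x =1 y -> avg x = avg y.
Proof. by move=> xy; rewrite /avg (eq_bigr _ (fun m _ => xy m)). Qed.

Lemma inner_avg x v : inner (avg x) v = M%:R^-1 * \sum_(m < M) inner (x m) v.
Proof. by rewrite innerZl inner_suml. Qed.

Lemma mean_le (a : 'I_M -> R) c : (forall m, a m <= c) ->
  M%:R^-1 * \sum_(m < M) a m <= c.
Proof.
move=> ac; rewrite -ler_pdivlMl ?invr_gt0 ?ltr0n// invrK.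
rewrite mulr_natl -[X in _ *+ X]card_ord -sumr_const; exact: ler_sum.
Qed.

Lemma mean_ge (a : 'I_M -> R) c : (forall m, c <= a m) ->
  c <= M%:R^-1 * \sum_(m < M) a m.
Proof.
move=> ac; rewrite -ler_pdivrMl ?invr_gt0 ?ltr0n// invrK.
rewrite mulr_natl -[X in _ *+ X]card_ord -sumr_const; exact: ler_sum.
Qed.

Lemma norm2_avg x c : (forall m, norm2 (x m) <= c) -> norm2 (avg x) <= c.
Proof.
move=> xc; rewrite norm2Z ger0_norm ?invr_ge0 ?ler0n//.
apply: (@le_trans _ _ (M%:R^-1 * \sum_(m < M) norm2 (x m))).
  by rewrite ler_wpM2l ?invr_ge0 ?ler0n// norm2_sum.
exact: mean_le.
Qed.

(** The mean of [|x m - A|^2], with [A] the average, is nonnegative; expanded, it is the mean of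
    [|x m|^2] minus [|A|^2]. *)
Lemma inner_avg_sq x :
  inner (avg x) (avg x) <= M%:R^-1 * \sum_(m < M) inner (x m) (x m).
Proof.
have sumE : \sum_(m < M) x m = M%:R *: avg x by rewrite scalerA mulfV// scale1r.
move: (avg x) sumE => A sumE.
have : 0 <= M%:R^-1 * \sum_(m < M) inner (x m - A) (x m - A).
  by rewrite mulr_ge0 ?invr_ge0 ?ler0n// sumr_ge0// => m _; exact: inner_ge0.
under eq_bigr do rewrite !innerE (innerC A (x _)).
rewrite !big_split/= !sumrN -!inner_suml sumr_const card_ord sumE innerZl.
rewrite -[A *+ M]scaler_nat innerZl; move: (inner A A) => b.
by rewrite opprK addNr addr0 mulrBr mulrA mulVf// mul1r subr_ge0.
Qed.

End Averages.

(** * The recursion of Local SGDM *)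

Section Recursion.
Context {R : realType} {d M : nat} {Xi : Type}.
Variables (K : nat) (g : 'rV[R]_d -> Xi -> 'rV[R]_d) (x0 : 'rV[R]_d).
Variables (eta beta rho : R) (s : 'I_M -> nat -> Xi).
Hypotheses (M0 : (0 < M)%N) (K0 : (0 < K)%N) (beta1 : beta < 1).

Let x t m := lsgdm_x K g x0 eta beta rho s t m.
Let u t m := (lsgdm_state K g x0 eta beta rho s t).2 m.
Let z t m := lsgdm_z K g x0 eta beta rho s t m.
Let xb t := lsgdm_xbar K g x0 eta beta rho s t.
Let zb t := lsgdm_zbar K g x0 eta beta rho s t.
Let gh t m := clip (g (x t m) (s m t)) rho.
Let u' t m := beta *: u t m + (1 - beta) *: gh t m.

Let b1 : 1 - beta != 0. Proof. by rewrite subr_eq0 eq_sym lt_eqF. Qed.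

Let xS_local t m : (t %% K != K.-1)%N -> x t.+1 m = x t m - eta *: u' t m.
Proof. by move=> /negbTE tK; rewrite /x /lsgdm_x /= tK. Qed.

Let uS_local t m : (t %% K != K.-1)%N -> u t.+1 m = u' t m.
Proof. by move=> /negbTE tK; rewrite /u /= tK. Qed.

Let xS_sync t m : (t %% K == K.-1)%N ->
  x t.+1 m = avg (fun n => x t n - eta *: u' t n).
Proof. by move=> tK; rewrite /x /lsgdm_x /= tK. Qed.

Let uS_sync t m : (t %% K == K.-1)%N -> u t.+1 m = avg (u' t).
Proof. by move=> tK; rewrite /u /= tK. Qed.

(** Here [u t] is the momentum before step [t]. The formula survives synchronisation because the
    definition of [z] then subtracts the averaged iterate, so that [x] and [u] are averaged
    consistently. *)
Lemma sgdm_z_momentum t m : z t m = x t m - (eta * beta / (1 - beta)) *: u t m.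
Proof.
case: t => [|t]; first by rewrite /z /x /u /= scaler0 subr0.
rewrite /z /lsgdm_z -/(x t.+1 m); case: (boolP (t %% K == K.-1)%N) => tK.
  rewrite -/(xb t) uS_sync//.
  have -> : xb t = x t.+1 m + eta *: avg (u' t).
    by rewrite xS_sync// avgB avgZ// subrK.
  move: (x t.+1 m) (avg _) => a b; apply/rowP => i; rewrite !mxE; field.
  by [].
rewrite -/(x t m) uS_local//.
have -> : x t m = x t.+1 m + eta *: u' t m by rewrite xS_local// subrK.
move: (x t.+1 m) (u' t m) => a b; apply/rowP => i; rewrite !mxE; field.
by [].
Qed.

(** In the momentum form of [z] the old momentum cancels: [eta / (1 - beta)] times the new [u] is
    [eta * beta / (1 - beta)] times the old one plus [eta] times the clipped gradient. So [z] makes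
    plain steps. *)
Lemma sgdm_z_local t m : (t %% K != K.-1)%N ->
  z t.+1 m = z t m - eta *: gh t m.
Proof.
move=> tK; rewrite !sgdm_z_momentum xS_local// uS_local// /u'.
move: (x t m) (u t m) (gh t m) => a b c; apply/rowP => i; rewrite !mxE; field.
by [].
Qed.

(** Makes [x] an exponential average of [z]; from here on this relation replaces the momentum as the
    second state variable. *)
Lemma sgdm_x_local t m : (t %% K != K.-1)%N ->
  x t.+1 m = beta *: x t m + (1 - beta) *: z t.+1 m.
Proof.
move=> tK; rewrite /z /lsgdm_z (negbTE tK) -/(x t.+1 m) -/(x t m).
by rewrite scalerA mulfV// scale1r addrC subrK.
Qed.

(** Synchronisation changes neither the average of [x] nor that of [u], so one recursion covers
    every time. *)
Lemma sgdm_zbar_step t : zb t.+1 = zb t - eta *: avg (gh t).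
Proof.
have zE n : zb n = xb n - (eta * beta / (1 - beta)) *: avg (u n).
  by rewrite /zb /lsgdm_zbar (eq_avg (sgdm_z_momentum n)) avgB avgZ.
have xbS : xb t.+1 = xb t - eta *: avg (u' t).
  rewrite /xb /lsgdm_xbar; case: (boolP (t %% K == K.-1)%N) => tK.
    by rewrite (eq_avg (fun m => xS_sync m tK)) avg_cst// avgB avgZ.
  by rewrite (eq_avg (fun m => xS_local m tK)) avgB avgZ.
have ubS : avg (u t.+1) = beta *: avg (u t) + (1 - beta) *: avg (gh t).
  transitivity (avg (u' t)); last by rewrite avgD !avgZ.
  case: (boolP (t %% K == K.-1)%N) => tK.
    by rewrite (eq_avg (fun m => uS_sync m tK)) avg_cst.
  by rewrite (eq_avg (fun m => uS_local m tK)).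
rewrite !zE xbS ubS (_ : avg (u' t) = beta *: avg (u t) + (1 - beta) *: avg (gh t)).
  move: (xb t) (avg _) (avg _) => a b c; apply/rowP => i; rewrite !mxE; field.
  by [].
by rewrite avgD !avgZ.
Qed.

Lemma sgdm_xbar_step t : xb t.+1 = beta *: xb t + (1 - beta) *: zb t.+1.
Proof.
have -> : zb t.+1 = (1 - beta)^-1 *: (xb t.+1 - beta *: xb t).
  rewrite /zb /lsgdm_zbar /lsgdm_z; case: (boolP (t %% K == K.-1)%N) => tK.
    by rewrite avgZ avgB avgZ avg_cst.
  by rewrite avgZ avgB avgZ.
move: (xb t.+1) (xb t) => a b.
by rewrite scalerA mulfV// scale1r addrC subrK.
Qed.

Lemma sgdm_sync t m n : (t %% K = 0)%N -> x t m = x t n /\ z t m = z t n.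
Proof.
case: t => [|t] tK; first by [].
have tK' : (t %% K == K.-1)%N.
  move: tK; rewrite -addn1 -modnDml addn1 => tK.
  have tlt := ltn_pmod t K0.
  have [|tKlt] := boolP ((t %% K).+1 == K); first by move/eqP/(congr1 predn)/eqP.
  by move: tK; rewrite modn_small // ltn_neqAle tKlt.
have xE : x t.+1 m = x t.+1 n by rewrite !xS_sync.
by split => //; rewrite /z /lsgdm_z tK' -/(x t.+1 m) xE.
Qed.

Lemma sgdm_zbar0 : zb 0 = x0.
Proof. by rewrite /zb /lsgdm_zbar /lsgdm_z /= avg_cst. Qed.

End Recursion.

(** * Convexity, smoothness and worker drift *)

Section ConvexSmooth.
Context {R : realType} {d : nat}.
Variables (f : 'rV[R]_d -> R) (gf : 'rV[R]_d -> 'rV[R]_d) (Om : set 'rV[R]_d) (L : R).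
Hypothesis L0 : 0 < L.
Hypothesis lip : forall x y, Om x -> Om y -> norm2 (gf x - gf y) <= L * norm2 (x - y).
Hypothesis conv : forall x y, Om x -> Om y -> f x + inner (gf x) (y - x) <= f y.

(* Convexity at [y] together with the Lipschitz bound replaces the integral form
   of the descent lemma, at the price of a factor 2. *)
Lemma descent x y : Om x -> Om y ->
  f y <= f x + inner (gf x) (y - x) + L * inner (y - x) (y - x).
Proof.
move=> xO yO; have := conv yO xO.
rewrite -(opprB y x) innerNr => H.
have : inner (gf y - gf x) (y - x) <= L * inner (y - x) (y - x).
  apply: le_trans (inner_le_norm2 _ _) _.
  by rewrite -norm2_sqr expr2 mulrA ler_wpM2r ?norm2_ge0// lip.
rewrite innerDl innerNl; lra.
Qed.

(** Convexity at [x] and the descent bound at [y] are compared at the gradient step [y'] of length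
    [1 / (2 L)], optimal for a descent constant [L]; [1 / (4 L)] is [1 / (2 L) - L / (4 L^2)]. As
    the assumptions are local, [y'] has to lie in the region. *)
Lemma cocoercive_half x y : Om x -> Om y ->
  Om (y - (2 * L)^-1 *: (gf y - gf x)) ->
  f x + inner (gf x) (y - x) + (4 * L)^-1 * inner (gf y - gf x) (gf y - gf x) <= f y.
Proof.
set v := gf y - gf x; set y' := y - _ *: _ => xO yO yO'.
have h1 := conv xO yO'; have h2 := descent yO yO'.
have E1 : y' - y = - (2 * L)^-1 *: v by rewrite /y' addrC addKr scaleNr.
have E2 : y' - x = (y - x) + - (2 * L)^-1 *: v by rewrite -E1 [RHS]addrC addrA subrK.
move: h1 h2; rewrite E1 E2 innerDr !innerZr innerZl.
have Ev : inner v v = inner (gf y) v - inner (gf x) v by rewrite {1}/v innerDl innerNl.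
move: (inner (gf x) (y - x)) Ev => a Ev.
have -> : inner (gf y) v = inner v v + inner (gf x) v by rewrite Ev; ring.
have -> : (4 * L)^-1 = (2 * L)^-1 - L * ((2 * L)^-1 * (2 * L)^-1).
  by field; rewrite gt_eqF.
lra.
Qed.

Lemma cocoercive x y : Om x -> Om y ->
  Om (y - (2 * L)^-1 *: (gf y - gf x)) -> Om (x - (2 * L)^-1 *: (gf x - gf y)) ->
  inner (gf x - gf y) (gf x - gf y) <= 2 * L * inner (x - y) (gf x - gf y).
Proof.
move=> xO yO y'O x'O.
have := cocoercive_half xO yO y'O; have := cocoercive_half yO xO x'O.
have -> : gf y - gf x = - (gf x - gf y) by rewrite opprB.
have -> : y - x = - (x - y) by rewrite opprB.
rewrite !innerNr !innerNl opprK.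
have -> : inner (x - y) (gf x - gf y) = inner (gf x) (x - y) - inner (gf y) (x - y).
  by rewrite innerC innerDl innerNl.
move: (inner (gf x) _) (inner (gf y) _) (inner (gf x - gf y) _) => a b v h1 h2.
have : 2 * (4 * L)^-1 * v <= a - b by lra.
have -> : 2 * (4 * L)^-1 * v = (2 * L)^-1 * v by field; rewrite gt_eqF.
by rewrite ler_pdivrMl// mulr_gt0.
Qed.

End ConvexSmooth.

(** * One local step of a pair of workers *)

Section PairStep.
Context {R : realType} {d : nat}.
Variables (eta L beta c : R).
Hypotheses (eta0 : 0 < eta) (L0 : 0 < L) (beta0 : 0 <= beta) (c0 : 0 < c).
Hypotheses (cb : c <= 1 - beta) (etaL : 16 * (eta * L) <= c ^+ 2).

(** The weight is chosen so that the fraction [1 - beta] of the second term lost per step equals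
    [4 eta L |dz - dx|^2], the price of pairing the gradient difference with [dz] instead of
    [dx]. *)
Definition potential (dx dz : 'rV[R]_d) : R :=
  inner dz dz + 4 * eta * L / (1 - beta) * inner (dz - dx) (dz - dx).

(** With [e = dz - dx], cocoercivity yields the gain [(eta / L) |dg|^2] from [2 eta <dx, dg>]. A
    quarter of it, together with the loss of the second term, absorbs [2 eta <e, dg>]; the rest
    dominates the [|dg|^2] part of [5/4 eta^2 |dg + nu|^2], as [eta L] is at most 1/16. *)
Lemma potential_step (dx dz dg nu dx' dz' : 'rV[R]_d) :
  inner dg dg <= 2 * L * inner dx dg ->
  dz' = dz - eta *: (dg + nu) -> dx' = beta *: dx + (1 - beta) *: dz' ->
  potential dx' dz' <=
    potential dx dz - 2 * eta * inner dz nu + 4 * eta ^+ 2 * inner nu nu.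
Proof.
move: (eta0) (L0) (beta0) (c0) (cb) (etaL) => eta0' L0' beta0' c0' cb' etaL'.
move=> coco dzE dxE; rewrite /potential.
have [e eE] : exists e, e = dz - dx by exists (dz - dx).
have [p pE] : exists p, p = dg + nu by exists (dg + nu).
rewrite -eE.
have c1 : c <= 1 by lra.
have ga0 : 0 < 1 - beta by lra.
have e'E : dz' - dx' = beta *: (e - eta *: p).
  by rewrite dxE dzE eE -pE; apply/rowP => i; rewrite !mxE; ring.
have H1 : inner dz' dz' = inner dz dz - 2 * eta * inner dz p + eta ^+ 2 * inner p p.
  by rewrite dzE -pE !innerE (innerC p dz); ring.
have H2 : (1 - beta) * inner (dz' - dx') (dz' - dx') <=
    (1 - beta) * beta * inner e e + beta ^+ 2 * eta ^+ 2 * inner p p.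
  (* Young's inequality in completed-square form, weighted so that exactly [beta |e|^2] survives. *)
  have : 0 <= beta * inner ((1 - beta) *: e + beta *: (eta *: p))
                        ((1 - beta) *: e + beta *: (eta *: p)).
    by rewrite mulr_ge0// inner_ge0.
  rewrite e'E !innerE (innerC p e) => H.
  rewrite -subr_ge0; apply: le_trans H _; rewrite le_eqVlt; apply/orP; left.
  by apply/eqP; ring.
have zE : inner dz p = inner dx dg + inner e dg + inner dz nu.
  by rewrite pE innerDr eE innerDl innerNl; ring.
have H3 : 0 <= 16 * L ^+ 2 * inner e e + 8 * L * inner e dg + inner dg dg.
  have := inner_ge0 ((4 * L) *: e + dg); rewrite !innerE (innerC dg e).
  by move=> H; apply: le_trans H _; rewrite le_eqVlt; apply/orP; left; apply/eqP; ring.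
have H4 := inner_sqD dg nu; rewrite -pE in H4.
have pp := inner_ge0 p; have gg := inner_ge0 dg; have nn := inner_ge0 nu.
move: (inner e e) (inner e dg) (inner dg dg) (inner p p) (inner nu nu)
  (inner dx dg) (inner dz nu) (inner dz dz) (inner dz p) (inner dz' dz')
  (inner (dz' - dx') (dz' - dx')) coco H1 H2 zE H3 H4 pp gg nn
  => ee ed gg pp nn xg zn zz zp zz' ee' coco H1 H2 zE H3 H4 pp0 gg0 nn0.
rewrite {}H1 {}zE.
set a := 4 * eta * L / (1 - beta).
have a0 : 0 <= a by rewrite /a divr_ge0 ?mulr_ge0 ?ltW.
have aga : a * (1 - beta) = 4 * eta * L by rewrite /a mulfVK// gt_eqF.
have H5 : a * ee' <= a * ee - 4 * eta * L * ee + 4^-1 * eta ^+ 2 * pp.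
  have h : ee' <= beta * ee + beta ^+ 2 * eta ^+ 2 * pp / (1 - beta).
    rewrite -(@ler_pM2l _ (1 - beta))//; apply: (le_trans H2).
    by rewrite le_eqVlt; apply/orP; left; apply/eqP; field; rewrite gt_eqF.
  apply: le_trans (ler_wpM2l a0 h) _.
  have -> : a * (beta * ee + beta ^+ 2 * eta ^+ 2 * pp / (1 - beta)) =
     a * ee - a * (1 - beta) * ee + (a * beta ^+ 2 / (1 - beta)) * (eta ^+ 2 * pp).
    by rewrite /a; field; rewrite gt_eqF.
  (* After multiplication by [(1 - beta)^2] this reads [16 eta L beta^2 <= (1 - beta)^2], the origin
     of [etaL]. *)
  suff hh : a * beta ^+ 2 / (1 - beta) <= 4^-1.
    rewrite aga lerD2l.
    have ep : 0 <= eta ^+ 2 * pp by rewrite mulr_ge0 ?sqr_ge0.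
    by have := ler_wpM2r ep hh; rewrite [leRHS]mulrA.
  rewrite ler_pdivrMr// -(ler_pM2r ga0).
  have -> : a * beta ^+ 2 * (1 - beta) = 4 * eta * L * beta ^+ 2 by rewrite -aga; ring.
  have b1 : beta ^+ 2 <= 1 by rewrite expr_le1//; lra.
  have cc2 : c ^+ 2 <= (1 - beta) ^+ 2 by rewrite ler_pXn2r // nnegrE ltW.
  have h1 : 4 * eta * L * beta ^+ 2 <= 4 * eta * L * 1.
    by rewrite ler_wpM2l// !mulr_ge0 ?ltW.
  have -> : 4^-1 * (1 - beta) * (1 - beta) = 4^-1 * (1 - beta) ^+ 2 by ring.
  lra.
have c2 : c ^+ 2 <= 1 by rewrite expr_le1// ltW.
rewrite -(@ler_pM2l _ (4 * L)) ?mulr_gt0//.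
have h5 : 4 * L * (a * ee') <= 4 * L * (a * ee - 4 * eta * L * ee + 4^-1 * eta ^+ 2 * pp).
  by rewrite ler_wpM2l// mulr_ge0 ?ltW.
have h3 : 0 <= eta * (16 * L ^+ 2 * ee + 8 * L * ed + gg) by rewrite mulr_ge0// ltW.
have hc : 4 * eta * gg <= 4 * eta * (2 * L * xg) by rewrite ler_wpM2l// mulr_ge0 ?ltW.
have h4 : (5 * eta ^+ 2 * L) * pp <= (5 * eta ^+ 2 * L) * (2 * gg + 2 * nn).
  by rewrite ler_wpM2l// !mulr_ge0 ?sqr_ge0 ?ltW.
have h6 : 16 * (eta * gg) * (eta * L) <= eta * gg * 1.
  have -> : 16 * (eta * gg) * (eta * L) = eta * gg * (16 * (eta * L)) by ring.
  by apply: ler_wpM2l; [rewrite mulr_ge0// ltW|lra].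
have h7 : 0 <= eta ^+ 2 * L * nn by rewrite !mulr_ge0 ?sqr_ge0// ltW.
have h8 : 0 <= eta * gg by rewrite mulr_ge0// ltW.
rewrite !expr2 in h4 h5 h3 h6 h7 *; lra.
Qed.

End PairStep.

(** * Convergence on the good event *)

Section MainStep.
Context {R : realType} {d : nat}.

(** To be read with [w = zb - xstar], [G], [b], [Y] the mean gradient, bias and noise, [F] the gap
    at [zb], and [q] the distance of the workers from [zb]. Of the gain [2 eta F], one half pays for
    [3 eta^2 |G|^2], since [12 eta L <= 1]. *)
Lemma distance_step (w w' G b Y : 'rV[R]_d) (eta L q F D0 b0 : R) :
  0 < eta -> 12 * (eta * L) <= 1 -> 0 <= F -> 0 <= D0 ->
  w' = w - eta *: (G + b + Y) ->
  F - L * q ^+ 2 <= inner w G -> inner G G <= 4 * L * F + 2 * L ^+ 2 * q ^+ 2 ->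
  norm2 w <= 3 / 2 * D0 -> norm2 b <= b0 ->
  inner w' w' <= inner w w - eta * F
    + (2 * eta * L * q ^+ 2 + 6 * eta ^+ 2 * L ^+ 2 * q ^+ 2
       + 3 * eta * D0 * b0 + 3 * eta ^+ 2 * b0 ^+ 2)
    + (- (2 * eta * inner w Y) + 3 * eta ^+ 2 * inner Y Y).
Proof.
move=> eta0 etaL F0 D00 -> wG GG wD bb0.
have b00 : 0 <= b0 := le_trans (norm2_ge0 b) bb0.
have h1 : - inner w b <= 3 / 2 * D0 * b0.
  by rewrite (le_trans (innerN_le_norm2 _ _))// ler_pM ?norm2_ge0.
have h2 := inner_sqD3 G b Y.
have h3 : inner b b <= b0 ^+ 2 by rewrite -norm2_le.
have [p pE] : exists p, p = G + b + Y by exists (G + b + Y).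
rewrite -pE in h2 *.
have -> : inner (w - eta *: p) (w - eta *: p) =
    inner w w - 2 * eta * inner w p + eta ^+ 2 * inner p p.
  by rewrite !innerE (innerC p w); ring.
have -> : inner w p = inner w G + inner w b + inner w Y by rewrite pE !innerDr.
have e2 : 0 <= eta ^+ 2 by exact: sqr_ge0.
have k1 := ler_wpM2l e2 h2.
have k2 := ler_wpM2l e2 h3.
have k3 := ler_wpM2l e2 GG.
have k4 := ler_wpM2l (ltW eta0) wG.
have k5 := ler_wpM2l (ltW eta0) h1.
have k6 : eta * F * (12 * (eta * L)) <= eta * F * 1.
  by apply: ler_wpM2l => //; rewrite mulr_ge0// ltW.
rewrite !expr2 in k1 k2 k3 k4 k5 k6 *; lra.
Qed.

End MainStep.

(** * Pathwise induction, given the bounds on the noise sums *)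

Section Deterministic.
Context {R : realType} {d M : nat}.
Variables (K T : nat) (f : 'rV[R]_d -> R) (gf : 'rV[R]_d -> 'rV[R]_d).
Variables (xs : 'rV[R]_d) (D0 L eta beta c N B b0 eps dp : R).
Variables (x z gh bi n : nat -> 'I_M -> 'rV[R]_d) (xb zb : nat -> 'rV[R]_d).
Hypotheses (M0 : (0 < M)%N) (K0 : (0 < K)%N) (T0 : (0 < T)%N).
Let Om := [set v : 'rV[R]_d | norm2 (v - xs) <= Num.sqrt 3 * D0].

Hypothesis fmin : forall v, f xs <= f v.
Hypothesis lip : forall v w, Om v -> Om w ->
  norm2 (gf v - gf w) <= L * norm2 (v - w).
Hypothesis smooth : forall v, Om v -> norm2 (gf v) ^+ 2 <= 2 * L * (f v - f xs).
Hypothesis conv : forall v w, Om v -> Om w -> f v + inner (gf v) (w - v) <= f w.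

Hypothesis ghE : forall t m, gh t m = gf (x t m) + bi t m + n t m.
Hypothesis z_local : forall t m, (t %% K != K.-1)%N -> z t.+1 m = z t m - eta *: gh t m.
Hypothesis x_local : forall t m, (t %% K != K.-1)%N ->
  x t.+1 m = beta *: x t m + (1 - beta) *: z t.+1 m.
Hypothesis zb_step : forall t, zb t.+1 = zb t - eta *: avg (gh t).
Hypothesis xb_step : forall t, xb t.+1 = beta *: xb t + (1 - beta) *: zb t.+1.
Hypothesis sync : forall t m m', (t %% K = 0)%N -> x t m = x t m' /\ z t m = z t m'.
Hypothesis xbE : forall t, xb t = avg (x t).
Hypotheses (zb0 : inner (zb 0%N - xs) (zb 0%N - xs) <= D0 ^+ 2) (xb0 : xb 0%N = zb 0%N).

Hypothesis gh_le : forall t m, norm2 (gh t m) <= N.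
Hypothesis bi_le : forall t m, Om (x t m) -> norm2 (bi t m) <= b0.

Hypotheses (eta0 : 0 < eta) (L0 : 0 < L) (beta0 : 0 <= beta) (c0 : 0 < c).
Hypotheses (cb : c <= 1 - beta) (etaL : 16 * (eta * L) <= c ^+ 2).
Hypotheses (eps0 : 0 < eps) (D00 : 0 < D0) (B0 : 0 <= B) (b00 : 0 <= b0).
Hypotheses (NB : eta * N <= c * B) (BD : 16 * B <= D0) (LB : 128 * (L * B ^+ 2) <= eps).
Hypotheses (etaT : eta * T%:R * eps = 2 * D0 ^+ 2) (Db : 48 * (D0 * b0) <= eps).
Hypothesis dpB : dp + K%:R * (4 * eta * B * b0 + 32 * eta ^+ 2 * b0 ^+ 2) <= B ^+ 2.

Definition good_state t : Prop :=
  [/\ norm2 (zb t - xs) <= 3 / 2 * D0, forall m, Om (x t m)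
    & forall m m', norm2 (z t m - z t m') <= B].

Definition main_noise t : R :=
  - (2 * eta * inner (zb t - xs) (avg (n t))) + 3 * eta ^+ 2 * inner (avg (n t)) (avg (n t)).
(** The 8 is the 4 of [potential_step] doubled when the perturbation is split into bias and
    noise. *)
Definition pair_noise m m' t : R :=
  - (2 * eta * inner (z t m - z t m') (n t m - n t m'))
  + 8 * eta ^+ 2 * inner (n t m - n t m') (n t m - n t m').

(** Both noise bounds are granted only while all earlier states are good, which is what probability
    can deliver before the induction is closed. In the second one, [t %/ K * K] is the start of the
    current round. *)
Hypothesis main_event : forall t, (t <= T)%N -> (forall s, (s < t)%N -> good_state s) ->
  \sum_(0 <= s < t) main_noise s <= D0 ^+ 2 / 2.
Hypothesis pair_event : forall t m m', (t <= T)%N -> (forall s, (s < t)%N -> good_state s) ->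
  \sum_(t %/ K * K <= s < t) pair_noise m m' s <= dp.

Let sqrt3 : 17 / 10 <= Num.sqrt 3 :> R.
Proof.
have h : 0 <= 17 / 10 :> R by lra.
by rewrite -(@ler_pXn2r _ 2) ?nnegrE ?sqrtr_ge0// sqr_sqrtr; lra.
Qed.

(** Between 3/2 and 17/10 there is room for the distance [2 B] of a worker from [zb] and a
    displacement [B / 2], as [16 B <= D0]. *)
Let OmP v : norm2 (v - xs) <= 17 / 10 * D0 -> Om v.
Proof. by move=> h; rewrite /Om /= (le_trans h)// ler_wpM2r// ltW. Qed.

(** The gap is multiplied by [beta <= 1 - c] after a change of at most [eta N <= c B], and
    [(1 - c) (1 + c) <= 1]. Clipping alone gives this, with no probability. *)
Let zx_gap t : norm2 (zb t - xb t) <= B.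
Proof.
have := (NB, cb, c0, beta0, B0) => -[[[[NB' cb'] c0'] beta0'] B0'].
elim: t => [|t IH]; first by rewrite xb0 subrr norm20.
have -> : zb t.+1 - xb t.+1 = beta *: ((zb t - xb t) - eta *: avg (gh t)).
  by rewrite xb_step zb_step; apply/rowP => i; rewrite !mxE; ring.
rewrite norm2Z ger0_norm//.
have h1 : norm2 (avg (gh t)) <= N by exact: norm2_avg.
have h2 : norm2 ((zb t - xb t) - eta *: avg (gh t)) <= B + c * B.
  rewrite (le_trans (norm2B _ _))// lerD// norm2Z gtr0_norm//.
  by rewrite (le_trans _ NB)// ler_wpM2l// ltW.
have h3 := ler_wpM2l beta0 h2; apply: (le_trans h3).
have h4 : beta * (B + c * B) <= (1 - c) * (B + c * B).
  by apply: ler_wpM2r; [rewrite addr_ge0// mulr_ge0// ltW | lra].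
have h5 : 0 <= c * (c * B) by rewrite !mulr_ge0// ltW.
lra.
Qed.

Let x_pair t m m' : (forall s, (s <= t)%N -> forall m m', norm2 (z s m - z s m') <= B) ->
  norm2 (x t m - x t m') <= B.
Proof.
elim: t => [|t IH] zB.
  by have [-> _] := @sync 0%N m m' (mod0n K); rewrite subrr norm20.
case: (boolP (t %% K == K.-1)%N) => tK.
  have t0 : (t.+1 %% K = 0)%N.
    by rewrite -addn1 -modnDml (eqP tK) addn1 prednK// modnn.
  by have [-> _] := @sync t.+1 m m' t0; rewrite subrr norm20.
rewrite !x_local//.
have -> : beta *: x t m + (1 - beta) *: z t.+1 m - (beta *: x t m' + (1 - beta) *: z t.+1 m')
  = beta *: (x t m - x t m') + (1 - beta) *: (z t.+1 m - z t.+1 m').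
  by apply/rowP => i; rewrite !mxE; ring.
have b1 : 0 <= 1 - beta by rewrite (le_trans _ cb)// ltW.
rewrite (le_trans (norm2D _ _))// !norm2Z !ger0_norm//.
have h1 := ler_wpM2l beta0 (IH (fun s st => zB s (leqW st))).
have h2 := ler_wpM2l b1 (zB t.+1 (leqnn _) m m').
lra.
Qed.

(** One [B] is the disagreement of the workers, inherited by [x] as a convex combination of values
    of [z]; the other is the lag of [xb] behind [zb]. *)
Let x_zbar t m : (forall s, (s <= t)%N -> forall m m', norm2 (z s m - z s m') <= B) ->
  norm2 (x t m - zb t) <= 2 * B.
Proof.
move=> zB; have -> : x t m - zb t = avg (fun m' => x t m - x t m') - (zb t - xb t).
  by rewrite avgB avg_cst// -xbE opprB addrA subrK.
rewrite (le_trans (norm2B _ _))//.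
have h1 := zx_gap t.
have h2 : norm2 (avg (fun m' => x t m - x t m')) <= B.
  by apply: norm2_avg => // m'; exact: x_pair.
lra.
Qed.

Let good_close t m : (forall s, (s < t.+1)%N -> good_state s) ->
  norm2 (x t m - zb t) <= 2 * B.
Proof. by move=> good; apply: x_zbar => s st; have [] := good s st. Qed.

Let pair_coco t m m' : (forall s, (s < t.+1)%N -> good_state s) ->
  inner (gf (x t m) - gf (x t m')) (gf (x t m) - gf (x t m')) <=
  2 * L * inner (x t m - x t m') (gf (x t m) - gf (x t m')).
Proof.
move=> good.
have [zD xO _] := good t (leqnn _).
have pairB a b : norm2 (x t a - x t b) <= B.
  by apply: x_pair => s st; have [] := good s st.
(* The Lipschitz bound makes the shift at most [B / 2], and [3/2 D0 + 2 B + B / 2 <= 17/10 D0]. *)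
have key a b : Om (x t b - (2 * L)^-1 *: (gf (x t b) - gf (x t a))).
  apply: OmP.
  have -> : x t b - (2 * L)^-1 *: (gf (x t b) - gf (x t a)) - xs =
     (x t b - zb t) + (zb t - xs) - (2 * L)^-1 *: (gf (x t b) - gf (x t a)).
    by rewrite addrA subrK addrAC.
  have h1 := good_close b good.
  have h2 : norm2 ((2 * L)^-1 *: (gf (x t b) - gf (x t a))) <= B / 2.
    rewrite norm2Z gtr0_norm ?invr_gt0 ?mulr_gt0// ler_pdivrMl ?mulr_gt0//.
    rewrite (le_trans (lip (xO b) (xO a)))//.
    have := ler_wpM2l (ltW L0) (pairB b a); lra.
  rewrite (le_trans (norm2B _ _))//.
  have h3 := norm2D (x t b - zb t) (zb t - xs); have BD' := BD; have D00' := D00; lra.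
by apply: (cocoercive L0 lip conv).
Qed.

(** The potential vanishes at the start of the round, so only the perturbations since then
    accumulate. With a bias difference of norm at most [2 b0], the bias costs [2 eta B (2 b0)] and
    [4 eta^2 * 2 (2 b0)^2] per step. *)
Let pair_potential t m m' : (t <= T)%N -> (forall s, (s < t)%N -> good_state s) ->
  forall j, (t %/ K * K <= j <= t)%N ->
  potential eta L beta (x j m - x j m') (z j m - z j m') <=
  \sum_(t %/ K * K <= s < j)
    (pair_noise m m' s + (4 * eta * B * b0 + 32 * eta ^+ 2 * b0 ^+ 2)).
Proof.
move=> tT good j /andP[]; elim: j => [|j IH] rj jt.
  have /eqP r0 : (t %/ K * K == 0)%N by rewrite -leqn0.
  rewrite r0 big_geq//; have [-> ->] := @sync 0%N m m' (mod0n K).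
  by rewrite !subrr /potential subrr !inner0l mulr0 addr0.
(* Either the step from [j] is inside the round, or [j.+1] starts it, where the workers agree and
   the sum is empty. *)
have : (t %/ K * K <= j)%N \/ (t %/ K * K = j.+1)%N.
  by move: rj; rewrite leq_eqVlt => /orP[/eqP|]; [right|left].
case=> [rlt|rE]; last first.
  have j0 : (j.+1 %% K = 0)%N by rewrite -rE modnMl.
  have [-> ->] := @sync j.+1 m m' j0; rewrite rE big_geq//.
  by rewrite !subrr /potential subrr !inner0l mulr0 addr0.
have jK : (j %% K != K.-1)%N.
  rewrite -(subnKC rlt) modnMDl.
  have jt' : (j - t %/ K * K < t %% K)%N.
    by rewrite ltn_subLR// -divn_eq.
  rewrite modn_small; last by rewrite (ltn_trans jt')// ltn_pmod.
  by rewrite ltn_eqF// (leq_trans jt')// -ltnS prednK// ltn_pmod.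
rewrite big_nat_recr//=.
have {}IH := IH rlt (ltnW jt).
have goodj : forall s, (s < j.+1)%N -> good_state s.
  by move=> s sj; apply: good; exact: leq_trans sj jt.
have [_ xO zB] := good j jt.
have coco := pair_coco m m' goodj.
set bd := bi j m - bi j m'; set nd := n j m - n j m'.
have zE : z j.+1 m - z j.+1 m' =
  (z j m - z j m') - eta *: ((gf (x j m) - gf (x j m')) + (bd + nd)).
  by rewrite !z_local// !ghE /bd /nd; apply/rowP => i; rewrite !mxE; ring.
have xE : x j.+1 m - x j.+1 m' =
  beta *: (x j m - x j m') + (1 - beta) *: (z j.+1 m - z j.+1 m').
  by rewrite !x_local//; apply/rowP => i; rewrite !mxE; ring.
have step := potential_step eta0 L0 beta0 c0 cb etaL coco zE xE.
apply: (le_trans step).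
have hbd : norm2 bd <= 2 * b0.
  rewrite (le_trans (norm2B _ _))//.
  have := bi_le (xO m); have := bi_le (xO m'); lra.
have hbd2 : inner bd bd <= (2 * b0) ^+ 2 by rewrite -norm2_le// mulr_ge0.
have h1 : - inner (z j m - z j m') bd <= B * (2 * b0).
  by rewrite (le_trans (innerN_le_norm2 _ _))// ler_pM ?norm2_ge0.
have h2 := inner_sqD bd nd.
rewrite innerDr /pair_noise -/nd.
have k1 := ler_wpM2l (ltW eta0) h1.
have k2 := ler_wpM2l (sqr_ge0 eta) h2.
have k3 := ler_wpM2l (sqr_ge0 eta) hbd2.
rewrite !expr2 in k1 k2 k3 IH *; lra.
Qed.

Let good_zpair t m m' : (t <= T)%N -> (forall s, (s < t)%N -> good_state s) ->
  norm2 (z t m - z t m') <= B.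
Proof.
move=> tT good; rewrite norm2_le//.
have {}h1 := pair_potential m m' tT good (j := t).
rewrite leq_divM leqnn in h1; have {}h1 := h1 isT.
have ga0 : 0 < 1 - beta by rewrite (lt_le_trans c0).
apply: le_trans (le_trans (le_trans _ h1) _) dpB.
  rewrite /potential lerDl mulr_ge0 ?inner_ge0//.
  by rewrite divr_ge0 ?mulr_ge0 ?ltW.
rewrite big_split/= lerD ?pair_event// sumr_const_nat -[leLHS]mulr_natl.
have p0 : 0 <= 4 * eta * B * b0 + 32 * eta ^+ 2 * b0 ^+ 2.
  by rewrite addr_ge0 ?mulr_ge0 ?sqr_ge0// ltW.
rewrite ler_wpM2r// ler_nat.
by rewrite {1}(divn_eq t K) addKn ltnW// ltn_pmod.
Qed.

Let F t := f (zb t) - f xs.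
Let err := 8 * eta * L * B ^+ 2 + 24 * eta ^+ 2 * L ^+ 2 * B ^+ 2
  + 3 * eta * D0 * b0 + 3 * eta ^+ 2 * b0 ^+ 2.

Let distance_decrease t : (forall s, (s < t.+1)%N -> good_state s) ->
  inner (zb t.+1 - xs) (zb t.+1 - xs) <=
  inner (zb t - xs) (zb t - xs) - eta * F t + err + main_noise t.
Proof.
move=> good; have [zD xO _] := good t (leqnn _).
have xz m := good_close m good.
have zO : Om (zb t) by apply: OmP; have D00' := D00; lra.
have sO : Om xs by rewrite /Om /= subrr norm20 mulr_ge0 ?sqrtr_ge0// ltW.
have F0 : 0 <= F t by rewrite subr_ge0.
have wE : zb t.+1 - xs = (zb t - xs) -
    eta *: (avg (fun m => gf (x t m)) + avg (bi t) + avg (n t)).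
  rewrite zb_step -!avgD (eq_avg (ghE t)); move: (avg _) => a.
  by rewrite addrAC.
have sq m : inner (x t m - zb t) (x t m - zb t) <= (2 * B) ^+ 2.
  by rewrite -norm2_le// mulr_ge0.
(* Convexity from [x t m] towards [xs] and from [zb t] towards [x t m] leaves the gap at [zb t], up
   to the gradient variation between the two points paired with their difference. *)
have wG : F t - L * (2 * B) ^+ 2 <= inner (zb t - xs) (avg (fun m => gf (x t m))).
  rewrite innerC inner_avg; apply: mean_ge => // m.
  have h1 := conv (xO m) sO; have h2 := conv zO (xO m).
  have h3 : inner (gf (zb t) - gf (x t m)) (zb t - x t m) <= L * (2 * B) ^+ 2 ->
      F t - L * (2 * B) ^+ 2 <= inner (gf (x t m)) (zb t - xs).
    rewrite /F innerDl innerNl.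
    have -> : inner (gf (x t m)) (zb t - xs) = inner (gf (x t m)) (zb t - x t m)
       - inner (gf (x t m)) (xs - x t m).
      by rewrite -innerNr -innerDr opprB addrA subrK.
    move: h2; rewrite -(opprB (zb t)) innerNr; lra.
  apply: h3; rewrite (le_trans (inner_le_norm2 _ _))//.
  rewrite (le_trans (ler_wpM2r (norm2_ge0 _) (lip zO (xO m))))//.
  by rewrite -mulrA ler_pM2l// -expr2 norm2BC norm2_sqr.
have GG : inner (avg (fun m => gf (x t m))) (avg (fun m => gf (x t m))) <=
    4 * L * F t + 2 * L ^+ 2 * (2 * B) ^+ 2.
  apply: le_trans (inner_avg_sq _ _) _ => //; apply: mean_le => // m.
  have h1 := inner_sqD (gf (x t m) - gf (zb t)) (gf (zb t)).
  rewrite subrK in h1; apply: (le_trans h1).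
  have h2 := smooth zO; rewrite norm2_sqr in h2.
  have h3 : inner (gf (x t m) - gf (zb t)) (gf (x t m) - gf (zb t)) <= L ^+ 2 * (2 * B) ^+ 2.
    rewrite -exprMn -norm2_le; last by rewrite !mulr_ge0// ltW.
    by rewrite (le_trans (lip (xO m) zO))// ler_pM2l.
  rewrite /F; lra.
have bb : norm2 (avg (bi t)) <= b0 by apply: norm2_avg => // m; exact: bi_le.
have eL : 12 * (eta * L) <= 1.
  have c1 : c ^+ 2 <= 1.
    have c1' : c <= 1 by have cb' := cb; have beta0' := beta0; lra.
    by rewrite expr_le1// ltW.
  have := etaL; have : 0 <= eta * L by rewrite mulr_ge0 ?ltW.
  lra.
have := distance_step eta0 eL F0 (ltW D00) wE wG GG zD bb.
rewrite /main_noise /err; rewrite !expr2; lra.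
Qed.

Let distance_sum t : (t <= T)%N -> (forall s, (s < t)%N -> good_state s) ->
  inner (zb t - xs) (zb t - xs) + eta * \sum_(0 <= s < t) F s <=
  D0 ^+ 2 + t%:R * err + \sum_(0 <= s < t) main_noise s.
Proof.
elim: t => [|t IH] tT good.
  by rewrite !big_geq// mulr0 mul0r !addr0.
have {}IH := IH (ltnW tT) (fun s st => good s (leqW st)).
rewrite !big_nat_recr//= -natr1.
have := distance_decrease good; lra.
Qed.

(** Multiplied by [eta T = 2 D0^2 / eps], the hypotheses [LB] and [Db] bound the drift and bias
    terms by fractions of [D0^2]; the quadratic bias term also uses [eta eps <= 2 D0^2], that is
    [T >= 1]. *)
Let err_sum : T%:R * err <= D0 ^+ 2 / 2.
Proof.
have X0 : 0 <= eta * T%:R by rewrite mulr_ge0 ?ler0n// ltW.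
have T1 : (1 : R) <= T%:R by rewrite ler1n.
have c1 : c ^+ 2 <= 1.
  have c1' : c <= 1 by have cb' := cb; have beta0' := beta0; lra.
  by rewrite expr_le1// ltW.
have D2 : 0 <= D0 ^+ 2 by exact: sqr_ge0.
have p0 : 0 <= D0 * b0 by rewrite mulr_ge0// ltW.
have k1 := ler_wpM2l X0 LB.
have eL : eta * L <= 16^-1 by have := etaL; lra.
have eL0 : 0 <= eta * L by rewrite mulr_ge0 ?ltW.
have LB0 : 0 <= L * B ^+ 2 by rewrite mulr_ge0 ?sqr_ge0// ltW.
have k2 : (eta * T%:R) * ((eta * L) * (L * B ^+ 2)) <= (eta * T%:R) * (16^-1 * (L * B ^+ 2)).
  by apply: ler_wpM2l => //; exact: ler_wpM2r.
have k3 := ler_wpM2l X0 Db.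
have ee : eta * eps <= 2 * D0 ^+ 2.
  rewrite -etaT [leRHS]mulrAC -[leLHS]mulr1 ler_wpM2l// mulr_ge0// ltW//.
have k4 : 192 * (eta * T%:R * eta * b0 ^+ 2 * 3) <= D0 ^+ 2.
  have sq : (48 * (D0 * b0)) ^+ 2 <= eps ^+ 2.
    by rewrite ler_pXn2r// nnegrE; [rewrite mulr_ge0|exact: ltW].
  have Xe : 0 <= eta * T%:R * eta by rewrite mulr_ge0// ltW.
  have s1 := ler_wpM2l Xe sq.
  have s2 : (eta * T%:R * eps) * (eta * eps) <= (2 * D0 ^+ 2) * (2 * D0 ^+ 2).
    by rewrite etaT ler_wpM2l// mulr_ge0.
  have D2p : 0 < D0 ^+ 2 by rewrite exprn_gt0.
  rewrite -(ler_pM2l D2p); rewrite !expr2 in s1 s2 *; lra.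
rewrite /err; have := etaT => etaT'; rewrite !expr2 in k1 k2 k3 k4 D2 etaT' *.
lra.
Qed.

Let err_ge0 : 0 <= err.
Proof.
by rewrite /err !addr_ge0// !mulr_ge0 ?sqr_ge0// ltW.
Qed.

(** [D0^2] from the start, one half of it from drift and bias, one half from the noise. The total
    stays below [(3/2 D0)^2], which lets the induction continue. *)
Let distance_bound t : (t <= T)%N -> (forall s, (s < t)%N -> good_state s) ->
  inner (zb t - xs) (zb t - xs) + eta * \sum_(0 <= s < t) F s <= 2 * D0 ^+ 2.
Proof.
move=> tT good; have h1 := distance_sum tT good; have h2 := main_event tT good.
have h3 : t%:R * err <= T%:R * err by rewrite ler_wpM2r// ler_nat.
have := err_sum; lra.
Qed.

Let all_good t : (t <= T)%N -> good_state t.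
Proof.
elim/ltn_ind: t => t IH tT.
have good s : (s < t)%N -> good_state s.
  by move=> st; apply: IH => //; exact: leq_trans (ltnW st) tT.
(* The pair bound comes first and includes time [t] itself: the position of [x t m] relative to
   [zb t] depends on it. *)
have zB s : (s <= t)%N -> forall m m', norm2 (z s m - z s m') <= B.
  rewrite leq_eqVlt => /orP[/eqP -> m m'|/good[]//]; exact: good_zpair.
have zD : norm2 (zb t - xs) <= 3 / 2 * D0.
  have D00' := D00.
  rewrite norm2_le; last lra.
  have h1 := distance_bound tT good.
  have h2 : 0 <= eta * \sum_(0 <= s < t) F s.
    by apply: mulr_ge0; [exact: ltW|apply: sumr_ge0 => s _; rewrite subr_ge0].
  have h3 : 0 <= D0 ^+ 2 by exact: sqr_ge0.
  rewrite !expr2 in h1 h3 *; lra.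
split => //; last exact: zB.
move=> m; apply: OmP.
have -> : x t m - xs = (x t m - zb t) + (zb t - xs) by rewrite addrA subrK.
have h1 := x_zbar m zB; have h2 := norm2D (x t m - zb t) (zb t - xs).
have := BD; have := D00; lra.
Qed.

Lemma deterministic_convergence :
  f (T%:R^-1 *: \sum_(j < T) zb j) - f xs <= eps.
Proof.
have good s : (s < T)%N -> good_state s by move=> /ltnW; exact: all_good.
have Tn0 : (T%:R : R) != 0 by rewrite pnatr_eq0 -lt0n.
have h1 := distance_bound (leqnn T) good.
set xh := _ *: _.
have zO s : (s < T)%N -> norm2 (zb s - xs) <= 3 / 2 * D0 by move=> /good[].
have xhO : Om xh.
  apply: OmP; have D00' := D00; apply: (@le_trans _ _ (3 / 2 * D0)); last lra.
  have -> : xh - xs = avg (fun j : 'I_T => zb j - xs) by rewrite avgB avg_cst.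
  by apply: norm2_avg => // j; exact: zO.
(* Jensen through the tangent plane at [xh], whose linear part averages to zero; [xh] is in the
   region because balls are convex. *)
have jens : f xh <= T%:R^-1 * \sum_(j < T) f (zb j).
  have -> : f xh = T%:R^-1 * \sum_(j < T) (f xh + inner (gf xh) (zb j - xh)).
    rewrite big_split/= sumr_const card_ord -inner_sumr big_split/= sumr_const card_ord.
    have -> : \sum_(j < T) zb j = xh *+ T.
      by rewrite -scaler_nat /xh scalerA mulfV// scale1r.
    by rewrite mulNrn subrr inner0r addr0 -[f xh *+ T]mulr_natl mulrA mulVf// mul1r.
  rewrite ler_wpM2l ?invr_ge0 ?ler0n// ler_sum// => j _; apply: conv => //.
  by apply: OmP; have := zO j (ltn_ord j); have := D00; lra.
have sumF : \sum_(0 <= s < T) F s = \sum_(j < T) f (zb j) - T%:R * f xs.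
  by rewrite big_mkord /F big_split/= sumr_const card_ord mulNrn mulr_natl.
have h2 : eta * \sum_(0 <= s < T) F s <= 2 * D0 ^+ 2.
  have := inner_ge0 (zb T - xs); lra.
have h3 : \sum_(0 <= s < T) F s <= T%:R * eps.
  rewrite -(ler_pM2l eta0) (le_trans h2)// -etaT; lra.
apply: (@le_trans _ _ (T%:R^-1 * \sum_(0 <= s < T) F s)).
  by rewrite sumF mulrBr mulrA mulVf// mul1r lerD2r.
by rewrite ler_pdivrMl ?ltr0n.
Qed.

End Deterministic.

(** * Clipping and clipped moments *)

Section ClipScalar.
Context {R : realType}.
Variable rho : R.
Hypothesis rho0 : 0 < rho.

Definition clip1 (X : R) : R := Num.sg X * Num.min `|X| rho.

Lemma clip1E X : clip1 X = Num.max (- rho) (Num.min X rho).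
Proof.
have r0 := rho0; rewrite /clip1.
have [X0|X0|->] := ltgtP X 0.
- rewrite ltr0_sg// ltr0_norm// mulN1r.
  rewrite (_ : Num.min X rho = X); last by apply/min_idPl; lra.
  by rewrite oppr_min opprK maxC.
- rewrite gtr0_sg// gtr0_norm// mul1r; apply/esym/max_idPr.
  by rewrite le_min; apply/andP; split; lra.
- rewrite sgr0 mul0r; apply/esym.
  by rewrite (_ : Num.min 0 rho = 0); [apply/max_idPr|apply/min_idPl]; lra.
Qed.

Lemma clip1_le X : `|clip1 X| <= rho.
Proof.
have r0 := rho0; rewrite clip1E ler_norml le_max lexx /= ge_max ge_min lexx orbT.
by rewrite andbT; lra.
Qed.

(** Clipping is the projection onto [[-rho, rho]], which is nonexpansive and fixes [mu]. *)
Lemma clip1_contract X mu : `|mu| <= rho -> `|clip1 X - mu| <= `|X - mu|.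
Proof.
rewrite ler_norml clip1E => /andP[m1 m2]; have r0 := rho0.
have [h1|h1] := leP X rho; last first.
  rewrite (max_idPr _); last lra.
  by rewrite !ger0_norm; lra.
have [h2|h2] := leP (- rho) X; first by [].
by rewrite !ler0_norm; lra.
Qed.

(** Clipping acts only if [|X| > rho]; then [|X - mu|] is at least [rho / 2] and exceeds the loss
    [|X| - rho], so the factor [(|X - mu| * 2 / rho)^(alpha - 1) >= 1] may be inserted. *)
Lemma clip1_bias X mu alpha : 1 <= alpha -> `|mu| <= rho / 2 ->
  `|clip1 X - X| <= `|X - mu| `^ alpha * (2 / rho) `^ (alpha - 1).
Proof.
move=> a1 mur; have r0 := rho0.
have [Xr|Xr] := leP `|X| rho.
  rewrite clip1E; move: Xr; rewrite ler_norml => /andP[h1 h2].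
  by rewrite (min_idPl h2) (max_idPr h1) subrr normr0 mulr_ge0 ?powR_ge0.
have cX : `|clip1 X - X| = `|X| - rho.
  rewrite clip1E; have [X0|X0] := leP 0 X.
    rewrite ger0_norm// in Xr *; rewrite (min_idPr (ltW Xr)) (max_idPr _); last lra.
    by rewrite ler0_norm; lra.
  rewrite ltr0_norm// in Xr *; rewrite (min_idPl _); last lra.
  by rewrite (max_idPl _) ?ger0_norm; lra.
have hXmu : `|X| <= `|X - mu| + `|mu| by rewrite -{1}(subrK mu X) ler_normD.
move: (`|X - mu| : R) hXmu => y hXmu.
have yr : rho / 2 <= y by lra.
have y0 : 0 < y by lra.
rewrite cX; apply: (@le_trans _ _ y); first lra.
have -> : y `^ alpha = y * y `^ (alpha - 1).
  have yn : y != 0 by rewrite gt_eqF.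
  have := @powRD _ y 1 (alpha - 1); rewrite yn implybT => /(_ isT).
  by rewrite (addrC 1) subrK powRr1// ltW.
have r2 : 0 <= 2 / rho by rewrite divr_ge0// ltW.
rewrite -mulrA ler_peMr ?(ltW y0)// -powRM// ?(ltW y0)//.
have h1 : 1 <= y * (2 / rho) by rewrite mulrA ler_pdivlMr//; lra.
apply: (@le_trans _ _ (1 `^ (alpha - 1))); first by rewrite powR1.
rewrite ge0_ler_powR ?nnegrE//; first by rewrite subr_ge0.
by rewrite mulr_ge0// ltW.
Qed.

(** A pointwise substitute for Jensen in passing from the moment of order [alpha] to the second:
    with [s] the moment bound it loses only a factor 2. *)
Lemma sqr_le_powR (y s alpha : R) : 0 <= y -> 0 < s -> 2 <= alpha ->
  y ^+ 2 <= s ^+ 2 + y `^ alpha * s `^ (2 - alpha).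
Proof.
move=> y0 s0 a2; have [ys|sy] := leP y s.
  rewrite -[leLHS]addr0 lerD ?mulr_ge0 ?powR_ge0// ler_pXn2r ?nnegrE// ltW//.
have yp : 0 < y by exact: lt_trans sy.
apply: (@le_trans _ _ (y `^ alpha * s `^ (2 - alpha))); last by rewrite lerDr sqr_ge0.
have -> : y `^ alpha = y ^+ 2 * y `^ (alpha - 2).
  have yn : y != 0 by rewrite gt_eqF.
  have := @powRD _ y 2 (alpha - 2); rewrite yn implybT => /(_ isT).
  by rewrite (addrC 2) subrK powR_mulrn.
rewrite -mulrA ler_peMr ?sqr_ge0//.
rewrite -[2 - alpha]opprB powRN ler_pdivlMr ?powR_gt0// mul1r.
by rewrite ge0_ler_powR ?nnegrE ?subr_ge0 ?(ltW s0) ?(ltW yp) ?(ltW sy).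
Qed.

End ClipScalar.

Section ClipMoments.
Context {R : realType} {dX : measure_display} {Xi : measurableType dX}.
Variables (D : probability Xi R) (rho alpha mu sg : R) (X : Xi -> R).
Hypotheses (rho0 : 0 < rho) (alpha2 : 2 <= alpha) (sg0 : 0 <= sg) (mX : measurable_fun setT X).
Hypothesis mur : `|mu| <= rho / 2.
Hypothesis Xint : D.-integrable setT (fun v => (X v)%:E).
Hypothesis Xmean : (\int[D]_v (X v)%:E = mu%:E)%E.
Hypothesis Xmom : (\int[D]_v (`|X v - mu| `^ alpha)%:E <= (sg `^ alpha)%:E)%E.

Lemma measurable_clip1 (d : measure_display) (T : measurableType d) (Y : T -> R) :
  measurable_fun setT Y -> measurable_fun setT (fun v => clip1 rho (Y v)).
Proof.
move=> mY; rewrite (_ : (fun v => _) = fun v => Num.max (- rho) (Num.min (Y v) rho)).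
  by apply: measurable_maxr => //; exact: measurable_minr.
by apply/funext => v; rewrite clip1E.
Qed.

Lemma bmeas_clip1 (d : measure_display) (T : measurableType d) (Y : T -> R) :
  measurable_fun setT Y -> bmeas (fun v => clip1 rho (Y v)).
Proof.
move=> mY; split; first exact: measurable_clip1.
by exists rho => v; exact: clip1_le.
Qed.

Let mpow : measurable_fun setT (fun v => `|X v - mu| `^ alpha).
Proof.
apply: (measurableT_comp (measurable_powR _)).
by apply: measurableT_comp => //; apply: measurable_funB.
Qed.

Lemma clip1_mean_bias :
  `|\int[D]_v clip1 rho (X v) - mu| <= sg `^ alpha * (2 / rho) `^ (alpha - 1).
Proof.
have bc := bmeas_clip1 mX.
have a1 : 1 <= alpha by have := alpha2; lra.
have muE : mu = \int[D]_v X v by rewrite /Rintegral Xmean.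
have ci := bmeas_integrable D bc.
have XintE : D.-integrable setT (EFin \o X) by exact: Xint.
rewrite muE -RintegralB//.
apply: (le_trans (le_normr_Rintegral _ _)) => //; first exact: (integrableB _ ci XintE).
have iB : D.-integrable setT (EFin \o (fun v => `|clip1 rho (X v) - X v|)).
  exact: (integrable_norm (integrableB measurableT ci XintE)).
rewrite -lee_fin /Rintegral fineK; last exact: integrable_fin_num.
apply: (@le_trans _ _ (\int[D]_v ((`|X v - mu| `^ alpha)%:E *
    ((2 / rho) `^ (alpha - 1))%:E))%E).
  apply: ge0_le_integral => //.
  - by case/integrableP : iB.
  - by apply/measurable_EFinP; apply: measurable_funM.
  - by move=> v _; rewrite /= lee_fin; exact: clip1_bias.
rewrite ge0_integralZr ?lee_fin ?powR_ge0//; last exact/measurable_EFinP.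
by rewrite EFinM lee_wpmul2r// lee_fin powR_ge0.
Qed.

Lemma clip1_second_moment : \int[D]_v (clip1 rho (X v) - mu) ^+ 2 <= 2 * sg ^+ 2.
Proof.
have bc := bmeas_clip1 mX.
have b2 : bmeas (fun v => (clip1 rho (X v) - mu) ^+ 2).
  by apply: bmeasX2; apply: bmeasD => //; exact: bmeas_cst.
have key s : 0 < s ->
    \int[D]_v (clip1 rho (X v) - mu) ^+ 2 <= s ^+ 2 + sg `^ alpha * s `^ (2 - alpha).
  move=> s0; rewrite -lee_fin -bmeas_EFin_Rintegral//.
  apply: (@le_trans _ _ (\int[D]_v ((s ^+ 2)%:E +
     (`|X v - mu| `^ alpha)%:E * (s `^ (2 - alpha))%:E))%E).
    apply: ge0_le_integral => //.
    - by move=> v _; rewrite lee_fin sqr_ge0.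
    - by apply/measurable_EFinP; case: b2.
    - by apply/measurable_EFinP; apply: measurable_funD => //; exact: measurable_funM.
    - move=> v _; rewrite -EFinM -EFinD lee_fin.
      apply: le_trans (sqr_le_powR _ s0 alpha2) => //.
      rewrite -[leLHS]real_normK ?num_real// ler_pXn2r ?nnegrE//.
      by apply: clip1_contract => //; have := mur; have := rho0; lra.
  rewrite ge0_integralD//; last 3 first.
  - by move=> v _; rewrite lee_fin sqr_ge0.
  - by move=> v _; rewrite mule_ge0// lee_fin powR_ge0.
  - by apply/measurable_EFinP; exact: measurable_funM.
  rewrite integral_cst//= probability_setT mule1 ge0_integralZr ?lee_fin ?powR_ge0//; last exact/measurable_EFinP.
  by rewrite EFinD leeD2l// EFinM lee_wpmul2r// lee_fin powR_ge0.
have [s00|s00] := eqVneq sg 0; last first.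
  have sgp : 0 < sg by rewrite lt_def s00.
  apply: (le_trans (key _ sgp)); rewrite -powRD; last by rewrite s00 implybT.
  by rewrite (_ : alpha + (2 - alpha) = 2) ?powR_mulrn//; lra.
rewrite s00 expr0n/= mulr0 leNgt; apply/negP.
move: (\int[D]_v (clip1 rho (X v) - mu) ^+ 2) key => I key I0.
(* For [sg = 0] the estimate says [I <= s^2] for all positive [s]; this choice contradicts
   [I > 0]. *)
have s0 : 0 < Num.sqrt (I / 2) by rewrite sqrtr_gt0 divr_gt0.
have a0 : alpha != 0 by rewrite gt_eqF// (lt_le_trans _ alpha2).
have := key _ s0; rewrite s00 powR0//.
rewrite mul0r addr0 sqr_sqrtr; [lra|rewrite divr_ge0// ltW//].
Qed.

(* The mean minimises the quadratic deviation. *)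
Lemma clip1_variance : \int[D]_v (clip1 rho (X v) - \int[D]_v clip1 rho (X v)) ^+ 2 <= 2 * sg ^+ 2.
Proof.
apply: le_trans clip1_second_moment.
have bc := bmeas_clip1 mX; set h := \int[D]_v clip1 rho (X v).
have E (a : R) : \int[D]_v (clip1 rho (X v) - a) ^+ 2 =
    \int[D]_v (clip1 rho (X v)) ^+ 2 + (- (2 * a) * h + a ^+ 2).
  have b2 := bmeasX2 bc; have b1 := bmeasZ (- (2 * a)) bc; have b0 := bmeas_cst (T := Xi) (a ^+ 2).
  transitivity (\int[D]_v (clip1 rho (X v) ^+ 2 + (- (2 * a) * clip1 rho (X v) + a ^+ 2))).
    by apply: eq_Rintegral => v _; ring.
  rewrite RexpectD//; last exact: bmeasD.
  by rewrite RexpectD// RexpectZ// Rexpect_cst.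
rewrite !E; have := sqr_ge0 (h - mu); rewrite !expr2; lra.
Qed.

End ClipMoments.

(** * Measurable vectors and quadratic moment generating functions *)

Section VectorMeasurability.
Context {R : realType} {d : nat} {dT : measure_display} {T : measurableType dT}.
Implicit Types X Y : T -> 'rV[R]_d.

Definition vmeas X : Prop := forall i, measurable_fun setT (fun w => X w 0 i).

Lemma vmeas_cst v : vmeas (fun=> v).
Proof. by move=> i; exact: measurable_cst. Qed.

Lemma vmeasD X Y : vmeas X -> vmeas Y -> vmeas (fun w => X w + Y w).
Proof.
move=> mX mY i; rewrite (_ : (fun w => _) = fun w => X w 0 i + Y w 0 i).
  exact: measurable_funD.
by apply/funext => w; rewrite mxE.
Qed.

Lemma vmeasZ a X : vmeas X -> vmeas (fun w => a *: X w).
Proof.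
move=> mX i; rewrite (_ : (fun w => _) = fun w => a * X w 0 i).
  exact: measurable_funM.
by apply/funext => w; rewrite mxE.
Qed.

Lemma vmeasB X Y : vmeas X -> vmeas Y -> vmeas (fun w => X w - Y w).
Proof.
move=> mX mY i; rewrite (_ : (fun w => _) = fun w => X w 0 i - Y w 0 i).
  exact: measurable_funB.
by apply/funext => w; rewrite !mxE.
Qed.

Lemma vmeas_avg (M : nat) (X : 'I_M -> T -> 'rV[R]_d) :
  (forall m, vmeas (X m)) -> vmeas (fun w => avg (fun m => X m w)).
Proof.
move=> mX i.
rewrite (_ : (fun w => _) = fun w => M%:R^-1 * \sum_(m < M) X m w 0 i).
  by apply: measurable_funM => //; apply: measurable_sum => m; exact: mX.
by apply/funext => w; rewrite mxE summxE.
Qed.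

Lemma measurable_inner X Y : vmeas X -> vmeas Y ->
  measurable_fun setT (fun w => inner (X w) (Y w)).
Proof.
by move=> mX mY; apply: measurable_sum => i; exact: measurable_funM.
Qed.

Lemma measurable_norm2 X : vmeas X -> measurable_fun setT (fun w => norm2 (X w)).
Proof.
move=> mX; rewrite (_ : (fun w => _) = fun w => (inner (X w) (X w)) `^ 2^-1).
  apply: (measurableT_comp (measurable_powR _)); exact: measurable_inner.
by apply/funext => w; rewrite powR12_sqrt ?inner_ge0//; congr Num.sqrt.
Qed.

End VectorMeasurability.

Section QuadraticMgf.
Context {R : realType} {d : nat} {dT : measure_display} {T : measurableType dT}.
Variable P : probability T R.

(** Covers both kinds of noise increments, with [k = 3] and [k = 8]. The linear part is centred, so
    the mean comes from the quadratic part; the second moment uses [(a + b)^2 <= 2 a^2 + 2 b^2] and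
    keeps one factor [|Y|^2] to be integrated to [s]. *)
Lemma inner_mgf (Y : T -> 'rV[R]_d) (v : 'rV[R]_d) (th eta k V r s : R) :
  0 <= th -> 0 <= eta -> 0 <= k -> 0 <= r -> 0 <= V ->
  (forall i, bmeas (fun w => Y w 0 i)) -> (forall i, \int[P]_w Y w 0 i = 0) ->
  \int[P]_w inner (Y w) (Y w) <= s -> (forall w, norm2 (Y w) <= r) -> norm2 v <= V ->
  th * (2 * eta * V * r + k * eta ^+ 2 * r ^+ 2) <= 2^-1 ->
  (\int[P]_w (expR (th * (- (2 * eta * inner v (Y w)) + k * eta ^+ 2 * inner (Y w) (Y w))))%:E
   <= (expR (th * k * eta ^+ 2 * s
             + 2 * (th ^+ 2 * (8 * eta ^+ 2 * V ^+ 2 + 2 * k ^+ 2 * eta ^+ 4 * r ^+ 2) * s)))%:E)%E.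
Proof.
move=> th0 eta0 k0 r0 V0 bY EY Es Yr vV thr.
have bvY : bmeas (fun w => inner v (Y w)).
  by apply: bmeas_sum => i; exact: bmeasZ.
have bYY : bmeas (fun w => inner (Y w) (Y w)).
  by apply: bmeas_sum => i; exact: bmeasM.
have EvY : \int[P]_w inner v (Y w) = 0.
  rewrite Rexpect_sum; last by move=> i; exact: bmeasZ.
  by rewrite big1// => i _; rewrite RexpectZ// EY mulr0.
have bX : bmeas (fun w => th * (- (2 * eta * inner v (Y w)) + k * eta ^+ 2 * inner (Y w) (Y w))).
  apply: bmeasZ; apply: bmeasD; last exact: bmeasZ.
  rewrite (_ : (fun w => _) = fun w => - (2 * eta) * inner v (Y w)); first exact: bmeasZ.
  by apply/funext => w; rewrite mulNr.
have sqY w : inner (Y w) (Y w) <= r ^+ 2 by rewrite -norm2_le.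
have sqv : inner v v <= V ^+ 2 by rewrite -norm2_le.
apply: mgf_le => //.
- move=> w; apply: le_trans thr; rewrite ler_wpM2l// lerD//.
    have h : - inner v (Y w) <= V * r.
      by rewrite (le_trans (innerN_le_norm2 _ _))// ler_pM ?norm2_ge0.
    have e2 : 0 <= 2 * eta by rewrite mulr_ge0.
    by have := ler_wpM2l e2 h; rewrite mulrN !mulrA.
  by rewrite ler_wpM2l// mulr_ge0// sqr_ge0.
- have -> : \int[P]_w (th * (- (2 * eta * inner v (Y w)) + k * eta ^+ 2 * inner (Y w) (Y w)))
    = th * k * eta ^+ 2 * \int[P]_w inner (Y w) (Y w).
    transitivity (\int[P]_w (- (th * (2 * eta)) * inner v (Y w) +
        th * k * eta ^+ 2 * inner (Y w) (Y w))).
      by apply: eq_Rintegral => w _; ring.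
    rewrite RexpectD; [|exact: bmeasZ|exact: bmeasZ].
    by rewrite !RexpectZ// EvY mulr0 add0r.
  by rewrite ler_wpM2l// !mulr_ge0// sqr_ge0.
- set q := 8 * eta ^+ 2 * V ^+ 2 + 2 * k ^+ 2 * eta ^+ 4 * r ^+ 2.
  have q0 : 0 <= q.
    by rewrite addr_ge0 ?mulr_ge0 ?sqr_ge0 ?exprn_ge0.
  apply: (@le_trans _ _ (\int[P]_w (th ^+ 2 * q * inner (Y w) (Y w)))).
    apply: le_Rexpect; [exact: bmeasX2|exact: bmeasZ|move=> w].
    rewrite exprMn -[leRHS]mulrA ler_wpM2l ?sqr_ge0//.
    have h1 : inner v (Y w) ^+ 2 <= V ^+ 2 * inner (Y w) (Y w).
      apply: (le_trans (cauchy_schwarz_sqr _ _)).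
      by rewrite ler_wpM2r ?inner_ge0.
    have h2 : inner (Y w) (Y w) ^+ 2 <= r ^+ 2 * inner (Y w) (Y w).
      by rewrite expr2 ler_wpM2r ?inner_ge0.
    have e2 : 0 <= 8 * eta ^+ 2 by rewrite mulr_ge0 ?sqr_ge0.
    have e4 : 0 <= 2 * k ^+ 2 * eta ^+ 4 by rewrite !mulr_ge0 ?sqr_ge0 ?exprn_ge0.
    have k1 := ler_wpM2l e2 h1; have k2 := ler_wpM2l e4 h2.
    have k3 := sqr_ge0 (2 * eta * inner v (Y w) + k * eta ^+ 2 * inner (Y w) (Y w)).
    move: k1 k2 k3; rewrite /q; move: (inner v (Y w)) (inner (Y w) (Y w)) => a b k1 k2 k3.
    rewrite -subr_ge0; rewrite -subr_ge0 in k1; rewrite -subr_ge0 in k2.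
    have := addr_ge0 (addr_ge0 k1 k2) k3.
    by move/le_trans; apply; rewrite le_eqVlt; apply/orP; left; apply/eqP; ring.
  by rewrite RexpectZ// ler_wpM2l// mulr_ge0// sqr_ge0.
Qed.

End QuadraticMgf.

(** * Expectations of functions of one or two samples *)

Section SampleLaw.
Context {R : realType} {dX : measure_display} {Xi : measurableType dX}.
Context {dO : measure_display} {Om : measurableType dO}.
Variables (P : probability Om R) (D : probability Xi R).

Lemma Rexpect_law (X : Om -> Xi) (phi : Xi -> R) : measurable_fun setT X ->
  (forall B, measurable B -> P (X @^-1` B) = D B) -> bmeas phi ->
  \int[P]_w phi (X w) = \int[D]_v phi v.
Proof.
move=> mX law bphi; rewrite /Rintegral; congr fine.
have mphi : measurable_fun setT (EFin \o phi) by apply/measurable_EFinP; case: bphi.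
have iphi : P.-integrable (X @^-1` setT) ((EFin \o phi) \o X).
  rewrite preimage_setT; apply: (@bmeas_integrable _ _ _ P (phi \o X)).
  case: bphi => m1 [c hc]; split; first exact: measurableT_comp.
  by exists c => w; exact: hc.
have := integral_pushforward mX mphi iphi measurableT.
rewrite preimage_setT => <-.
by apply: eq_measure_integral => A mA _; rewrite /= /pushforward law.
Qed.

Lemma bmeas_comp (X : Om -> Xi) (phi : Xi -> R) : measurable_fun setT X ->
  bmeas phi -> bmeas (fun w => phi (X w)).
Proof.
move=> mX [m1 [c hc]]; split; first exact: measurableT_comp.
by exists c => w; exact: hc.
Qed.

(** The product formula is stated for nonnegative integrands, so both factors are shifted by their
    bounds; expanding the shifted product returns zero. *)
Lemma Rexpect_uncorrelated (X Y : Om -> Xi) (a b : Xi -> R) :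
  measurable_fun setT X -> measurable_fun setT Y ->
  (forall A B, measurable A -> measurable B ->
     P (X @^-1` A `&` Y @^-1` B) = P (X @^-1` A) * P (Y @^-1` B))%E ->
  bmeas a -> bmeas b -> \int[P]_w a (X w) = 0 -> \int[P]_w b (Y w) = 0 ->
  \int[P]_w (a (X w) * b (Y w)) = 0.
Proof.
move=> mX mY XY ba bb Ea Eb.
have [_ [ca ha]] := ba; have [_ [cb hb]] := bb.
have baX := bmeas_comp mX ba; have bbY := bmeas_comp mY bb.
have a0 v : 0 <= a v + ca by have := ha v; rewrite ler_norml => /andP[]; lra.
have b0 v : 0 <= b v + cb by have := hb v; rewrite ler_norml => /andP[]; lra.
have bac : bmeas (fun w => a (X w) + ca) by apply: bmeasD => //; exact: bmeas_cst.
have bbc : bmeas (fun w => b (Y w) + cb) by apply: bmeasD => //; exact: bmeas_cst.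
have E1 : \int[P]_w ((a (X w) + ca) * (b (Y w) + cb)) = ca * cb.
  apply/eqP; rewrite -eqe; apply/eqP; rewrite -bmeas_EFin_Rintegral; last exact: bmeasM.
  pose phi (p : Xi * Xi) : \bar R := ((a p.1 + ca) * (b p.2 + cb))%:E.
  have mphi : measurable_fun setT phi.
    apply/measurable_EFinP; apply: measurable_funM; apply: measurable_funD => //.
      by apply: (measurableT_comp (proj1 ba)); exact: measurable_fst.
    by apply: (measurableT_comp (proj1 bb)); exact: measurable_snd.
  have phi0 z : (0 <= phi z)%E by rewrite lee_fin mulr_ge0.
  rewrite (indep_ge0_integral mX mY XY mphi phi0) /phi /=.
  under eq_integral.
    move=> w _; under eq_integral do rewrite EFinM.
    rewrite ge0_integralZl//; last 3 first.
    - by apply/measurable_EFinP; case: bbc.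
    - by move=> w' _; rewrite lee_fin.
    - by rewrite lee_fin.
    rewrite bmeas_EFin_Rintegral// RexpectD//; last exact: bmeas_cst.
    rewrite Eb add0r Rexpect_cst -EFinM.
    over.
  rewrite bmeas_EFin_Rintegral; last by apply: bmeasM => //; exact: bmeas_cst.
  have -> : \int[P]_x ((a (X x) + ca) * cb) = \int[P]_x (cb * (a (X x) + ca)).
    by apply: eq_Rintegral => w _; rewrite mulrC.
  rewrite RexpectZ// RexpectD//; last exact: bmeas_cst.
  by rewrite Ea add0r Rexpect_cst mulrC.
have -> : \int[P]_w (a (X w) * b (Y w)) =
    \int[P]_w ((a (X w) + ca) * (b (Y w) + cb) + (- cb * a (X w) + (- ca * b (Y w) + - (ca * cb)))).
  by apply: eq_Rintegral => w _; ring.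
have bA := bmeasZ (- cb) baX; have bB := bmeasZ (- ca) bbY.
have bC := bmeas_cst (T := Om) (- (ca * cb)).
rewrite RexpectD; [|exact: bmeasM|by apply: bmeasD => //; exact: bmeasD].
rewrite RexpectD//; last exact: bmeasD.
rewrite RexpectD// !RexpectZ// Ea Eb Rexpect_cst E1; lra.
Qed.

End SampleLaw.

(** * The noise of the clipped oracle *)

Section OracleNoise.
Context {R : realType} {d M : nat} {dX : measure_display} {Xi : measurableType dX}.
Context {dO : measure_display} {Om : measurableType dO}.
Variables (D : probability Xi R) (P : probability Om R).
Variables (xi : 'I_M -> nat -> Om -> Xi) (g : 'rV[R]_d -> Xi -> 'rV[R]_d).
Variables (gf : 'rV[R]_d -> 'rV[R]_d) (OmS : set 'rV[R]_d).
Variables (sigma : 'rV[R]_d) (alpha rho : R).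
Hypotheses (M0 : (0 < M)%N) (rho0 : 0 < rho) (alpha2 : 2 <= alpha).
Hypothesis sigma0 : forall i, 0 <= sigma 0 i.
Hypothesis mg : oracle_measurable g.
Hypothesis mxi : forall m t, measurable_fun setT (xi m t).
Hypothesis law : forall m t B, measurable B -> P (xi m t @^-1` B) = D B.
Hypothesis xi_indep : mutually_independent P (fun p : 'I_M * nat => xi p.1 p.2).
Hypothesis unbiased : forall x i, D.-integrable setT (fun v => (g x v 0 i)%:E) /\
  (\int[D]_v (g x v 0 i)%:E = (gf x 0 i)%:E)%E.
Hypothesis moment : forall x i, OmS x ->
  (\int[D]_v (`|g x v 0 i - gf x 0 i| `^ alpha)%:E <= (sigma 0 i `^ alpha)%:E)%E.
Hypothesis gf_le : forall x i, OmS x -> `|gf x 0 i| <= rho / 2.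

(** Splits the error of the clipped oracle: [clip_mean x - gf x] is the bias, and what remains is
    centred at every [x], inside the region or not. *)
Definition clip_mean (x : 'rV[R]_d) : 'rV[R]_d :=
  \row_i \int[D]_v clip1 rho (g x v 0 i).
Definition noise (x : 'rV[R]_d) (v : Xi) : 'rV[R]_d := clip (g x v) rho - clip_mean x.

Lemma clip_coord (X : 'rV[R]_d) i : clip X rho 0 i = clip1 rho (X 0 i).
Proof. by rewrite mxE. Qed.

Let mgx x i : measurable_fun setT (fun v => g x v 0 i).
Proof. by apply: (mg (X := fun=> x) (Y := id)). Qed.

Lemma noise_coord x v i :
  noise x v 0 i = clip1 rho (g x v 0 i) - \int[D]_v clip1 rho (g x v 0 i).
Proof. by rewrite !mxE. Qed.

Lemma bmeas_noise x i : bmeas (fun v => noise x v 0 i).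
Proof.
rewrite (_ : (fun v => _) = fun v => clip1 rho (g x v 0 i) +
    - \int[D]_v clip1 rho (g x v 0 i)).
  by apply: bmeasD; [exact: bmeas_clip1|exact: bmeas_cst].
by apply/funext => v; rewrite noise_coord.
Qed.

Lemma norm2_clip X : norm2 (clip X rho : 'rV[R]_d) <= Num.sqrt d%:R * rho.
Proof.
by apply: norm2_coord => [|i]; [exact: ltW|rewrite clip_coord clip1_le].
Qed.

Lemma norm2_clip_mean x : norm2 (clip_mean x) <= Num.sqrt d%:R * rho.
Proof.
apply: norm2_coord => [|i]; first exact: ltW.
have bc := bmeas_clip1 rho0 (mgx x i).
rewrite mxE ler_norml; apply/andP; split.
  rewrite -[leLHS](Rexpect_cst D); apply: le_Rexpect => //; first exact: bmeas_cst.
  by move=> v; have := clip1_le rho0 (g x v 0 i); rewrite ler_norml => /andP[].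
rewrite -[leRHS](Rexpect_cst D); apply: le_Rexpect => //; first exact: bmeas_cst.
by move=> v; have := clip1_le rho0 (g x v 0 i); rewrite ler_norml => /andP[].
Qed.

Lemma norm2_noise x v : norm2 (noise x v) <= 2 * (Num.sqrt d%:R * rho).
Proof.
rewrite (le_trans (norm2B _ _))//.
by have := norm2_clip (g x v); have := norm2_clip_mean x; lra.
Qed.

Lemma norm2_bias x : OmS x -> norm2 (clip_mean x - gf x) <=
  norm2 (\row_i (sigma 0 i `^ alpha)) * (2 / rho) `^ (alpha - 1).
Proof.
move=> xO; rewrite norm2_le ?mulr_ge0 ?norm2_ge0 ?powR_ge0// exprMn norm2_sqr.
rewrite /inner mulr_suml; apply: ler_sum => i _.
rewrite -!expr2 -exprMn !mxE -[leLHS]real_normK ?num_real//.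
rewrite ler_pXn2r ?nnegrE ?mulr_ge0 ?powR_ge0//.
have [h1 h2] := unbiased x i.
by apply: clip1_mean_bias => //; [exact: gf_le | exact: moment].
Qed.

Lemma noise_mean0 x m t i : \int[P]_w noise x (xi m t w) 0 i = 0.
Proof.
rewrite (Rexpect_law (mxi m t) (law m t) (bmeas_noise x i)).
have bc := bmeas_clip1 rho0 (mgx x i).
under eq_Rintegral do rewrite noise_coord.
by rewrite RexpectD ?Rexpect_cst ?subrr//; exact: bmeas_cst.
Qed.

Lemma bmeas_noise_xi x m t i : bmeas (fun w => noise x (xi m t w) 0 i).
Proof. exact: (bmeas_comp (mxi m t) (bmeas_noise x i)). Qed.

Lemma noise_variance x m t : OmS x ->
  \int[P]_w inner (noise x (xi m t w)) (noise x (xi m t w)) <= 2 * inner sigma sigma.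
Proof.
move=> xO; rewrite Rexpect_sum => [|i]; last by apply: bmeasM; exact: bmeas_noise_xi.
rewrite mulr_sumr; apply: ler_sum => i _.
have b2 := bmeasX2 (bmeas_noise x i).
rewrite (Rexpect_law (mxi m t) (law m t) b2) -expr2.
have [h1 h2] := unbiased x i.
under eq_Rintegral do rewrite noise_coord.
by apply: (@clip1_variance _ _ _ D rho alpha (gf x 0 i)) => //;
  [exact: gf_le | exact: moment].
Qed.

Lemma noise_uncorrelated x x' m m' t : m != m' ->
  \int[P]_w inner (noise x (xi m t w)) (noise x' (xi m' t w)) = 0.
Proof.
move=> mm'; rewrite Rexpect_sum => [|i]; last by apply: bmeasM; exact: bmeas_noise_xi.
rewrite big1// => i _.
apply: (Rexpect_uncorrelated (mxi m t) (mxi m' t) _ (bmeas_noise x i) (bmeas_noise x' i)).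
- move=> A B mA mB.
  pose C (p : 'I_M * nat) := if p.1 == m then A else B.
  have mC p : measurable (C p) by rewrite /C; case: ifP.
  have us : uniq [:: (m, t); (m', t)] by rewrite /= inE andbT xpair_eqE eqxx andbT.
  have := xi_indep us mC; rewrite !big_cons !big_nil /C /= eqxx.
  by rewrite (negbTE (_ : m' != m)) ?setIT ?mule1// eq_sym.
- exact: noise_mean0.
- exact: noise_mean0.
Qed.

(** The cross terms vanish by independence of the workers at frozen points [x m]: the source of the
    linear speed-up in [M]. *)
Lemma avg_noise_variance (x : 'I_M -> 'rV[R]_d) t : (forall m, OmS (x m)) ->
  \int[P]_w inner (avg (fun m => noise (x m) (xi m t w)))
                  (avg (fun m => noise (x m) (xi m t w)))
  <= 2 * inner sigma sigma / M%:R.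
Proof.
move=> xO.
have bmm m m' : bmeas (fun w => inner (noise (x m) (xi m t w)) (noise (x m') (xi m' t w))).
  by apply: bmeas_sum => i; apply: bmeasM; exact: bmeas_noise_xi.
have -> : \int[P]_w inner (avg (fun m => noise (x m) (xi m t w)))
                  (avg (fun m => noise (x m) (xi m t w))) =
  M%:R^-1 * (M%:R^-1 * \sum_(m < M) \int[P]_w inner (noise (x m) (xi m t w)) (noise (x m) (xi m t w))).
  transitivity (\int[P]_w (M%:R^-1 * (M%:R^-1 * \sum_(m < M) \sum_(m' < M)
      inner (noise (x m) (xi m t w)) (noise (x m') (xi m' t w))))).
    apply: eq_Rintegral => w _; rewrite /avg innerZl innerZr inner_suml.
    by under eq_bigr do rewrite inner_sumr.
  have bs m : bmeas (fun w => \sum_(m' < M) inner (noise (x m) (xi m t w)) (noise (x m') (xi m' t w))).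
    by apply: bmeas_sum.
  rewrite RexpectZ; last by apply: bmeasZ; exact: bmeas_sum.
  rewrite RexpectZ; last exact: bmeas_sum.
  rewrite Rexpect_sum//; congr (_ * (_ * _)); apply: eq_bigr => m _.
  rewrite Rexpect_sum// (bigD1 m)//= big1 ?addr0// => m' mm'.
  by apply: noise_uncorrelated; rewrite eq_sym.
rewrite [leRHS]mulrC ler_wpM2l ?invr_ge0 ?ler0n//.
by apply: mean_le => // m; exact: noise_variance.
Qed.

Lemma pair_noise_variance x x' m m' t : OmS x -> OmS x' ->
  \int[P]_w inner (noise x (xi m t w) - noise x' (xi m' t w))
                  (noise x (xi m t w) - noise x' (xi m' t w))
  <= 8 * inner sigma sigma.
Proof.
move=> xO xO'.
have b1 y n : bmeas (fun w => inner (noise y (xi n t w)) (noise y (xi n t w))).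
  by apply: bmeas_sum => i; apply: bmeasM; exact: bmeas_noise_xi.
have h1 := noise_variance m t xO; have h2 := noise_variance m' t xO'.
apply: (@le_trans _ _ (\int[P]_w (2 * inner (noise x (xi m t w)) (noise x (xi m t w)) +
   2 * inner (noise x' (xi m' t w)) (noise x' (xi m' t w))))).
  apply: le_Rexpect.
  - have b2 i : bmeas (fun w => (noise x (xi m t w) - noise x' (xi m' t w)) 0 i).
      rewrite (_ : (fun w => _) = fun w =>
        noise x (xi m t w) 0 i + -1 * noise x' (xi m' t w) 0 i).
        by apply: bmeasD; [|apply: bmeasZ]; exact: bmeas_noise_xi.
      by apply/funext => w; rewrite !mxE mulN1r.
    by apply: bmeas_sum => i; exact: bmeasM.
  - by apply: bmeasD; exact: bmeasZ.
  - move=> w; apply: (le_trans (inner_sqD _ _)).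
    by rewrite innerNl innerNr opprK.
rewrite RexpectD; [|exact: bmeasZ|exact: bmeasZ].
have two : 0 <= 2 :> R by [].
rewrite (RexpectZ P 2 (b1 x m)) (RexpectZ P 2 (b1 x' m')).
apply: (le_trans (lerD (ler_wpM2l two h1) (ler_wpM2l two h2))).
by rewrite le_eqVlt; apply/orP; left; apply/eqP; ring.
Qed.

(** An integral depending on a parameter is measurable by Tonelli, after a shift by [rho] that makes
    the integrand nonnegative. *)
Lemma vmeas_clip_mean (dT : measure_display) (T : measurableType dT) (X : T -> 'rV[R]_d) :
  vmeas X -> vmeas (fun w => clip_mean (X w)).
Proof.
move=> mX i.
pose phi (p : T * Xi) : \bar R := (clip1 rho (g (X p.1) p.2 0 i) + rho)%:E.
have mphi : measurable_fun setT phi.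
  apply/measurable_EFinP; apply: measurable_funD => //.
  apply: measurable_clip1 => //.
  apply: (mg (X := fun p : T * Xi => X p.1) (Y := snd)) => //.
  by move=> j; apply: (measurableT_comp (mX j)); exact: measurable_fst.
have phi0 z : (0 <= phi z)%E.
  rewrite lee_fin; have := clip1_le rho0 (g (X z.1) z.2 0 i).
  by rewrite ler_norml => /andP[]; lra.
have mF := @measurable_fun_fubini_tonelli_F _ _ _ _ _ D phi mphi phi0.
rewrite (_ : (fun w => _) = fun w => fine (fubini_F D phi w) - rho).
  apply: measurable_funB => //.
  by have := measurableT_comp (fine_measurable measurableT) mF.
apply/funext => w; rewrite mxE /fubini_F /phi /=.
have bc := bmeas_clip1 rho0 (mgx (X w) i); have br := bmeas_cst (T := Xi) rho.
rewrite bmeas_EFin_Rintegral; last exact: bmeasD.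
by rewrite /= RexpectD// Rexpect_cst addrK.
Qed.

Lemma vmeas_clip_oracle (dT : measure_display) (T : measurableType dT)
    (X : T -> 'rV[R]_d) (Y : T -> Xi) : vmeas X -> measurable_fun setT Y ->
  vmeas (fun w => clip (g (X w) (Y w)) rho).
Proof.
move=> mX mY i; under eq_fun do rewrite clip_coord.
by apply: measurable_clip1 => //; exact: mg.
Qed.

Lemma vmeas_noise (dT : measure_display) (T : measurableType dT)
    (X : T -> 'rV[R]_d) (Y : T -> Xi) : vmeas X -> measurable_fun setT Y ->
  vmeas (fun w => noise (X w) (Y w)).
Proof.
by move=> mX mY; apply: vmeasB; [exact: vmeas_clip_oracle|exact: vmeas_clip_mean].
Qed.

End OracleNoise.

(** * The algorithm as a stochastic process *)

Lemma prob_bigsetU_le {R : realType} (dO : measure_display) (Om : measurableType dO)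
    (P : probability Om R) (I : Type) (s : seq I) (A : I -> set Om) (p : R) :
  (forall i, measurable (A i)) -> (forall i, P (A i) <= p%:E)%E ->
  (P (\big[setU/set0]_(i <- s) A i) <= ((size s)%:R * p)%:E)%E.
Proof.
move=> mA Ap; elim: s => [|i s IH]; first by rewrite big_nil measure0 mul0r.
rewrite big_cons; apply: le_trans (measureU2 _ _ _) _ => //.
  exact: bigsetU_measurable.
by rewrite /= -natr1 mulrDl mul1r addrC EFinD leeD.
Qed.

Section Process.
Context {R : realType} {d M : nat} {dX : measure_display} {Xi : measurableType dX}.
Context {dO : measure_display} {Om : measurableType dO}.
Variables (D : probability Xi R) (P : probability Om R) (K T : nat).
Variables (xi : 'I_M -> nat -> Om -> Xi) (g : 'rV[R]_d -> Xi -> 'rV[R]_d).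
Variables (f : 'rV[R]_d -> R) (gf : 'rV[R]_d -> 'rV[R]_d).
Variables (x0 xs sigma : 'rV[R]_d) (alpha rho L eta beta c B eps l l1 th1 th2 dp delta : R).
Let D0 := norm2 (x0 - xs).
Let OmS := [set v : 'rV[R]_d | norm2 (v - xs) <= Num.sqrt 3 * D0].
Let N := Num.sqrt d%:R * rho.
Let b0 := norm2 (\row_i (sigma 0 i `^ alpha) : 'rV[R]_d) * (2 / rho) `^ (alpha - 1).
Let sq := inner sigma sigma.

Hypotheses (M0 : (0 < M)%N) (K0 : (0 < K)%N) (T0 : (0 < T)%N).
Hypotheses (rho0 : 0 < rho) (alpha2 : 2 <= alpha).
Hypothesis sigma0 : forall i, 0 <= sigma 0 i.
Hypothesis mg : oracle_measurable g.
Hypothesis mxi : forall m t, measurable_fun setT (xi m t).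
Hypothesis law : forall m t A, measurable A -> P (xi m t @^-1` A) = D A.
Hypothesis xi_indep : mutually_independent P (fun p : 'I_M * nat => xi p.1 p.2).
Hypothesis unbiased : forall x i, D.-integrable setT (fun v => (g x v 0 i)%:E) /\
  (\int[D]_v (g x v 0 i)%:E = (gf x 0 i)%:E)%E.
Hypothesis moment : forall x i, OmS x ->
  (\int[D]_v (`|g x v 0 i - gf x 0 i| `^ alpha)%:E <= (sigma 0 i `^ alpha)%:E)%E.
Hypothesis gf_le : forall x i, OmS x -> `|gf x 0 i| <= rho / 2.

Hypothesis fmin : forall v, f xs <= f v.
Hypothesis lip : forall v w, OmS v -> OmS w ->
  norm2 (gf v - gf w) <= L * norm2 (v - w).
Hypothesis smooth : forall v, OmS v -> norm2 (gf v) ^+ 2 <= 2 * L * (f v - f xs).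
Hypothesis conv : forall v w, OmS v -> OmS w -> f v + inner (gf v) (w - v) <= f w.

Hypotheses (eta0 : 0 < eta) (L0 : 0 < L) (beta0 : 0 <= beta) (c0 : 0 < c).
Hypotheses (cb : c <= 1 - beta) (etaL : 16 * (eta * L) <= c ^+ 2).
Hypotheses (eps0 : 0 < eps) (D00 : 0 < D0) (B0 : 0 <= B).
Hypotheses (NB : eta * N <= c * B) (BD : 16 * B <= D0) (LB : 128 * (L * B ^+ 2) <= eps).
Hypotheses (etaT : eta * T%:R * eps = 2 * D0 ^+ 2) (Db : 48 * (D0 * b0) <= eps).
Hypothesis dpB : dp + K%:R * (4 * eta * B * b0 + 32 * eta ^+ 2 * b0 ^+ 2) <= B ^+ 2.
Hypothesis dp0 : 0 <= dp.

(** The exponents of [inner_mgf]: here [k = 3], [V = 3/2 D0], [r = 2 N], [s = 2 sq / M]; for [c2],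
    [k = 8], [V = B], [r = 4 N], [s = 8 sq]. *)
Let c1 := th1 * 3 * eta ^+ 2 * (2 * sq / M%:R)
  + 2 * (th1 ^+ 2 * (8 * eta ^+ 2 * (3 / 2 * D0) ^+ 2 + 2 * 3 ^+ 2 * eta ^+ 4 * (2 * N) ^+ 2)
         * (2 * sq / M%:R)).
Let c2 := th2 * 8 * eta ^+ 2 * (8 * sq)
  + 2 * (th2 ^+ 2 * (8 * eta ^+ 2 * B ^+ 2 + 2 * 8 ^+ 2 * eta ^+ 4 * (4 * N) ^+ 2) * (8 * sq)).
Hypotheses (th10 : 0 < th1) (th20 : 0 < th2).
Hypothesis th1_le :
  th1 * (2 * eta * (3 / 2 * D0) * (2 * N) + 3 * eta ^+ 2 * (2 * N) ^+ 2) <= 2^-1.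
Hypothesis th2_le :
  th2 * (2 * eta * B * (4 * N) + 8 * eta ^+ 2 * (4 * N) ^+ 2) <= 2^-1.
Hypothesis dev1 : T%:R * c1 + l1 <= th1 * (D0 ^+ 2 / 2).
Hypothesis dev2 : K%:R * c2 + l <= th2 * dp.
Hypothesis budget : T%:R * expR (- l1) + (T * M * M)%:R * expR (- l) <= delta.

Let s w : 'I_M -> nat -> Xi := fun m t => xi m t w.
Let x t m w := lsgdm_x K g x0 eta beta rho (s w) t m.
Let u t m w := (lsgdm_state K g x0 eta beta rho (s w) t).2 m.
Let z t m w := lsgdm_z K g x0 eta beta rho (s w) t m.
Let zb t w := lsgdm_zbar K g x0 eta beta rho (s w) t.
Let nz t m w w' := noise D g rho (x t m w) (xi m t w').

Let beta1 : beta < 1.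
Proof. by have cb' := cb; have c0' := c0; lra. Qed.

Let state_meas b t : (t <= b)%N ->
  (forall m, vmeas (x t m : info xi (past M b) -> _)) /\
  (forall m, vmeas (u t m : info xi (past M b) -> _)).
Proof.
elim: t => [|t IH] tb; first by split=> m; exact: vmeas_cst.
have [mx mu] := IH (ltnW tb).
have mxit m : measurable_fun setT (xi m t : info xi (past M b) -> Xi).
  by apply: measurable_xi_info; rewrite mem_past.
have mgh m : vmeas (fun w : info xi (past M b) => clip (g (x t m w) (xi m t w)) rho).
  exact: vmeas_clip_oracle.
have mu' m : vmeas (fun w : info xi (past M b) =>
    beta *: u t m w + (1 - beta) *: clip (g (x t m w) (xi m t w)) rho).
  by apply: vmeasD; apply: vmeasZ.
have mx' m : vmeas (fun w : info xi (past M b) => x t m w - eta *: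
    (beta *: u t m w + (1 - beta) *: clip (g (x t m w) (xi m t w)) rho)).
  by apply: vmeasB => //; exact: vmeasZ.
rewrite /x /u /lsgdm_x /=; case: (t %% K == K.-1)%N; split => m /=.
- exact: (vmeas_avg mx').
- exact: (vmeas_avg mu').
- exact: mx'.
- exact: mu'.
Qed.

Let x_meas t m : vmeas (x t m : info xi (past M t) -> _).
Proof. by have [] := @state_meas t t (leqnn t). Qed.

Let z_meas t m : vmeas (z t m : info xi (past M t) -> _).
Proof.
have [mx mu] := @state_meas t t (leqnn t).
rewrite (_ : z t m = fun w => x t m w - (eta * beta / (1 - beta)) *: u t m w).
  by apply: vmeasB => //; exact: vmeasZ.
by apply/funext => w; exact: sgdm_z_momentum.
Qed.

Let zb_meas t : vmeas (zb t : info xi (past M t) -> _).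
Proof. by apply: vmeas_avg => m; exact: z_meas. Qed.

Let fresh t := (info xi (past M t) * info xi (present M t))%type.

Let past_meas t (X : Om -> 'rV[R]_d) : vmeas (X : info xi (past M t) -> _) ->
  vmeas (fun p : fresh t => X p.1).
Proof. by move=> mX i; apply: (measurableT_comp (mX i)); exact: measurable_fst. Qed.

Let nz_meas t m : vmeas (fun p : fresh t => nz t m p.1 p.2).
Proof.
apply: (vmeas_noise D rho0 mg); first by apply: past_meas; exact: x_meas.
have mt : measurable_fun setT (xi m t : info xi (present M t) -> Xi).
  by apply: measurable_xi_info; rewrite mem_present.
by apply: (measurableT_comp mt); exact: measurable_snd.
Qed.

Let in_ball (v : 'rV[R]_d) (r : R) : bool := norm2 v <= r.

Let in_ball_meas t (X : Om -> 'rV[R]_d) r : vmeas (X : info xi (past M t) -> _) ->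
  measurable_fun setT (fun p : fresh t => in_ball (X p.1) r).
Proof.
move=> mX; apply: measurable_fun_ler => //.
by apply: measurable_norm2; exact: past_meas.
Qed.

Let all_in t (r : seq 'I_M) w : bool := all (fun m => in_ball (x t m w - xs) (Num.sqrt 3 * D0)) r.

Let all_in_meas t r : measurable_fun setT (fun p : fresh t => all_in t r p.1).
Proof.
elim: r => [|m r IH]; first exact: measurable_cst.
apply: measurable_and => //; apply: (@in_ball_meas t (fun w => x t m w - xs)).
by apply: vmeasB => //; exact: vmeas_cst.
Qed.

(** Each test asks for what the exponential moment of its own increment needs and reads only the
    state at time [t], so it is measurable for the past; [good_state] implies all of them. *)
Let main_ok t w := in_ball (zb t w - xs) (3 / 2 * D0) && all_in t (enum 'I_M) w.
Let pair_ok m m' t w := in_ball (z t m w - z t m' w) B && all_in t [:: m; m'] w.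

Let Ymain t w w' := avg (fun m => nz t m w w').
Let Ypair m m' t w w' := nz t m w w' - nz t m' w w'.
Let Xmain t w w' : R := if main_ok t w then
  th1 * (- (2 * eta * inner (zb t w - xs) (Ymain t w w'))
         + 3 * eta ^+ 2 * inner (Ymain t w w') (Ymain t w w')) else 0.
Let Xpair m m' t w w' : R := if pair_ok m m' t w then
  th2 * (- (2 * eta * inner (z t m w - z t m' w) (Ypair m m' t w w'))
         + 8 * eta ^+ 2 * inner (Ypair m m' t w w') (Ypair m m' t w w')) else 0.

Let quad_meas t (V : Om -> 'rV[R]_d) (Y : Om -> Om -> 'rV[R]_d) th k :
  vmeas (V : info xi (past M t) -> _) -> vmeas (fun p : fresh t => Y p.1 p.2) ->
  fresh_meas xi t (fun w w' => th * (- (2 * eta * inner (V w) (Y w w'))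
         + k * eta ^+ 2 * inner (Y w w') (Y w w'))).
Proof.
move=> mV mY; rewrite /fresh_meas.
apply: measurable_funM => //; apply: measurable_funD.
  apply: measurableT_comp => //; apply: measurable_funM => //.
  by apply: measurable_inner => //; exact: past_meas.
by apply: measurable_funM => //; exact: measurable_inner.
Qed.

Let Xmain_meas t : fresh_meas xi t (Xmain t).
Proof.
apply: measurable_fun_ifT => //.
- apply: measurable_and; last exact: all_in_meas.
  by apply: (@in_ball_meas t (fun w => zb t w - xs)); apply: vmeasB; [exact: zb_meas|exact: vmeas_cst].
- apply: (@quad_meas t (fun w => zb t w - xs) (Ymain t)).
    by apply: vmeasB; [exact: zb_meas|exact: vmeas_cst].
  by apply: vmeas_avg => m; exact: nz_meas.
Qed.

Let Xpair_meas m m' t : fresh_meas xi t (Xpair m m' t).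
Proof.
apply: measurable_fun_ifT => //.
- apply: measurable_and; last exact: all_in_meas.
  by apply: (@in_ball_meas t (fun w => z t m w - z t m' w)); apply: vmeasB; exact: z_meas.
- apply: (@quad_meas t (fun w => z t m w - z t m' w) (Ypair m m' t)).
    by apply: vmeasB; exact: z_meas.
  by apply: vmeasB; exact: nz_meas.
Qed.

Let N0 : 0 <= N. Proof. by rewrite mulr_ge0 ?sqrtr_ge0// ltW. Qed.
Let sq0 : 0 <= sq. Proof. exact: inner_ge0. Qed.

Let c1_ge0 : 0 <= c1.
Proof.
have s0 : 0 <= 2 * sq / M%:R by rewrite divr_ge0 ?ler0n// mulr_ge0.
have e4 : 0 <= eta ^+ 4 by rewrite exprn_ge0// ltW.
have h1 : 0 <= th1 * 3 * eta ^+ 2 by rewrite !mulr_ge0 ?sqr_ge0// ltW.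
apply: addr_ge0; first exact: mulr_ge0.
apply: mulr_ge0 => //; apply: mulr_ge0 => //; apply: mulr_ge0; first exact: sqr_ge0.
apply: addr_ge0; apply: mulr_ge0; try exact: sqr_ge0.
  by rewrite mulr_ge0// sqr_ge0.
by rewrite mulr_ge0// mulr_ge0// sqr_ge0.
Qed.

Let c2_ge0 : 0 <= c2.
Proof.
have s0 : 0 <= 8 * sq by rewrite mulr_ge0.
have e4 : 0 <= eta ^+ 4 by rewrite exprn_ge0// ltW.
have h1 : 0 <= th2 * 8 * eta ^+ 2 by rewrite !mulr_ge0 ?sqr_ge0// ltW.
apply: addr_ge0; first exact: mulr_ge0.
apply: mulr_ge0 => //; apply: mulr_ge0 => //; apply: mulr_ge0; first exact: sqr_ge0.
apply: addr_ge0; apply: mulr_ge0; try exact: sqr_ge0.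
  by rewrite mulr_ge0// sqr_ge0.
by rewrite mulr_ge0// mulr_ge0// sqr_ge0.
Qed.

Let nz_bmeas t m w i : bmeas (fun w' => nz t m w w' 0 i).
Proof. exact: bmeas_noise_xi. Qed.

Let nz_mean0 t m w i : \int[P]_w' nz t m w w' 0 i = 0.
Proof. exact: (noise_mean0 rho0 mg mxi law). Qed.

Let mgf0 (cc : R) : 0 <= cc -> (\int[P]_w (expR 0)%:E <= (expR cc)%:E)%E.
Proof.
move=> cc0; rewrite integral_cst//= probability_setT mule1 lee_fin ler_expR//.
Qed.

Let Xmain_mgf t w : (\int[P]_w' (expR (Xmain t w w'))%:E <= (expR c1)%:E)%E.
Proof.
rewrite /Xmain; case: (boolP (main_ok t w)) => [/andP[zD xO]|_]; last exact: mgf0.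
have xOm m : OmS (x t m w) by move/allP: xO => /(_ m); rewrite mem_enum; apply.
have V0 : 0 <= 3 / 2 * D0 by rewrite mulr_ge0// ltW.
have r0 : 0 <= 2 * N by rewrite mulr_ge0.
have [t10 e0] := (ltW th10, ltW eta0).
apply: (inner_mgf (r := 2 * N) (V := 3 / 2 * D0)) => //.
- move=> i; rewrite (_ : (fun w' => _) = fun w' => M%:R^-1 * \sum_(m < M) nz t m w w' 0 i).
    by apply: bmeasZ; apply: bmeas_sum => m; exact: nz_bmeas.
  by apply/funext => w'; rewrite mxE summxE.
- move=> i; transitivity (\int[P]_w' (M%:R^-1 * \sum_(m < M) nz t m w w' 0 i)).
    by apply: eq_Rintegral => w' _; rewrite mxE summxE.
  rewrite RexpectZ; last by apply: bmeas_sum => m; exact: nz_bmeas.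
  rewrite Rexpect_sum; last by move=> m; exact: nz_bmeas.
  by rewrite big1 ?mulr0// => m _; exact: nz_mean0.
- exact: (avg_noise_variance M0 rho0 alpha2 sigma0 mg mxi law xi_indep unbiased moment gf_le).
- by move=> w'; apply: norm2_avg => // m; exact: norm2_noise.
Qed.

Let Xpair_mgf m m' t w : (\int[P]_w' (expR (Xpair m m' t w w'))%:E <= (expR c2)%:E)%E.
Proof.
rewrite /Xpair; case: (boolP (pair_ok m m' t w)) => [/andP[zB /and3P[xO xO' _]]|_]; last exact: mgf0.
have coordE w' i : Ypair m m' t w w' 0 i = nz t m w w' 0 i + -1 * nz t m' w w' 0 i.
  by rewrite /Ypair mxE [X in _ + X]mxE mulN1r.
have r0 : 0 <= 4 * N by rewrite mulr_ge0.
have [t20 e0] := (ltW th20, ltW eta0).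
apply: (inner_mgf (r := 4 * N) (V := B)) => //.
- move=> i; under eq_fun do rewrite coordE.
  by apply: bmeasD; [|apply: bmeasZ]; exact: nz_bmeas.
- move=> i; under eq_Rintegral do rewrite coordE.
  rewrite RexpectD//; last by apply: bmeasZ; exact: nz_bmeas.
  by rewrite RexpectZ// !nz_mean0 mulr0 addr0.
- exact: (pair_noise_variance rho0 alpha2 sigma0 mg mxi law unbiased moment gf_le).
- move=> w'; rewrite (le_trans (norm2B _ _))//.
  rewrite (_ : 4 * N = 2 * N + 2 * N); last by ring.
  by apply: lerD; exact: norm2_noise.
Qed.

(** The time is [j.+1]: at time 0 the sum is empty and harmless, so [T] events suffice, as counted
    in [budget]. *)
Let bad_main (j : 'I_T) : set Om :=
  [set w | th1 * (D0 ^+ 2 / 2) < partial_sum Xmain 0 j.+1 w].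
Let bad_pair (p : 'I_T * 'I_M * 'I_M) : set Om :=
  [set w | th2 * dp < partial_sum (Xpair p.1.2 p.2) (p.1.1.+1 %/ K * K) p.1.1.+1 w].

Let bad_meas (X : nat -> Om -> Om -> R) y a b : (forall t, fresh_meas xi t (X t)) ->
  measurable [set w | (y < partial_sum X a b w)%R].
Proof.
move=> mX; have mS : measurable_fun setT (partial_sum X a b).
  by apply: (@measurable_of_info _ _ _ _ _ xi mxi _ _ (past M b)); exact: partial_sum_meas.
rewrite (_ : [set w | _] = partial_sum X a b @^-1` `]y, +oo[%classic).
  by rewrite -[X in measurable X]setTI; exact: mS.
by apply/seteqP; split => w /=; rewrite in_itv /= andbT.
Qed.

Let bad_main_prob j : (P (bad_main j) <= (expR (- l1))%:E)%E.
Proof.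
apply: (freedman mxi xi_indep (c := c1)) => //.
apply: le_trans dev1; rewrite lerD2r ler_wpM2r// ler_nat subn0.
exact: ltn_ord.
Qed.

Let bad_pair_prob p : (P (bad_pair p) <= (expR (- l))%:E)%E.
Proof.
apply: (freedman mxi xi_indep (c := c2)) => //; first exact: leq_divM.
apply: le_trans dev2; rewrite lerD2r ler_wpM2r// ler_nat.
by rewrite {1}(divn_eq p.1.1.+1 K) addKn ltnW// ltn_pmod.
Qed.

Let bad : set Om := (\big[setU/set0]_(j <- enum 'I_T) bad_main j) `|`
  (\big[setU/set0]_(p <- enum {: 'I_T * 'I_M * 'I_M}) bad_pair p).

Let bad_measurable : measurable bad.
Proof.
by apply: measurableU; apply: bigsetU_measurable => j _; apply: bad_meas.
Qed.

Let bad_prob : (P bad <= delta%:E)%E.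
Proof.
apply: (le_trans (measureU2 _ _ _)).
- by apply: bigsetU_measurable => j _; apply: bad_meas.
- by apply: bigsetU_measurable => j _; apply: bad_meas.
apply: (@le_trans _ _ ((T%:R * expR (- l1))%:E + ((T * M * M)%:R * expR (- l))%:E)%E); last first.
  by rewrite -EFinD lee_fin.
apply: leeD.
- have := prob_bigsetU_le (enum 'I_T) (fun j => @bad_meas Xmain (th1 * (D0 ^+ 2 / 2)) 0 j.+1 Xmain_meas) bad_main_prob.
  by rewrite -cardE card_ord.
- have mb p : measurable (bad_pair p) by apply: bad_meas.
  have := prob_bigsetU_le (enum {: 'I_T * 'I_M * 'I_M}) mb bad_pair_prob.
  by rewrite -cardE !card_prod !card_ord.
Qed.

Let goodP t w : good_state xs D0 B (fun t m => x t m w) (fun t m => z t m w) (fun t => zb t w) t ->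
  main_ok t w /\ forall m m', pair_ok m m' t w.
Proof.
move=> [zD xO zB]; split; first by apply/andP; split => //; apply/allP => m _; exact: xO.
by move=> m m'; apply/andP; split; [exact: zB|apply/and3P; split; rewrite // /in_ball; exact: xO].
Qed.

Let not_bad_main w t : ~ bad w -> (0 < t <= T)%N -> partial_sum Xmain 0 t w <= th1 * (D0 ^+ 2 / 2).
Proof.
move=> nb; case: t => // t /= tT; rewrite leNgt; apply/negP => lt.
apply: nb; left; rewrite -bigcup_seq; exists (Ordinal tT) => //=.
by rewrite mem_enum.
Qed.

Let not_bad_pair w t m m' : ~ bad w -> (0 < t <= T)%N ->
  partial_sum (Xpair m m') (t %/ K * K) t w <= th2 * dp.
Proof.
move=> nb; case: t => // t /= tT; rewrite leNgt; apply/negP => lt.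
apply: nb; right; rewrite -bigcup_seq; exists (Ordinal tT, m, m') => //=.
by rewrite mem_enum.
Qed.

Lemma process_convergence : exists E : set Om, measurable E /\
  E `<=` [set w | f (lsgdm_output K g x0 eta beta rho (fun m t => xi m t w) T)
                    - f xs <= eps] /\
  ((1 - delta)%:E <= P E)%E.
Proof.
exists (~` bad); split; first exact: measurableC.
split; last first.
  rewrite probability_setC//.
  have Pf : (P bad \is a fin_num)%E by exact: fin_num_measure.
  have := bad_prob; rewrite -(fineK Pf) -EFinB !lee_fin => h.
  by rewrite lerD2l lerN2.
move=> w nb /=.
apply: (@deterministic_convergence _ _ _ K T f gf xs D0 L eta beta c N B b0 eps dp
  (fun t m => x t m w) (fun t m => z t m w)
  (fun t m => clip (g (x t m w) (xi m t w)) rho)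
  (fun t m => clip_mean D g rho (x t m w) - gf (x t m w))
  (fun t m => nz t m w w)
  (fun t => lsgdm_xbar K g x0 eta beta rho (s w) t) (fun t => zb t w)) => //.
- move=> t m; rewrite /nz /noise.
  move: (clip _ _) (clip_mean _ _ _ _) (gf _) => a b e.
  by rewrite [e + _]addrC subrK addrC subrK.
- by move=> t m; exact: sgdm_z_local.
- by move=> t m; exact: sgdm_x_local.
- by move=> t; exact: sgdm_zbar_step.
- by move=> t; exact: sgdm_xbar_step.
- by move=> t m m'; exact: sgdm_sync.
- by rewrite /zb sgdm_zbar0// -norm2_sqr.
- by move=> t m; exact: norm2_clip.
- by move=> t m xO; apply: (norm2_bias rho0 alpha2 mg unbiased moment gf_le).
- by rewrite mulr_ge0 ?norm2_ge0 ?powR_ge0.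
- case=> [|t] tT good.
    by rewrite big_geq// divr_ge0// sqr_ge0.
  (* Goodness at all earlier times means that no increment was switched off, so the partial sum is
     [th1] times the true noise sum. *)
  have := not_bad_main nb (tT : (0 < t.+1 <= T)%N).
  rewrite /partial_sum (_ : \sum_(0 <= s0 < t.+1) Xmain s0 w w = th1 *
     \sum_(0 <= s0 < t.+1) main_noise xs eta (fun t m => nz t m w w) (fun t => zb t w) s0).
    by rewrite ler_pM2l.
  rewrite mulr_sumr; apply: eq_big_nat => r /andP[_ rt].
  by rewrite /Xmain (proj1 (goodP (good r rt))).
- case=> [|t] m m' tT good.
    by rewrite big_geq.
  have := not_bad_pair m m' nb (tT : (0 < t.+1 <= T)%N).
  rewrite /partial_sum (_ : \sum_(t.+1 %/ K * K <= s0 < t.+1) Xpair m m' s0 w w = th2 *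
     \sum_(t.+1 %/ K * K <= s0 < t.+1)
       pair_noise eta (fun t m => z t m w) (fun t m => nz t m w w) m m' s0).
    by rewrite ler_pM2l.
  rewrite mulr_sumr; apply: eq_big_nat => r /andP[_ rt].
  by rewrite /Xpair (proj2 (goodP (good r rt))).
Qed.

End Process.

(** * Choice of the parameters *)

Section Tuning.
Context {R : realType}.
Variables (eta N l l1 c L eps D0 sq b0 K M T : R).
Hypotheses (eta0 : 0 < eta) (N0 : 0 < N) (l11 : 1 <= l1) (l1l : l1 <= l).
Hypotheses (c0 : 0 < c) (c1 : c <= 1) (L0 : 0 < L) (eps0 : 0 < eps) (D00 : 0 < D0).
Hypotheses (sq0 : 0 <= sq) (b00 : 0 <= b0) (K1 : 1 <= K) (M0 : 0 < M) (T0 : 0 < T).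
Hypothesis etaT : eta * T * eps = 2 * D0 ^+ 2.
(** The largest step times the logarithm. Freedman over a round deviates by order [B Q], so [B^2]
    dominates it once [B] is a large multiple of [Q]; the division by [c] lets [B] absorb the
    momentum lag. *)
Let Q := eta * N * l.
Let B := 64 * Q / c.
Hypothesis QD : 1024 * Q <= c * D0.
Hypothesis QL : L * (1024 * Q) ^+ 2 <= c ^+ 2 * eps.
Hypothesis Ksq : 64 * (K * sq) <= N ^+ 2 * l.
Hypothesis Kb : K * b0 <= N * l.
Hypothesis Tsq : 4960 * (l1 * D0 ^+ 2 * sq) <= eps ^+ 2 * T * M.
(** Makes [th1 * D0^2 / 2 = 2 l1]: one [l1] for the probability, one for the sum of the exponents
    [c1]. *)
Let th1 := 4 * l1 / D0 ^+ 2.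
Let th2 := (32 * eta * B * N)^-1.
(** The Freedman cost [l / th2] is [32 B Q]; the remainder covers the sum of the exponents [c2]. *)
Let dp := 32 * Q ^+ 2 + 36 * (B * Q).

Let l1' : 1 <= l. Proof. exact: le_trans l11 l1l. Qed.
Let l0 : 0 < l. Proof. exact: lt_le_trans l1'. Qed.
Let Q0 : 0 < Q. Proof. by rewrite !mulr_gt0. Qed.
Let B0 : 0 < B. Proof. by rewrite divr_gt0// mulr_gt0. Qed.
Let cB : c * B = 64 * Q. Proof. by rewrite /B mulrC mulfVK// gt_eqF. Qed.
Let BQ : 64 * Q <= B.
Proof. by rewrite -cB -[leRHS]mul1r ler_wpM2r// ltW. Qed.
Let eNQ : eta * N <= Q.
Proof. by rewrite /Q -[leLHS]mulr1 ler_wpM2l// ltW// mulr_gt0. Qed.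
Let eN0 : 0 < eta * N. Proof. exact: mulr_gt0. Qed.

Lemma tuning_B_gt0 : 0 < B. Proof. exact: B0. Qed.

Lemma tuning_NB : eta * N <= c * B.
Proof. by rewrite cB; have h := eNQ; have q := Q0; lra. Qed.

Lemma tuning_BD : 16 * B <= D0.
Proof.
rewrite -(ler_pM2l c0) mulrCA cB; have h := QD; lra.
Qed.

Lemma tuning_LB : 128 * (L * B ^+ 2) <= eps.
Proof.
have c20 : 0 < c ^+ 2 by rewrite exprn_gt0.
rewrite -(ler_pM2l c20).
have -> : c ^+ 2 * (128 * (L * B ^+ 2)) = 128 * (L * (c * B) ^+ 2) by ring.
rewrite cB; apply: le_trans QL.
have -> : 1024 * Q = 16 * (64 * Q) by ring.
have h : 0 <= L * (64 * Q) ^+ 2 by rewrite mulr_ge0 ?sqr_ge0// ltW.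
move: (64 * Q) h => X h; rewrite exprMn [leRHS]mulrCA.
by rewrite ler_wpM2r// expr2; lra.
Qed.

Lemma tuning_dp0 : 0 <= dp.
Proof.
by apply: addr_ge0; apply: mulr_ge0 => //; [exact: sqr_ge0|apply: mulr_ge0; exact: ltW].
Qed.

Lemma tuning_dpB :
  dp + K * (4 * eta * B * b0 + 32 * eta ^+ 2 * b0 ^+ 2) <= B ^+ 2.
Proof.
have h1 : eta * (K * b0) <= Q by rewrite /Q -mulrA ler_pM2l.
have h2 : eta * b0 <= Q.
  apply: le_trans h1; rewrite ler_pM2l// -[leLHS]mul1r ler_wpM2r//.
have e0 : 0 <= eta * b0 by rewrite mulr_ge0// ltW.
have k1 := ler_wpM2l (ltW B0) h1.
have k2 : (eta * (K * b0)) * (eta * b0) <= Q * Q.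
  by apply: ler_pM => //; rewrite !mulr_ge0 ?(ltW eta0)// (le_trans _ K1).
have k3 : Q * B <= B / 64 * B by rewrite ler_pM2r//; have := BQ; lra.
have k4 : Q * Q <= B / 64 * Q by rewrite ler_pM2r//; have := BQ; lra.
have k5 : 0 <= B * B by apply: mulr_ge0; exact: ltW.
rewrite /dp !expr2; lra.
Qed.

Lemma tuning_th1_gt0 : 0 < th1.
Proof. by rewrite divr_gt0 ?exprn_gt0 ?mulr_gt0// (lt_le_trans _ l11). Qed.

Lemma tuning_th2_gt0 : 0 < th2.
Proof.
rewrite invr_gt0; apply: mulr_gt0 => //; apply: mulr_gt0; last exact: B0.
exact: mulr_gt0.
Qed.

Let l10 : 0 < l1. Proof. by rewrite (lt_le_trans _ l11). Qed.
Let eNl1 : eta * N * l1 <= Q. Proof. by rewrite /Q ler_pM2l. Qed.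
Let QD' : 1024 * Q <= D0.
Proof. by apply: (le_trans QD); rewrite -[leRHS]mul1r ler_wpM2r// ltW. Qed.
Let D20 : 0 < D0 ^+ 2. Proof. by rewrite exprn_gt0. Qed.

Lemma tuning_th1_le :
  th1 * (2 * eta * (3 / 2 * D0) * (2 * N) + 3 * eta ^+ 2 * (2 * N) ^+ 2) <= 2^-1.
Proof.
rewrite /th1 mulrAC ler_pdivrMr//.
have -> : 4 * l1 * (2 * eta * (3 / 2 * D0) * (2 * N) + 3 * eta ^+ 2 * (2 * N) ^+ 2) =
  24 * (eta * N * l1) * D0 + 48 * (eta * N * l1) * (eta * N) by field.
have h1 : eta * N * l1 <= D0 / 64 by have := D00; have := QD'; have := eNl1; lra.
have h2 : eta * N <= D0 / 64 by have := D00; have := QD'; have := eNQ; lra.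
have h3 : 0 <= eta * N * l1 by rewrite mulr_ge0// ltW.
have k1 : eta * N * l1 * D0 <= D0 / 64 * D0 by rewrite ler_pM2r.
have k2 : (eta * N * l1) * (eta * N) <= (D0 / 64) * (D0 / 64).
  by apply: ler_pM => //; exact: ltW.
have := D20; rewrite expr2; lra.
Qed.

(** The bracket is at most [155 l1], and 4960 is 155 * 4 * 2 * 4: from the bracket, from [th1], from
    the variance [2 sq / M], and from [(eta T eps)^2 = 4 D0^4]. *)
Lemma tuning_dev1 :
  T * (th1 * 3 * eta ^+ 2 * (2 * sq / M)
  + 2 * (th1 ^+ 2 * (8 * eta ^+ 2 * (3 / 2 * D0) ^+ 2 + 2 * 3 ^+ 2 * eta ^+ 4 * (2 * N) ^+ 2)
         * (2 * sq / M))) + l1 <= th1 * (D0 ^+ 2 / 2).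
Proof.
have s0 : 0 <= sq / M by rewrite divr_ge0// ltW.
have D2n : D0 != 0 by rewrite gt_eqF.
have thD : th1 * D0 ^+ 2 = 4 * l1 by rewrite /th1 mulfVK// gt_eqF.
have th0 := ltW tuning_th1_gt0.
have -> : th1 * (D0 ^+ 2 / 2) = 2 * l1 by rewrite mulrA thD; field.
have h2 : eta * N <= D0 / 12 by have := D00; have := QD'; have := eNQ; lra.
have h3 : (eta * N) ^+ 2 <= (D0 / 12) ^+ 2.
  by rewrite ler_pXn2r// nnegrE ltW// divr_gt0.
have -> : T * (th1 * 3 * eta ^+ 2 * (2 * sq / M)
  + 2 * (th1 ^+ 2 * (8 * eta ^+ 2 * (3 / 2 * D0) ^+ 2 + 2 * 3 ^+ 2 * eta ^+ 4 * (2 * N) ^+ 2)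
         * (2 * sq / M))) =
  (T * eta ^+ 2 * (2 * (sq / M)) * th1) * (3 + 36 * (th1 * D0 ^+ 2) + 144 * (th1 * (eta * N) ^+ 2)).
  by field; rewrite gt_eqF.
have k1 : th1 * (eta * N) ^+ 2 <= th1 * (D0 / 12) ^+ 2 by rewrite ler_wpM2l.
have k2 : 3 + 36 * (th1 * D0 ^+ 2) + 144 * (th1 * (eta * N) ^+ 2) <= 155 * l1.
  have E : th1 * (D0 / 12) ^+ 2 = th1 * D0 ^+ 2 / 12 ^+ 2 by field.
  by rewrite E in k1; rewrite !expr2 in k1 thD *; have := l11; lra.
have w0 : 0 <= T * eta ^+ 2 * (2 * (sq / M)) * th1.
  apply: mulr_ge0 => //; apply: mulr_ge0; last by rewrite mulr_ge0.
  by apply: mulr_ge0; [exact: ltW|exact: sqr_ge0].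
suff h : T * eta ^+ 2 * (2 * (sq / M)) * th1 * (155 * l1) <= l1.
  have := ler_wpM2l w0 k2; lra.
rewrite -[leRHS]mul1r mulrA ler_pM2r//.
rewrite -(ler_pM2r D20).
have -> : T * eta ^+ 2 * (2 * (sq / M)) * th1 * 155 * D0 ^+ 2
  = 155 * (th1 * D0 ^+ 2) * (T * eta ^+ 2 * (2 * (sq / M))) by ring.
rewrite thD mul1r.
have e2 : 0 < eps ^+ 2 * T * M by rewrite !mulr_gt0// exprn_gt0.
rewrite -(ler_pM2r e2).
have -> : 155 * (4 * l1) * (T * eta ^+ 2 * (2 * (sq / M))) * (eps ^+ 2 * T * M) =
  1240 * l1 * sq * (eta * T * eps) ^+ 2 by field; rewrite gt_eqF.
rewrite etaT.
have -> : 1240 * l1 * sq * (2 * D0 ^+ 2) ^+ 2 = D0 ^+ 2 * (4960 * (l1 * D0 ^+ 2 * sq)) by ring.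
by rewrite ler_pM2l.
Qed.

Let th2E : th2 * (eta * B * N) = 32^-1.
Proof. by rewrite /th2; field; rewrite !gt_eqF. Qed.

Lemma tuning_th2_le :
  th2 * (2 * eta * B * (4 * N) + 8 * eta ^+ 2 * (4 * N) ^+ 2) <= 2^-1.
Proof.
have -> : 2 * eta * B * (4 * N) + 8 * eta ^+ 2 * (4 * N) ^+ 2 =
  8 * (eta * B * N) + 128 * (eta * N * (eta * N)) by ring.
have h : eta * N * (eta * N) <= eta * N * (B / 64).
  by rewrite ler_pM2l//; have := eNQ; have := BQ; lra.
have k := ler_wpM2l (ltW tuning_th2_gt0) h.
have := th2E; lra.
Qed.

(** By [Ksq] the variance of a round is at most of the order of the squared range times the
    logarithm, which turns every term into a multiple of [Q^2] or [B Q]. *)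
Lemma tuning_dev2 :
  K * (th2 * 8 * eta ^+ 2 * (8 * sq)
  + 2 * (th2 ^+ 2 * (8 * eta ^+ 2 * B ^+ 2 + 2 * 8 ^+ 2 * eta ^+ 4 * (4 * N) ^+ 2) * (8 * sq)))
  + l <= th2 * dp.
Proof.
have t0 := tuning_th2_gt0.
have -> : K * (th2 * 8 * eta ^+ 2 * (8 * sq)
  + 2 * (th2 ^+ 2 * (8 * eta ^+ 2 * B ^+ 2 + 2 * 8 ^+ 2 * eta ^+ 4 * (4 * N) ^+ 2) * (8 * sq)))
  = (64 * (K * sq)) * (th2 * eta ^+ 2 * (1 + 2 * (th2 * B ^+ 2) + 512 * (th2 * (eta * N) ^+ 2))).
  by ring.
have lE : l = th2 * (32 * (eta * B * N) * l).
  have -> : th2 * (32 * (eta * B * N) * l) = 32 * (th2 * (eta * B * N)) * l by ring.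
  by rewrite th2E mulfV ?mul1r.
have w0 : 0 <= th2 * eta ^+ 2 * (1 + 2 * (th2 * B ^+ 2) + 512 * (th2 * (eta * N) ^+ 2)).
  have p1 : 0 <= th2 * B ^+ 2 by rewrite mulr_ge0 ?sqr_ge0// ltW.
  have p2 : 0 <= th2 * (eta * N) ^+ 2 by rewrite mulr_ge0 ?sqr_ge0// ltW.
  have p3 : 0 <= th2 * eta ^+ 2 by rewrite mulr_ge0 ?sqr_ge0// ltW.
  by apply: mulr_ge0; [exact: p3|lra].
apply: (@le_trans _ _ (N ^+ 2 * l * (th2 * eta ^+ 2 *
    (1 + 2 * (th2 * B ^+ 2) + 512 * (th2 * (eta * N) ^+ 2))) + l)).
  by rewrite lerD2r ler_wpM2r.
rewrite {2}lE.
have -> : N ^+ 2 * l * (th2 * eta ^+ 2 * (1 + 2 * (th2 * B ^+ 2) + 512 * (th2 * (eta * N) ^+ 2)))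
  + th2 * (32 * (eta * B * N) * l) =
  th2 * ((eta * N) * Q + 2 * (th2 * (eta * B * N)) * (B * Q)
     + 512 * (th2 * (eta * N * (eta * N))) * (eta * N * Q) + 32 * (B * Q)).
  by rewrite /Q; ring.
rewrite ler_pM2l// th2E.
have h : eta * N * (eta * N) <= eta * N * (B / 64).
  by rewrite ler_pM2l//; have := eNQ; have := BQ; lra.
have k1 := ler_wpM2l (ltW t0) h.
have k2 : th2 * (eta * N * (eta * N)) <= 1 / 2048 by have := th2E; lra.
have k3 : eta * N * Q <= Q * Q by rewrite ler_pM2r.
have k4 : 0 <= eta * N * Q by apply: mulr_ge0; exact: ltW.
have k5 : 512 * (th2 * (eta * N * (eta * N))) * (eta * N * Q) <= 512 * (1 / 2048) * (eta * N * Q).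
  by rewrite ler_wpM2r//; lra.
have k6 : 0 <= B * Q by apply: mulr_ge0; exact: ltW.
have k7 : 0 <= Q * Q by apply: mulr_ge0; exact: ltW.
rewrite /dp expr2; lra.
Qed.

End Tuning.

(** * A nearly optimal starting point *)

Section SmallStep.
Context {R : realType} {d M : nat} {Xi : Type}.
Variables (K : nat) (g : 'rV[R]_d -> Xi -> 'rV[R]_d) (x0 : 'rV[R]_d) (beta : R).
Hypotheses (M0 : (0 < M)%N) (K0 : (0 < K)%N) (beta1 : beta < 1).

Lemma sgdm_zbar_drift (eta rho : R) (s : 'I_M -> nat -> Xi) t : 0 < rho -> 0 <= eta ->
  norm2 (lsgdm_zbar K g x0 eta beta rho s t - x0) <= t%:R * (eta * (Num.sqrt d%:R * rho)).
Proof.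
move=> rho0 eta0; elim: t => [|t IH].
  by rewrite sgdm_zbar0// subrr norm20 mul0r.
rewrite sgdm_zbar_step// addrAC (le_trans (norm2B _ _))// -natr1 mulrDl mul1r lerD//.
rewrite norm2Z ger0_norm// ler_wpM2l//.
by apply: norm2_avg => // m; exact: norm2_clip.
Qed.

(** Clipping bounds every step whatever the samples, so a small [eta] keeps the output in a
    neighbourhood of [x0] where continuity of [f] suffices, for every sample sequence. *)
Lemma small_step (f : 'rV[R]_d -> R) (y : R) (T : nat) :
  (0 < T)%N -> {for x0, continuous f} -> f x0 < y ->
  exists eta : R, 0 < eta /\
    forall s : 'I_M -> nat -> Xi, f (lsgdm_output K g x0 eta beta 1 s T) <= y.
Proof.
move=> T0 cf fy.
have /nbhs_ballP[e /= e0 He] : \forall t \near x0, `|f x0 - f t| < y - f x0.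
  by move: cf => /cvgrPdist_lt /(_ (y - f x0)); rewrite subr_gt0; exact.
pose N : R := Num.sqrt d%:R * 1.
have N0 : 0 <= N by rewrite mulr_ge0 ?sqrtr_ge0.
(* [N + 1] guards against [d = 0], where [N] vanishes. *)
pose eta := e / (2 * T%:R * (N + 1)).
have TN : 0 < 2 * T%:R * (N + 1).
  by rewrite mulr_gt0 ?mulr_gt0 ?ltr0n// ltr_wpDl.
have eta0 : 0 < eta by rewrite divr_gt0.
exists eta; split => // s.
have dist : norm2 (lsgdm_output K g x0 eta beta 1 s T - x0) < e.
  have -> : lsgdm_output K g x0 eta beta 1 s T - x0 =
      avg (fun j : 'I_T => lsgdm_zbar K g x0 eta beta 1 s j - x0).
    by rewrite avgB avg_cst.
  apply: (@le_lt_trans _ _ (T%:R * (eta * N))).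
    apply: norm2_avg => // j.
    apply: le_trans (sgdm_zbar_drift _ _ _ _) _ => //; first exact: ltW.
    rewrite ler_wpM2r ?ler_nat; [by []|by rewrite mulr_ge0// ltW|].
    exact: ltnW.
  have -> : T%:R * (eta * N) = e * (N / (2 * (N + 1))).
    rewrite /eta; field; rewrite !gt_eqF ?ltr0n//.
    by rewrite ltr_wpDl.
  rewrite -[ltRHS]mulr1 ltr_pM2l// ltr_pdivrMr ?mulr_gt0 ?ltr_wpDl//.
  by rewrite mul1r; lra.
have : ball x0 e (lsgdm_output K g x0 eta beta 1 s T).
  split => // i j; rewrite (ord1 i) /ball /=.
  apply: le_lt_trans dist.
  rewrite -(@ler_pXn2r _ 2) ?nnegrE ?norm2_ge0// norm2_sqr real_normK ?num_real//.
  rewrite /inner (bigD1 j)//= !mxE -expr2 -sqrrN opprB lerDl sumr_ge0// => k _.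
  by rewrite -expr2 sqr_ge0.
move=> /He /=; rewrite ltr_norml => /andP[h _]; lra.
Qed.

End SmallStep.

(** * Powers and logarithms behind the clipping and confidence levels *)

Section PowerEstimates.
Context {R : realType}.

Lemma lpnorm_powR (d : nat) (alpha : R) (sigma : 'rV[R]_d) : 0 < alpha ->
  (forall i, 0 <= sigma 0 i) ->
  norm2 (\row_i (sigma 0 i `^ alpha) : 'rV[R]_d) = lpnorm (2 * alpha) sigma `^ alpha.
Proof.
move=> a0 s0; rewrite /lpnorm -powRrM.
have -> : (2 * alpha)^-1 * alpha = 2^-1 by field; rewrite gt_eqF.
rewrite powR12_sqrt; last by apply: sumr_ge0 => i _; exact: powR_ge0.
congr Num.sqrt; apply: eq_bigr => i _.
by rewrite mxE ger0_norm// mulrC powRrM powR_mulrn ?powR_ge0.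
Qed.

Lemma lpnorm0 (d : nat) (p : R) : 0 < p -> lpnorm p (0 : 'rV[R]_d) = 0.
Proof.
move=> p0; rewrite /lpnorm big1 ?powR0 ?invr_eq0 ?gt_eqF// => i _.
by rewrite mxE normr0 powR0// gt_eqF.
Qed.

(** Origin of the 8 in the clipping level: the base is then at most 1/4, and [alpha >= 4] yields
    [4^(-3) = 1/64 < 1/48]. *)
Lemma bias_budget (a alpha rho : R) : 4 <= alpha -> 0 < a -> 0 < rho ->
  8 * a `^ (alpha - 1)^-1 <= rho -> 48 * (a * (2 / rho) `^ (alpha - 1)) <= 1.
Proof.
move=> a4 a0 r0 hr.
have p0 : 0 < alpha - 1 by lra.
have A0 : 0 < a `^ (alpha - 1)^-1 by exact: powR_gt0.
have aE : a = (a `^ (alpha - 1)^-1) `^ (alpha - 1).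
  by rewrite -powRrM mulVf ?gt_eqF// powRr1// ltW.
move: (a `^ (alpha - 1)^-1) A0 hr aE => A A0 hr ->.
rewrite -powRM ?(ltW A0) ?divr_ge0 ?(ltW r0)//.
have h1 : A * (2 / rho) <= 4^-1 by rewrite mulrA ler_pdivrMr//; lra.
have h2 : (A * (2 / rho)) `^ (alpha - 1) <= 4^-1 `^ (alpha - 1).
  have q4 : 0 <= 4^-1 :> R by rewrite invr_ge0.
  have q0 : 0 <= A * (2 / rho) by rewrite mulr_ge0 ?divr_ge0 ?ltW.
  by rewrite ge0_ler_powR ?nnegrE ?(ltW p0).
have h3 : (4^-1 : R) `^ (alpha - 1) <= 64^-1.
  rewrite -(@powR_inv1 R 4)// -powRrM mulN1r powRN lef_pV2 ?posrE ?powR_gt0//.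
  apply: (@le_trans _ _ (4 `^ 3)); last by rewrite ler_powR//; lra.
  by rewrite powR_mulrn// !exprS expr0; lra.
lra.
Qed.

(** Raising the hypothesis to the power [(alpha - 2) / 2] gives the conclusion. In logarithms both
    are linear in the logarithms of the data, which is why everything is written as an
    exponential. *)
Lemma round_length (S sg kap dd alpha : R) : 0 < S -> 0 < sg -> 0 < kap -> 0 < dd ->
  4 <= alpha ->
  (S * dd `^ (2^-1 - (2 * alpha)^-1) / sg) `^ (2 * alpha / (alpha - 2)) <= kap ->
  kap * S `^ alpha <= Num.sqrt dd * (sg * Num.sqrt kap / Num.sqrt dd) `^ alpha.
Proof.
have expE (x : R) : 0 < x -> exists a, x = expR a.
  by move=> x0; exists (ln x); rewrite lnK// posrE.
move=> /expE[a ->] /expE[b ->] /expE[k ->] /expE[D ->] a4.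
rewrite -!powR12_sqrt ?expR_ge0// -!expRM -!expRN -!expRD -!expRM -!expRD !ler_expR => h.
have a2 : 0 < (alpha - 2) / 2 by lra.
have := ler_wpM2r (ltW a2) h.
have -> : (a + D * (2^-1 - (2 * alpha)^-1) - b) * (2 * alpha / (alpha - 2)) * ((alpha - 2) / 2)
  = alpha * a + D * (alpha - 1) / 2 - alpha * b.
  by field; apply/andP; split; rewrite gt_eqF//; lra.
lra.
Qed.

Lemma expR1_le4 : expR 1 <= 4 :> R.
Proof.
have h : expR 2^-1 <= 2 :> R.
  by apply: (le_trans (expR_le_quad (lexx _))); rewrite expr2; lra.
have E : expR 1 = expR 2^-1 * expR 2^-1 :> R by rewrite -expRD; congr expR; field.
have h2 : expR 2^-1 * expR 2^-1 <= 2 * 2 :> R by rewrite ler_pM ?expR_ge0.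
by rewrite E; lra.
Qed.

(** Each union bound costs [delta / 4]. The factor 3 absorbs the constant 4 inside the logarithms,
    as [t >= 2] gives [4 <= (t / delta)^2]. *)
Lemma confidence_levels (t m delta : R) : 2 <= t -> 1 <= m -> 0 < delta -> delta < 1 ->
  let l1 := ln (4 * t / delta) in let l := ln (4 * m ^+ 2 * t / delta) in
  [/\ 1 <= l1, l1 <= l, l1 <= 3 * ln (t / delta), l <= 3 * ln (m * t / delta)
    & ln (m * t / delta) <= l] /\ t * expR (- l1) + t * m * m * expR (- l) <= delta.
Proof.
move=> t2 m1 d0 d1 l1 l.
have t0 : 0 < t by lra.
have m0 : 0 < m by lra.
have m2 : 1 <= m ^+ 2 by rewrite -(expr1n _ 2) ler_pXn2r// nnegrE// ltW.
have p1 : 0 < 4 * t / delta by rewrite divr_gt0// mulr_gt0.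
have p2 : 0 < 4 * m ^+ 2 * t / delta by rewrite divr_gt0// !mulr_gt0// exprn_gt0.
have q1 : 0 < t / delta by rewrite divr_gt0.
have q2 : 0 < m * t / delta by rewrite divr_gt0// mulr_gt0.
have di : 1 < delta^-1 by rewrite invf_gt1.
have td2 : 2 <= t / delta.
  apply: (le_trans t2); rewrite -[leLHS]mulr1 ler_pM2l// ltW//.
have td4 : 4 <= (t / delta) ^+ 2.
  have : 2 ^+ 2 <= (t / delta) ^+ 2 by rewrite ler_pXn2r// nnegrE ltW.
  by rewrite [2 ^+ 2]expr2; lra.
split; [split|].
- rewrite -(expRK (1 : R)) ler_ln ?posrE ?expR_gt0//.
  apply: (le_trans expR1_le4).
  by rewrite -mulrA -[leLHS]mulr1 ler_pM2l//; lra.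
- rewrite ler_ln ?posrE// ler_pM2r ?invr_gt0// ler_pM2r//.
  by rewrite -[leLHS]mulr1 ler_pM2l.
- rewrite mulr_natl -lnXn// ler_ln ?posrE ?exprn_gt0//.
  by rewrite -mulrA exprSr ler_pM2r.
- rewrite mulr_natl -lnXn// ler_ln ?posrE ?exprn_gt0//.
  have -> : 4 * m ^+ 2 * t / delta = m ^+ 2 * (4 * (t / delta)) by ring.
  have -> : (m * t / delta) ^+ 3 = m ^+ 2 * (m * ((t / delta) ^+ 2 * (t / delta))) by ring.
  have k1 : 4 * (t / delta) <= (t / delta) ^+ 2 * (t / delta) by rewrite ler_pM2r.
  have k2 : 0 <= (t / delta) ^+ 2 * (t / delta) by rewrite mulr_ge0 ?sqr_ge0// ltW.
  have k3 := ler_wpM2r k2 m1.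
  by rewrite ler_pM2l ?exprn_gt0//; lra.
- rewrite ler_ln ?posrE// ler_pM2r ?invr_gt0// ler_pM2r//.
  have : m * 1 <= m * m by rewrite ler_pM2l.
  have : 0 <= m * m by apply: mulr_ge0; exact: ltW.
  by rewrite expr2; lra.
rewrite !expRN !lnK ?posrE//.
have -> : t * (4 * t / delta)^-1 = delta / 4 by field; rewrite !gt_eqF.
have -> : t * m * m * (4 * m ^+ 2 * t / delta)^-1 = delta / 4 by field; rewrite !gt_eqF.
lra.
Qed.

End PowerEstimates.

(** * From the horizon condition to the step size *)

Section Horizon.
Context {R : realType}.

(** 48 is 2 * 8 * 3, from the step size, the clipping level and [l <= 3 LMT]; 32 doubles the 16 of
    [16 eta L]; 1024 * 16 exceeds 3 * 4960; the last bound gives [C > 1] and [T >= 2]. *)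
Definition horizon_constant (c C : R) : Prop :=
  [/\ 1024 * 48 <= C * c, 32 <= C * c ^+ 2, 1024 * 16 <= C & 1024 <= C].

Lemma horizon_constant_exists (c : R) : 0 < c -> exists C, horizon_constant c C.
Proof.
suff H a b e : 0 < c -> 0 <= a -> 0 <= b -> 0 <= e ->
    exists C, [/\ a <= C * c, b <= C * c ^+ 2 & e <= C].
  move=> c0; have [C [h1 h2 h3]] := H _ _ _ c0 (mulr_ge0 (ler0n R 1024) (ler0n R 48))
    (ler0n R 32) (mulr_ge0 (ler0n R 1024) (ler0n R 16)).
  exists C; split; [exact: h1|exact: h2|exact: h3|apply: le_trans h3].
  by apply: ler_peMr; rewrite ?ler0n// ler1n.
move=> c0 a0 b0 e0; have c2 : 0 < c ^+ 2 by rewrite exprn_gt0.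
have a1 : 0 <= a / c by rewrite divr_ge0// ltW.
have b1 : 0 <= b / c ^+ 2 by rewrite divr_ge0// ltW.
by exists (a / c + b / c ^+ 2 + e); split; rewrite -?ler_pdivrMr//; lra.
Qed.

Lemma clip_level_ge (a b : R) : 0 < a -> 0 < b ->
  [/\ a <= 8 * (a + b) / 2, 2 * b <= 8 * (a + b) & b <= 8 * (a + b)].
Proof. by move=> a0 b0; split; lra. Qed.

Lemma horizon_slack (a b v : R) : 0 <= b -> a <= 3 * b -> 1024 * 16 * b <= v ->
  4960 * a <= v.
Proof. lra. Qed.

Lemma round_bias (S kap alpha dd rho1 rho : R) : 4 <= alpha -> 0 <= kap ->
  0 < rho1 -> 2 * rho1 <= rho ->
  kap * S `^ alpha <= Num.sqrt dd * rho1 `^ alpha ->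
  kap * (S `^ alpha * (2 / rho) `^ (alpha - 1)) <= Num.sqrt dd * rho1.
Proof.
move=> a4 k0 r0 rr h.
have rn : rho1 != 0 by rewrite gt_eqF.
have rho0 : 0 < rho by lra.
have h1 : (2 / rho) `^ (alpha - 1) <= rho1^-1 `^ (alpha - 1).
  have q1 : 0 <= 2 / rho by rewrite divr_ge0// ltW.
  have q2 : 0 <= rho1^-1 by rewrite invr_ge0 ltW.
  rewrite ge0_ler_powR ?nnegrE//; first lra.
  by rewrite ler_pdivrMr// mulrC ler_pdivlMr.
rewrite mulrA.
have k1 : kap * S `^ alpha * (2 / rho) `^ (alpha - 1) <=
    (Num.sqrt dd * rho1 `^ alpha) * rho1^-1 `^ (alpha - 1).
  by apply: ler_pM; rewrite ?mulr_ge0 ?powR_ge0.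
apply: (le_trans k1).
have -> : rho1 `^ alpha = rho1 * rho1 `^ (alpha - 1).
  have := @powRD _ rho1 1 (alpha - 1); rewrite rn implybT => /(_ isT).
  by rewrite (addrC 1) subrK powRr1// ltW.
rewrite -!mulrA -powRM ?(ltW r0) ?invr_ge0 ?(ltW r0)// mulfV// powR1 mulr1.
by [].
Qed.

(** The two square roots of the horizon match the two parts of the clipping level: with
    [W = sqrt dd * A + sg * sqrt (K / ell)] their sum is [sqrt L * W * ell / sqrt eps], while a
    clipped vector has norm at most [8 W]. *)
Lemma step_size_bound (L eps X A sg K ell dd T c C l : R) :
  0 < L -> 0 < eps -> 0 < X -> 0 <= A -> 0 <= sg -> 0 < K -> 0 < ell -> 0 < dd ->
  0 < T -> 0 < c -> l <= 3 * ell -> 1024 * 48 <= C * c ->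
  C * X * (Num.sqrt (L * sg ^+ 2 * K * ell / eps) + Num.sqrt (dd * L / eps) * A * ell) <= T ->
  Num.sqrt L * (1024 * (2 * X / T *
    (Num.sqrt dd * (8 * (A + sg * Num.sqrt (K / ell) / Num.sqrt dd))) * l))
  <= c * Num.sqrt eps.
Proof.
move=> L0 e0 X0 A0 sg0 K0 l0 d0 T0 c0 ll Cc.
have se : Num.sqrt eps != 0 by rewrite gt_eqF// sqrtr_gt0.
have sd : Num.sqrt dd != 0 by rewrite gt_eqF// sqrtr_gt0.
have E3 : Num.sqrt (L * sg ^+ 2 * K * ell / eps) =
    Num.sqrt L * sg * (Num.sqrt (K / ell) * ell) / Num.sqrt eps.
  have -> : L * sg ^+ 2 * K * ell / eps = L * (sg * ell) ^+ 2 * (K / ell) * eps^-1.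
    by field; rewrite !gt_eqF.
  have q0 : 0 <= sg * ell by rewrite mulr_ge0// ltW.
  have k0 : 0 <= K / ell by rewrite divr_ge0 ?ltW.
  have L0' := ltW L0.
  have h1 : 0 <= L * (sg * ell) ^+ 2 by rewrite mulr_ge0// sqr_ge0.
  rewrite sqrtrM; last by rewrite mulr_ge0.
  rewrite [X in X * _]sqrtrM// [X in X * _ * _]sqrtrM//.
  by rewrite sqrtr_sqr ger0_norm// sqrtrV ?(ltW e0)//; ring.
have E4 : Num.sqrt (dd * L / eps) = Num.sqrt dd * Num.sqrt L / Num.sqrt eps.
  by rewrite !sqrtrM ?mulr_ge0 ?(ltW d0) ?(ltW L0)// sqrtrV// ltW.
rewrite {}E3 {}E4.
have sL : 0 < Num.sqrt L by rewrite sqrtr_gt0.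
have sd0 : 0 < Num.sqrt dd by rewrite sqrtr_gt0.
have se0 : 0 < Num.sqrt eps by rewrite sqrtr_gt0.
have sk0 : 0 <= Num.sqrt (K / ell) by exact: sqrtr_ge0.
move: (Num.sqrt (K / ell)) (Num.sqrt dd) (Num.sqrt eps) (Num.sqrt L) se sd sL sd0 se0 sk0
  => sk sdd see sL' se sd sL sd0 se0 sk0 hT.
set W := sdd * A + sg * sk.
have W0 : 0 <= W by rewrite addr_ge0// mulr_ge0// ltW.
have NE : sdd * (8 * (A + sg * sk / sdd)) = 8 * W by rewrite /W; field.
rewrite NE.
have TE : C * X * (sL' * sg * (sk * ell) / see + sdd * sL' / see * A * ell) =
   C * (X * (sL' * W * ell)) / see by rewrite /W; field.
rewrite TE ler_pdivrMr// in hT.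
have XW0 : 0 <= X * (sL' * W * ell) by rewrite !mulr_ge0// ltW.
apply: (@le_trans _ _ (1024 * 48 * (X * (sL' * W * ell)) / T)).
  have -> : sL' * (1024 * (2 * X / T * (8 * W) * l)) = 1024 * 16 * (X * (sL' * W) / T) * l.
    by field; rewrite gt_eqF.
  have -> : 1024 * 48 * (X * (sL' * W * ell)) / T = 1024 * 16 * (X * (sL' * W) / T) * (3 * ell).
    by field; rewrite gt_eqF.
  have n0 : 0 <= 1024 * 16 :> R := mulr_ge0 (ler0n _ _) (ler0n _ _).
  move: (1024 * 16 : R) n0 => k n0.
  apply: ler_wpM2l => //; apply: (mulr_ge0 n0); apply: divr_ge0; last exact: ltW.
  by apply: mulr_ge0; [exact: ltW|apply: mulr_ge0 => //; exact: ltW].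
rewrite ler_pdivrMr//.
apply: (@le_trans _ _ (C * c * (X * (sL' * W * ell)))); first exact: ler_wpM2r.
have := ler_wpM2l (ltW c0) hT; lra.
Qed.

End Horizon.

Theorem theorem6 (R : realType) (c0 : R) (Hc0 : 0 < c0) :
  exists C : R, 0 < C /\
  forall (d M K Rr : nat)
    (dX : measure_display) (Xi : measurableType dX) (D : probability Xi R)
    (dO : measure_display) (Om : measurableType dO) (P : probability Om R)
    (xi : 'I_M -> nat -> Om -> Xi)
    (f : 'rV[R]_d -> R) (g : 'rV[R]_d -> Xi -> 'rV[R]_d)
    (x0 xstar sigma : 'rV[R]_d) (L alpha Ginf beta1 delta eps : R),
  let T := (K * Rr)%N in
  let D0 := norm2 (x0 - xstar) in
  let Omega := [set x : 'rV[R]_d | norm2 (x - xstar) <= Num.sqrt 3 * D0] in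
  let s2a := lpnorm (2 * alpha) sigma in
  let sig := norm2 sigma in
  let siginf := linfnorm sigma in
  let LMT := ln ((M * T)%:R / delta) in
  let A := (D0 * s2a `^ alpha / eps) `^ (alpha - 1)^-1 in
  (0 < M)%N -> (0 < K)%N -> (0 < Rr)%N ->
  0 < delta < 1 -> 0 < eps ->
  (* x_* is a minimizer of f; f is C^2 *)
  (forall x, f xstar <= f x) ->
  C2 f ->
  (* smoothness on Omega *)
  (forall x y, Omega x -> Omega y ->
     norm2 (grad f x - grad f y) <= L * norm2 (x - y)) ->
  (forall x, Omega x -> norm2 (grad f x) ^+ 2 <= 2 * L * (f x - f xstar)) ->
  (* stochastic oracle: unbiased, with bounded coordinatewise alpha-moments *)
  oracle_measurable g ->
  (forall x (i : 'I_d), D.-integrable setT (fun v => (g x v 0 i)%:E) /\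
     (\int[D]_v (g x v 0 i)%:E = (grad f x 0 i)%:E)%E) ->
  4 <= alpha ->
  (forall i, 0 <= sigma 0 i) ->
  (forall x (i : 'I_d), Omega x ->
     (\int[D]_v (`|g x v 0 i - grad f x 0 i| `^ alpha)%:E
        <= (sigma 0 i `^ alpha)%:E)%E) ->
  (* fresh i.i.d. samples xi_t^m with law D *)
  (forall m t, measurable_fun setT (xi m t)) ->
  (forall m t B, measurable B -> P (xi m t @^-1` B) = D B) ->
  mutually_independent P (fun p : 'I_M * nat => xi p.1 p.2) ->
  (* convexity on Omega and bounded gradients *)
  (forall x y, Omega x -> Omega y ->
     0 <= inner (grad f x - grad f y) (x - y) /\
     f x + inner (grad f x) (y - x) <= f y) ->
  (forall x, Omega x -> linfnorm (grad f x) <= Ginf) ->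
  (* parameter conditions *)
  0 <= beta1 -> c0 <= 1 - beta1 ->
  C * Num.max Ginf siginf <= A ->
  C * LMT * (s2a * d%:R `^ (2^-1 - (2 * alpha)^-1) / sig) `^ (2 * alpha / (alpha - 2))
    <= K%:R ->
  C * (D0 ^+ 2 / eps) *
    (L + sig ^+ 2 / (M%:R * eps) * ln (T%:R / delta)
       + Num.sqrt (L * sig ^+ 2 * K%:R * LMT / eps)
       + Num.sqrt (d%:R * L / eps) * A * LMT)
    <= T%:R ->
  exists eta rho : R, 0 < eta /\ 0 < rho /\
    exists E : set Om, measurable E /\
      E `<=` [set w | f (lsgdm_output K g x0 eta beta1 rho (fun m t => xi m t w) T)
                        - f xstar <= eps] /\
      ((1 - delta)%:E <= P E)%E.
Proof.
have c20 : 0 < c0 ^+ 2 by rewrite exprn_gt0.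
have [C HC] := horizon_constant_exists Hc0.
have C1 : 1 < C by case: HC => _ _ _; apply: lt_le_trans; rewrite ltr1n.
have C0 : 0 < C by apply: lt_trans C1.
exists C; split => //.
move=> d M K Rr dX Xi D dO Om P xi f g x0 xstar sigma L alpha Ginf beta1 delta eps.
move=> T D0 Omega s2a sig siginf LMT A M0 K0 R0 /andP[delta0 delta1] eps0 fmin f2 lip smooth.
move=> mg unb a4 sigma0 mom mxi law ind conv Gle b0 cb hA hK hT.
have T0 : (0 < T)%N by rewrite muln_gt0 K0 R0.
have b1 : beta1 < 1 by rewrite -subr_gt0 (lt_le_trans Hc0).
have [fx0|fx0] := ltP (f x0) (f xstar + eps).
  have [eta [eta0 He]] := @small_step R d M Xi K g x0 beta1 M0 b1 f _ T T0 (f2.1 x0) fx0.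
  exists eta, 1; split => //; split => //; exists setT; split => //; split.
    by move=> w _ /=; rewrite lerBlDl; exact: He.
  by rewrite probability_setT lee_fin gerBl ltW.
have D0ge : 0 <= D0 by exact: norm2_ge0.
have s31 : 1 <= Num.sqrt 3 :> R by rewrite -{1}sqrtr1 ler_wsqrtr// ler1n.
have x0O : Omega x0 by rewrite /Omega /= -/D0 ler_peMl.
have xsO : Omega xstar by rewrite /Omega /= subrr norm20 mulr_ge0 ?sqrtr_ge0.
have gs0 : grad f xstar = 0.
  apply: norm2_eq0; apply/eqP; rewrite -[_ == 0](@expf_eq0 _ _ 2) eq_le sqr_ge0 andbT.
  by have := smooth _ xsO; rewrite subrr mulr0.
have fle : f x0 - f xstar <= inner (grad f x0) (x0 - xstar).
  have [_] := conv _ _ x0O xsO; rewrite -(opprB x0) innerNr; lra.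
have LD : eps <= L * D0 ^+ 2.
  apply: (@le_trans _ _ (f x0 - f xstar)); first by rewrite lerBrDl.
  apply: (le_trans fle); apply: (le_trans (inner_le_norm2 _ _)).
  rewrite -/D0 expr2 mulrA ler_wpM2r//.
  by have := lip _ _ x0O xsO; rewrite gs0 subr0.
have D00 : 0 < D0.
  rewrite lt_def D0ge andbT; apply/eqP => D0E.
  by move: LD; rewrite D0E expr0n /= mulr0 leNgt eps0.
have D20 : 0 < D0 ^+ 2 by rewrite exprn_gt0.
have L0 : 0 < L by rewrite -(pmulr_lgt0 _ D20) (lt_le_trans eps0).
(* If it vanished, so would [A], hence the gradient at [x0]; by convexity [x0] would then be
   optimal. *)
have s2a0 : 0 < s2a.
  rewrite lt_def powR_ge0 andbT; apply/eqP => s0.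
  have A0 : A = 0.
    rewrite /A s0 powR0 ?gt_eqF//; last lra.
    by rewrite mulr0 mul0r powR0// invr_eq0 gt_eqF//; lra.
  have G0 : Ginf <= 0.
    move: hA; rewrite A0 pmulr_rle0// => h; apply: le_trans h.
    by rewrite le_max lexx.
  have g0 : grad f x0 = 0.
    apply/rowP => i; rewrite [RHS]mxE; apply/eqP; rewrite -normr_eq0 eq_le normr_ge0 andbT.
    apply: le_trans G0; apply: le_trans (Gle _ x0O).
    exact: (le_bigmax _ (fun i => `|grad f x0 0 i|)).
  move: fle fx0; rewrite g0 inner0l; lra.
have sig0 : 0 < sig.
  rewrite lt_def norm2_ge0 andbT; apply/eqP => /norm2_eq0 s0.
  by move: s2a0; rewrite /s2a s0 lpnorm0 ?ltxx//; lra.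
have d0 : 0 < d%:R :> R.
  rewrite ltr0n lt0n; apply/eqP => dE; move: D00.
  suff -> : D0 = 0 by rewrite ltxx.
  by rewrite /D0 /norm2; move: (x0 - xstar); rewrite dE => v; rewrite big_ord0 sqrtr0.
have a0 : 0 < D0 * s2a `^ alpha / eps by rewrite divr_gt0// mulr_gt0// powR_gt0.
have A0 : 0 < A by exact: powR_gt0.
pose X := D0 ^+ 2 / eps.
have X0 : 0 < X by rewrite divr_gt0.
have Tr0 : 0 < T%:R :> R by rewrite ltr0n.
have Mr0 : 0 < M%:R :> R by rewrite ltr0n.
have Kr0 : 0 < K%:R :> R by rewrite ltr0n.
have Mr1 : 1 <= M%:R :> R by rewrite ler1n.
have Kr1 : 1 <= K%:R :> R by rewrite ler1n.
have T1 : 1 <= T%:R :> R by rewrite ler1n.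
have Td1 : 1 < T%:R / delta by rewrite ltr_pdivlMr// mul1r (lt_le_trans delta1).
have LT0 : 0 < ln (T%:R / delta) by exact: ln_gt0.
have LMTE : LMT = ln (M%:R * T%:R / delta) by rewrite /LMT natrM.
have LMT0 : 0 < LMT.
  rewrite LMTE ln_gt0// -mulrA (lt_le_trans Td1)// ler_peMl//.
  by rewrite ltW// (lt_trans _ Td1).
set a2 := sig ^+ 2 / (M%:R * eps) * ln (T%:R / delta) in hT.
set a3 := Num.sqrt (L * sig ^+ 2 * K%:R * LMT / eps) in hT.
set a5 := Num.sqrt (d%:R * L / eps) * A * LMT in hT.
have a20 : 0 <= a2.
  by apply: mulr_ge0; [rewrite divr_ge0 ?sqr_ge0// mulr_ge0// ltW|exact: ltW].
have a30 : 0 <= a3 by exact: sqrtr_ge0.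
have a50 : 0 <= a5 by rewrite mulr_ge0 ?mulr_ge0 ?sqrtr_ge0// ltW.
have CX0 : 0 < C * X by rewrite mulr_gt0.
have hT1 : C * X * L <= T%:R.
  by apply: le_trans hT; rewrite ler_pM2l// -!addrA lerDl !addr_ge0.
have hT2 : C * X * a2 <= T%:R.
  by apply: le_trans hT; rewrite ler_pM2l// -addrA (addrC L) -addrA lerDl !addr_ge0// ltW.
have hT3 : C * X * (a3 + a5) <= T%:R.
  by apply: le_trans hT; rewrite ler_pM2l// -addrA lerDr addr_ge0// ltW.
(* With this, the first term of the horizon alone forces [T >= C], hence the [T >= 2] required by
   [confidence_levels]. *)
have XL : 1 <= X * L by rewrite /X mulrAC ler_pdivlMr// mul1r mulrC.
have T2 : 2 <= T%:R :> R.
  apply: le_trans hT1; rewrite -mulrA.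
  apply: (@le_trans _ _ C); first by case: HC => _ _ _; apply: le_trans; rewrite ler_nat.
  by rewrite ler_peMr// ltW.
have [[l11 l1l l1T lMT LMTl] budget] := confidence_levels T2 Mr1 delta0 delta1.
rewrite -LMTE in lMT LMTl.
move: (ln (4 * T%:R / delta)) (ln (4 * M%:R ^+ 2 * T%:R / delta)) l11 l1l l1T lMT LMTl budget
  => l1 l l11 l1l l1T lMT LMTl budget.
have l0 : 0 < l by rewrite (lt_le_trans LMT0).
pose kap := K%:R / LMT.
have kap0 : 0 < kap by rewrite divr_gt0.
(* The level at which the range [sqrt d * rho1] times [LMT] equals [sig * sqrt (K * LMT)], the noise
   deviation of a round. *)
pose rho1 := sig * Num.sqrt kap / Num.sqrt d%:R.
have sd0 : 0 < Num.sqrt d%:R :> R by rewrite sqrtr_gt0.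
have rho10 : 0 < rho1 by rewrite divr_gt0// mulr_gt0// sqrtr_gt0.
have [rhoA rho1_2 rho1_le] := clip_level_ge A0 rho10.
pose rho := 8 * (A + rho1).
have rho0 : 0 < rho by rewrite mulr_gt0// addr_gt0.
pose eta := 2 * X / T%:R.
have eta0 : 0 < eta by rewrite divr_gt0// mulr_gt0.
have c1 : c0 <= 1 by apply: (le_trans cb); rewrite gerBl.
pose N := Num.sqrt d%:R * rho.
have N0 : 0 < N by rewrite mulr_gt0.
pose bb := norm2 (\row_i (sigma 0 i `^ alpha) : 'rV[R]_d) * (2 / rho) `^ (alpha - 1).
have alpha0 : 0 < alpha by apply: lt_le_trans a4; rewrite ltr0n.
have al2 : 2 <= alpha by apply: le_trans a4; rewrite ler_nat.
have bbE : bb = s2a `^ alpha * (2 / rho) `^ (alpha - 1) by rewrite /bb lpnorm_powR.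
have bb0 : 0 <= bb by rewrite mulr_ge0 ?norm2_ge0 ?powR_ge0.
have etaT : eta * T%:R * eps = 2 * D0 ^+ 2.
  by rewrite /eta mulfVK ?gt_eqF// /X -mulrA mulfVK// gt_eqF.
have sqE : inner sigma sigma = sig ^+ 2 by rewrite norm2_sqr.
have sQL : Num.sqrt L * (1024 * (eta * N * l)) <= c0 * Num.sqrt eps.
  apply: (step_size_bound L0 eps0 X0 (ltW A0) (ltW sig0) Kr0 LMT0 d0 Tr0 Hc0 lMT _ hT3).
  by case: HC.
have Q0 : 0 <= 1024 * (eta * N * l).
  apply: mulr_ge0; first by rewrite ler0n.
  by apply: mulr_ge0; [apply: mulr_ge0|]; exact: ltW.
have QL : L * (1024 * (eta * N * l)) ^+ 2 <= c0 ^+ 2 * eps.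
  rewrite -{1}(sqr_sqrtr (ltW L0)) -{1}(sqr_sqrtr (ltW eps0)) -!exprMn.
  have q1 := mulr_ge0 (sqrtr_ge0 L) Q0.
  have q2 := mulr_ge0 (ltW Hc0) (sqrtr_ge0 eps).
  by rewrite ler_pXn2r ?nnegrE.
(* The bound [sQL] again, now with [sqrt eps <= sqrt L * D0]. *)
have QD : 1024 * (eta * N * l) <= c0 * D0.
  have sL0 : 0 < Num.sqrt L by rewrite sqrtr_gt0.
  rewrite -(ler_pM2l sL0) (le_trans sQL)// mulrCA ler_pM2l//.
  have -> : Num.sqrt L * D0 = Num.sqrt (L * D0 ^+ 2).
    by rewrite sqrtrM ?(ltW L0)// sqrtr_sqr ger0_norm.
  by rewrite ler_wsqrtr.
have Ksq : 64 * (K%:R * inner sigma sigma) <= N ^+ 2 * l.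
  have NE : 8 * (sig * Num.sqrt kap) <= N.
    have -> : 8 * (sig * Num.sqrt kap) = Num.sqrt d%:R * (8 * rho1).
      by rewrite /rho1; field; rewrite gt_eqF.
    by rewrite ler_pM2l// ler_pM2l// lerDr ltW.
  have h1 : (8 * (sig * Num.sqrt kap)) ^+ 2 <= N ^+ 2.
    rewrite ler_pXn2r ?nnegrE ?(ltW N0)//.
    by rewrite !mulr_ge0 ?sqrtr_ge0// ltW.
  have E : (8 * (sig * Num.sqrt kap)) ^+ 2 = 64 * (sig ^+ 2 * kap).
    by rewrite !exprMn (sqr_sqrtr (ltW kap0)); ring.
  rewrite E in h1.
  have h2 : 64 * (K%:R * inner sigma sigma) = 64 * (sig ^+ 2 * kap) * LMT.
    by rewrite sqE /kap; field; rewrite gt_eqF.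
  rewrite h2; apply: ler_pM => //; last exact: ltW.
  by rewrite mulr_ge0// mulr_ge0 ?sqr_ge0// ltW.
(* Divided by [LMT], the condition on [K] has the form used by [round_length]; the bias of a round
   is then at most [sqrt d * rho1 * LMT]. *)
have Kb : K%:R * bb <= N * l.
  have hk : (s2a * d%:R `^ (2^-1 - (2 * alpha)^-1) / sig) `^ (2 * alpha / (alpha - 2)) <= kap.
    rewrite /kap ler_pdivlMr// mulrC; apply: le_trans hK.
    rewrite -[C * _ * _]mulrA ler_peMl//; first by rewrite mulr_ge0 ?powR_ge0// ltW.
    exact: ltW.
  have h1 := round_length s2a0 sig0 kap0 d0 a4 hk.
  have := round_bias a4 (ltW kap0) rho10 rho1_2 h1; rewrite -bbE => h2.
  have -> : K%:R * bb = kap * bb * LMT by rewrite /kap; field; rewrite gt_eqF.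
  apply: ler_pM => //; [by rewrite mulr_ge0// ltW|exact: ltW|].
  by apply: (le_trans h2); rewrite ler_pM2l.
have Db : 48 * (D0 * bb) <= eps.
  have hr : 8 * A <= rho by rewrite ler_pM2l// lerDl ltW.
  have := bias_budget a4 a0 rho0 hr.
  have -> : 48 * (D0 * s2a `^ alpha / eps * (2 / rho) `^ (alpha - 1)) =
     48 * (D0 * bb) / eps by rewrite bbE; field; rewrite gt_eqF.
  by rewrite ler_pdivrMr// mul1r.
have etaL : 16 * (eta * L) <= c0 ^+ 2.
  have -> : 16 * (eta * L) = 32 * (X * L) / T%:R by rewrite /eta; field; rewrite gt_eqF.
  rewrite ler_pdivrMr//.
  have XL0 : 0 <= X * L by rewrite mulr_ge0 ?ltW.
  apply: (@le_trans _ _ (C * c0 ^+ 2 * (X * L))).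
    by apply: ler_wpM2r => //; case: HC.
  rewrite (_ : C * c0 ^+ 2 * (X * L) = c0 ^+ 2 * (C * X * L)); last by ring.
  by rewrite ler_pM2l.
have Tsq : 4960 * (l1 * D0 ^+ 2 * inner sigma sigma) <= eps ^+ 2 * T%:R * M%:R.
  rewrite sqE.
  have w0 : 0 <= D0 ^+ 2 * sig ^+ 2 by rewrite mulr_ge0 ?sqr_ge0.
  have h1 : C * (ln (T%:R / delta) * (D0 ^+ 2 * sig ^+ 2)) <= eps ^+ 2 * T%:R * M%:R.
    have e0 : 0 < eps ^+ 2 * M%:R by rewrite mulr_gt0// exprn_gt0.
    have := ler_wpM2l (ltW e0) hT2.
    have -> : eps ^+ 2 * M%:R * (C * X * a2) = C * (ln (T%:R / delta) * (D0 ^+ 2 * sig ^+ 2)).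
      by rewrite /X /a2; field; rewrite !gt_eqF.
    by rewrite [_ * M%:R * T%:R]mulrAC.
  have LTw : 0 <= ln (T%:R / delta) * (D0 ^+ 2 * sig ^+ 2) by rewrite mulr_ge0// ltW.
  apply: (horizon_slack LTw); last first.
    by apply: le_trans h1; apply: ler_wpM2r => //; case: HC.
  by rewrite -mulrA [leRHS]mulrA; exact: ler_wpM2r.
exists eta, rho; split => //; split => //.
apply: (@process_convergence R d M dX Xi dO Om D P K T xi g f (grad f) x0 xstar sigma
  alpha rho L eta beta1 c0 (64 * (eta * N * l) / c0) eps l l1 (4 * l1 / D0 ^+ 2)
  ((32 * eta * (64 * (eta * N * l) / c0) * N)^-1)
  (32 * (eta * N * l) ^+ 2 + 36 * (64 * (eta * N * l) / c0 * (eta * N * l))) delta) => //.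
- move=> x i xO; apply: le_trans (_ : Ginf <= _).
    apply: le_trans (Gle _ xO); exact: (le_bigmax _ (fun i => `|grad f x 0 i|)).
  have G : C * Ginf <= A by apply: le_trans hA; rewrite ler_pM2l// le_max lexx.
  have [G0|G0] := leP Ginf 0; first by rewrite (le_trans G0)// divr_ge0// ltW.
  by apply: le_trans rhoA; apply: le_trans G; rewrite ler_peMl ?ltW.
- by move=> v w vO wO; have [_] := conv _ _ vO wO.
- by apply: ltW; exact: (tuning_B_gt0 eta0 N0 l11 l1l Hc0).
- exact: (tuning_NB eta0 N0 l11 l1l Hc0).
- exact: (tuning_BD Hc0 QD).
- exact: (tuning_LB Hc0 L0 QL).
- exact: (tuning_dpB eta0 N0 l11 l1l Hc0 c1 bb0 Kr1 Kb).
- exact: (tuning_dp0 eta0 N0 l11 l1l Hc0).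
- exact: (tuning_th1_gt0 l11 D00).
- exact: (tuning_th2_gt0 eta0 N0 l11 l1l Hc0).
- exact: (tuning_th1_le eta0 N0 l11 l1l c1 D00 QD).
- exact: (tuning_th2_le eta0 N0 l11 l1l Hc0 c1).
- exact: (tuning_dev1 eta0 N0 l11 l1l c1 eps0 D00 (inner_ge0 _) Mr0 Tr0 etaT QD Tsq).
- exact: (tuning_dev2 eta0 N0 l11 l1l Hc0 c1 Ksq).
- by rewrite (natrM _ (T * M)%N M) (natrM _ T M).
Qed.
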